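(* Let $\vartheta_{\mathbf{P}}=(\vartheta,\mathbf{P})$ be a primitive recognisable random substitution of constant length $\ell$ and assume that at least one of the following holds: (i) $\vartheta(a)$ has the same cardinality for all $a\in\mathcal{A}$; (ii) $\vartheta_{\mathbf{P}}$ is compatible and $\ell$ is the only non-zero eigenvalue of the substitution matrix. Under these hypotheses, the system $(X_\vartheta,S)$ is intrinsically ergodic, i.e. it has a unique measure of maximal entropy (among all shift-invariant Borel probability measures). Moreover, the unique measure of maximal entropy is the frequency measure corresponding to uniform probabilities, i.e. the frequency measure of $\vartheta$ equipped with the probabilities $1/\#\vartheta(a)$ for each $s\in\vartheta(a)$, $a\in\mathcal{A}$.
   Context: $\mathbb{N}=\{1,2,\dots\}$. $\mathcal{A}=\{a_1,\dots,a_d\}$ is a finite alphabet, $\mathcal{A}^+$ the set of non-empty finite words, $|u|$ the length of a word $u$, and $|u|_v$ the number of (possibly overlapping) occurrences of $v$ as a subword of $u$. A random substitution $\vartheta_{\mathbf{P}}=(\vartheta,\mathbf{P})$ is a map $\vartheta$ assigning to each letter $a_i$ a non-empty finite set $\vartheta(a_i)=\{s^{(i,1)},\dots,s^{(i,r_i)}\}\subset\mathcal{A}^+$ of $r_i$ distinct words, together with probability vectors $\mathbf{p}_i=(p_{i,1},\dots,p_{i,r_i})$ with all $p_{i,j}>0$; $\vartheta_{\mathbf{P}}(a_i)$ is the random word equal to $s^{(i,j)}$ with probability $p_{i,j}$. It is extended to words by applying it independently to each letter and concatenating; $(\vartheta_{\mathbf{P}}^n(u))_{n}$ is the Markov chain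 obtained by iterating this with fresh independent choices at each step, starting from $u$. $\mathbb{P},\mathbb{E}$ denote the corresponding probability and expectation, and $\vartheta^n(u)=\{v:\mathbb{P}[\vartheta_{\mathbf{P}}^n(u)=v]>0\}$. It is of constant length $\ell$ ($\ell\ge2$ an integer) if $|s|=\ell$ for all $s\in\vartheta(a)$, $a\in\mathcal{A}$. The substitution matrix is $M_{i,j}=\mathbb{E}[|\vartheta_{\mathbf{P}}(a_j)|_{a_i}]$. $\vartheta_{\mathbf{P}}$ is primitive if $M$ is primitive and its Perron--Frobenius eigenvalue satisfies $\lambda>1$ (independent of the choice of non-degenerate $\mathbf{P}$). It is compatible if for all $a\in\mathcal{A}$, $u,v\in\vartheta(a)$ and $b\in\mathcal{A}$, $|u|_b=|v|_b$. The language $\mathcal{L}_\vartheta$ is the set of words occurring as subwords of some word in $\vartheta^k(a)$, $a\in\mathcal{A}$, $k\in\mathbb{N}$. $X_\vartheta\subset\mathcal{A}^{\mathbb{Z}}$ is the set of bi-infinite sequences all of whose finite subwords lie in $\mathcal{L}_\vartheta$; $S$ is the left shift, $S(x)_i=x_{i+1}$. For $w\in X_\vartheta$, $\vartheta(w)\subset X_\vartheta$ is the set of sequences $\cdots v_{-2}v_{-1}.v_0v_1\cdots$ with $v_j\in\vartheta(w_j)$ for all $j\in\mathbb{Z}$, where $v_0$ starts at position $0$. If all words in $\vartheta(a)$ have a common length $|\vartheta(a)|$ for each $a\in\mathcal{A}$, then $\vartheta_{\mathbf{P}}$ is called recognisable if for every $x\in X_\vartheta$ there exist a unique $y=\cdots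 y_{-1}y_0y_1\cdots\in X_\vartheta$ and a unique integer $k\in\{0,\dots,|\vartheta(y_0)|-1\}$ with $S^{-k}(x)\in\vartheta(y)$. For $v\in\mathcal{L}_\vartheta$, $[v]=\{x\in X_\vartheta: x_0\cdots x_{|v|-1}=v\}$. The frequency measure $\mu_{\mathbf{P}}$ of a primitive $\vartheta_{\mathbf{P}}$ is the unique shift-invariant Borel probability measure on $X_\vartheta$ with $\mu_{\mathbf{P}}([v])=\lim_{k\to\infty}\mathbb{E}[|\vartheta_{\mathbf{P}}^k(a)|_v]/\mathbb{E}[|\vartheta_{\mathbf{P}}^k(a)|]$ for all $v\in\mathcal{L}_\vartheta$ (the limit exists and is independent of $a$; $\mu_{\mathbf{P}}$ is ergodic). A measure of maximal entropy is a shift-invariant Borel probability measure whose measure-theoretic entropy with respect to $S$ equals the topological entropy $h_{\mathrm{top}}(X_\vartheta)$. *)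

(* Defs.v *)
From HB Require Import structures.
From mathcomp Require Import all_boot all_order all_algebra finmap.
From mathcomp Require Import all_classical all_reals all_analysis.
From mathcomp Require Import complex.

Set Implicit Arguments.
Unset Strict Implicit.
Unset Printing Implicit Defensive.

Import Order.TTheory GRing.Theory Num.Theory.
Import numFieldNormedType.Exports.

Local Open Scope classical_set_scope.
Local Open Scope ring_scope.

(* Pointedness encodes that the finite alphabet is non-empty; it makes the
   full shift a pointed type, which [measurableType] requires. *)
#[short(type="alphabetType")]
HB.structure Definition Alphabet := {A of Finite A & Pointed A}.

(* The random substitution (theta, P): [theta a] is the set of possible images
   of the letter a, and [P a s] is the probability of the image s; the values
   of [P a] outside [theta a] play no role. *)
Section random_substitution.
Context {R : realType} {A : alphabetType}.
Implicit Types (theta : A -> {fset seq A}) (P : A -> seq A -> R).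
Implicit Types (a b : A) (u v w : seq A).

Definition random_substitution theta P :=
  [/\ forall a, theta a != fset0,
      forall a s, s \in theta a -> s != [::],
      forall a s, s \in theta a -> 0 < P a s
    & forall a, \sum_(s <- theta a) P a s = 1].

Definition uniform_weights theta : A -> seq A -> R :=
  fun a _ => #|` theta a|%:R^-1.

(* A law with finite support on words is a list of (weight, word) pairs, in
   which a word may be repeated. *)
Definition law_expectation (law : seq (R * seq A)) (f : seq A -> R) : R :=
  \sum_(p <- law) p.1 * f p.2.

Definition prob_eq (law : seq (R * seq A)) v : R :=
  law_expectation law (fun w => (w == v)%:R).

Fixpoint subst_law theta P u : seq (R * seq A) :=
  if u is a :: u' then
    [seq (P a s * q.1, s ++ q.2) | s <- theta a, q <- subst_law theta P u']
  else [:: (1, [::])].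

Fixpoint iter_law theta P (n : nat) u : seq (R * seq A) :=
  if n is n'.+1 then
    [seq (p.1 * q.1, q.2) | p <- iter_law theta P n' u,
                            q <- subst_law theta P p.2]
  else [:: (1, u)].

Fixpoint realisations theta u : seq (seq A) :=
  if u is a :: u' then [seq s ++ w | s <- theta a, w <- realisations theta u']
  else [:: [::]].

Fixpoint iter_realisations theta (n : nat) u : seq (seq A) :=
  if n is n'.+1 then
    [seq w | v <- iter_realisations theta n' u, w <- realisations theta v]
  else [:: u].

Lemma subst_law_supp theta P u :
  [seq p.2 | p <- subst_law theta P u] = realisations theta u.
Proof.
elim: u => //= a u <-; rewrite map_allpairs allpairs_mapr.
by apply: eq_allpairs.
Qed.

Lemma subst_law_gt0 theta P u : random_substitution theta P ->
  all (fun p => 0 < p.1) (subst_law theta P u).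
Proof.
case=> _ _ P0 _; elim: u => [|a u IH] /=; first by rewrite ltr01.
apply/allP => _ /allpairsP[[s q] [/= sa qu ->]] /=.
exact: mulr_gt0 (P0 _ _ sa) (allP IH _ qu).
Qed.

(* The words in [iter_realisations theta n u] are exactly those which
   theta_P^n(u) takes with positive probability, so that the language and the
   subshift below depend on theta only. *)
Lemma iter_realisationsP theta P n u v : random_substitution theta P ->
  (v \in iter_realisations theta n u) = (0 < prob_eq (iter_law theta P n u) v).
Proof.
move=> rs.
have -> : iter_realisations theta n u = [seq p.2 | p <- iter_law theta P n u].
  elim: n => //= n ->; rewrite map_allpairs allpairs_mapl.
  elim: (iter_law _ _ _ _) => //= p s ->; congr (_ ++ _).
  by rewrite -(subst_law_supp _ P) -[LHS]map_comp.
have : all (fun p => 0 < p.1) (iter_law theta P n u).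
  elim: n => [|n IH] /=; first by rewrite ltr01.
  apply/allP => _ /allpairsPdep[p [q [pn qp ->]]] /=.
  exact: mulr_gt0 (allP IH _ pn) (allP (subst_law_gt0 _ rs) _ qp).
rewrite /prob_eq /law_expectation; elim: (iter_law _ _ _ _) => [|p s IH] /=.
  by rewrite big_nil ltxx.
move=> /andP[p0 s0]; rewrite in_cons big_cons IH// eq_sym.
have s1 : 0 <= \sum_(j <- s) j.1 * (j.2 == v)%:R.
  rewrite big_seq sumr_ge0// => q qs.
  by rewrite mulr_ge0// ltW// (allP s0).
case: eqP => _ /=; last by rewrite mulr0 add0r.
by rewrite mulr1 ltr_pwDl.
Qed.

Definition constant_length theta (l : nat) :=
  forall a s, s \in theta a -> size s = l.

Definition compatible theta :=
  forall a u v b, u \in theta a -> v \in theta a -> count_mem b u = count_mem b v.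

Definition occurrences v w : nat :=
  count (fun i => prefix v (drop i w)) (iota 0 (size w)).

(* Rows and columns are indexed by the letters through [enum_val]. *)
Definition subst_matrix theta P : 'M[R]_#|A| :=
  \matrix_(i, j) law_expectation (subst_law theta P [:: enum_val j])
                             (fun w => (count_mem (enum_val i) w)%:R).

Definition primitive_mx n (M : 'M[R]_n) :=
  exists2 k : nat, (0 < k)%N & forall i j, 0 < (M ^+ k) i j.

Definition complex_eigenvalue n (M : 'M[R]_n) (z : R[i]) : bool :=
  eigenvalue (map_mx (real_complex R) M) z.

Definition perron_frobenius n (M : 'M[R]_n) (lambda : R) :=
  complex_eigenvalue M (real_complex R lambda) /\
  forall z, complex_eigenvalue M z -> `|z| <= real_complex R lambda.

Definition primitive theta P :=
  let M := subst_matrix theta P in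
  primitive_mx M /\ exists2 lambda : R, perron_frobenius M lambda & 1 < lambda.

Definition only_nonzero_eigenvalue theta P (c : R) :=
  forall z : R[i], z != 0 ->
    complex_eigenvalue (subst_matrix theta P) z <-> z = real_complex R c.

Definition language theta : set (seq A) :=
  [set v | exists k : nat, exists a w,
    [/\ (0 < k)%N, w \in iter_realisations theta k [:: a] & infix v w]].

End random_substitution.

Definition full_shift (A : alphabetType) := {ptws int -> discrete_topology A}.

HB.instance Definition _ (A : alphabetType) :=
  Topological.copy (full_shift A) {ptws int -> discrete_topology A}.
HB.instance Definition _ (A : alphabetType) :=
  Pointed.copy (full_shift A) (int -> A).

Definition borel_shift (A : alphabetType) :=
  g_sigma_algebraType (@open (full_shift A)).

Section subshift.
Context {A : alphabetType}.
Implicit Types (theta : A -> {fset seq A}) (x y w : int -> A).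

Definition left_shift (m : int) x : int -> A := fun i => x (i + m).

(* The word x_m x_(m+1) ... x_(m+n-1). *)
Definition subword x (m : int) (n : nat) : seq A :=
  [seq x (m + i%:Z) | i <- iota 0 n].

Definition subshift theta : set (full_shift A) :=
  [set x | forall m n, language theta (subword x m n)].

Definition cylinder theta (v : seq A) : set (full_shift A) :=
  [set x | subshift theta x /\ subword x 0 (size v) = v].

(* x is the concatenation ... v_(-1) . v_0 v_1 ... with v_j in theta(w_j),
   where the word v_j occupies the positions c_j, ..., c_(j+1) - 1 of x. *)
Definition subst_sequence theta w : set (int -> A) :=
  [set x | exists (v : int -> seq A) (c : int -> int),
    [/\ forall j, v j \in theta (w j),
        c 0 = 0,
        forall j, c (j + 1) = c j + (size (v j))%:Z
      & forall j, subword x (c j) (size (v j)) = v j]].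

(* The common length |theta(a)| of the words in theta(a), when there is one. *)
Definition subst_length theta (a : A) : nat := \max_(s <- theta a) size s.

Definition recognisable theta :=
  (forall a s t, s \in theta a -> t \in theta a -> size s = size t) /\
  forall x, subshift theta x ->
    exists! yk : (int -> A) * nat,
      [/\ subshift theta yk.1,
          (yk.2 < subst_length theta (yk.1 0))%N
        & subst_sequence theta yk.1 (left_shift (- yk.2%:Z) x)].

End subshift.

Section entropy.
Context {R : realType} {A : alphabetType}.
Implicit Types (X : set (full_shift A)) (mu : probability (borel_shift A) R).

(* A shift-invariant Borel probability measure on the subshift X is a
   shift-invariant Borel probability measure on the full shift which gives
   full measure to the closed set X. *)
Definition invariant_probability X mu :=
  mu X = 1%E /\
  forall B : set (borel_shift A), measurable B -> mu (left_shift 1 @^-1` B) = mu B.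

Definition measurable_partition k (xi : 'I_k -> set (borel_shift A)) :=
  [/\ forall i, measurable (xi i), trivIset setT xi
    & \bigcup_i xi i = setT].

(* An atom of the join of the partitions S^(-i) xi, i < n. *)
Definition join_atom k (xi : 'I_k -> set (borel_shift A)) n
    (f : {ffun 'I_n -> 'I_k}) : set (borel_shift A) :=
  \bigcap_(i : 'I_n) (left_shift (nat_of_ord i)%:Z @^-1` xi (f i)).

(* Null atoms contribute 0, by the convention ln 0 = 0. *)
Definition join_entropy mu k (xi : 'I_k -> set (borel_shift A)) (n : nat) : R :=
  - \sum_(f : {ffun 'I_n -> 'I_k})
      fine (mu (join_atom xi f)) * ln (fine (mu (join_atom xi f))).

Definition partition_entropy mu k (xi : 'I_k -> set (borel_shift A)) : \bar R :=
  limn (fun n => (join_entropy mu xi n / n%:R)%:E).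

Definition measure_entropy mu : \bar R :=
  ereal_sup [set h | exists k (xi : 'I_k -> set (borel_shift A)),
    measurable_partition xi /\ h = partition_entropy mu xi].

Definition open_cover X (U : set (set (full_shift A))) :=
  (forall V, U V -> open V) /\ X `<=` \bigcup_(V in U) V.

(* The join of the covers S^(-i) U, i < n. *)
Definition join_cover (U : set (set (full_shift A))) (n : nat) :
    set (set (full_shift A)) :=
  [set W | exists2 f : 'I_n -> set (full_shift A), forall i, U (f i) &
    W = \bigcap_(i : 'I_n) (left_shift (nat_of_ord i)%:Z @^-1` f i)].

(* The smallest cardinality of a subcover of X, as a real number. *)
Definition cover_number X (U : set (set (full_shift A))) : R :=
  inf [set m%:R | m in [set m | exists2 f : 'I_m -> set (full_shift A),
    forall i, U (f i) & X `<=` \bigcup_i f i]].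

Definition cover_entropy X (U : set (set (full_shift A))) : \bar R :=
  limn (fun n => (ln (cover_number X (join_cover U n)) / n%:R)%:E).

Definition topological_entropy X : \bar R :=
  ereal_sup [set cover_entropy X U | U in open_cover X].

Definition maximal_entropy X mu :=
  invariant_probability X mu /\ measure_entropy mu = topological_entropy X.

Definition frequency_measure (theta : A -> {fset seq A})
    (P : A -> seq A -> R) mu :=
  invariant_probability (subshift theta) mu /\
  forall v a, language theta v ->
    (fun k => law_expectation (iter_law theta P k [:: a])
                          (fun w => (occurrences v w)%:R) /
              law_expectation (iter_law theta P k [:: a])
                          (fun w => (size w)%:R)) @ \oo
    --> fine (mu (cylinder theta v)).

End entropy.

(* Main.v *)
Require Import Defs.
From HB Require Import structures.
From mathcomp Require Import all_boot all_order all_algebra finmap.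
From mathcomp Require Import all_classical all_reals all_analysis.
From mathcomp Require Import complex ring lra zify.

(** Why the theorem holds.

    All words are given uniform weights. The argument rests on a potential: a
    function [G] of letters, extended to words additively, such that
    [G s = G a + ln #theta(a)] for every image [s] of [a], and such that [G] takes
    the same value on all level [k] images of a letter. In case (i) a constant
    works; in case (ii) [G] solves a linear system whose matrix is the substitution
    matrix minus the identity, and 1 is not an eigenvalue
    ([potential_equal_cardinality], [potential_compatible]). Such a [G] has the same
    mean [h] along all points of the subshift ([potential_subword]). Moreover the
    uniform weights are Gibbs weights for [G]: along every history leading from [v]
    to [s] they multiply to [exp (G v - G s)] ([prob_ge]), and recognisability
    bounds the number of histories by [K ^+ k] after [k] steps ([prob_le]).

    The topological entropy is [h]. By the first estimate, [exp (- G)] sums to at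
    most [exp (- G a)] over the level [k] images of [a]; hence the partition
    functions of [- G] over the words of length [n] read in the subshift grow
    subexponentially ([partition_function]). As [G] is about [h n] on these words,
    there are at most [exp (h n + o(n))] of them. By the second estimate, the
    frequency measure of such a word is at most [exp (- h n + o(n))], so that the
    entropy of words under the frequency measure grows at least like [h n]
    ([word_entropy_lower]). Since a subcover of the join of the letter covers leaves
    no more words than it has members, everything is squeezed
    ([topological_entropyE]); the entropy of an invariant measure is read off its
    words because words predict every finite partition ([itinerary_entropy_le]).

    Uniqueness. Let [nu] be an invariant measure of entropy [h]. By recognisability
    almost every point is cut, in one way, into images of letters under [theta^j],
    which are blocks of length [N = l ^ j]. Code a point by the phase of the cutting,
    the sequence of letters and, given these letters, the blocks. The sequence of
    letters is again legal, and weighting it by [exp (- G)] costs nothing by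
    subexponential growth; so [N h] is at most the mean of [G a - ln (cond)], where
    [cond] is the conditional probability under [nu] of the block given its letter
    [a] ([word_entropy_le_blocks], [block_entropy_ge]). But the mean of [G] over
    blocks is [N h] too, and [exp (G a - G s)] is at most the probability of
    obtaining [s] from [a]. Hence the equality case of Gibbs' inequality: given its
    letter, a block is distributed exactly like its random image
    ([block_law_eq]). Counting occurrences of [w] inside blocks and letting [j] grow
    identifies [nu [w]] with the frequency of [w] ([word_measure_unique]).

    The frequencies exist, with a limit that is the same for all letters, by a
    contraction argument of Doeblin type ([has_frequency_ex]); compactness extends
    them from cylinders to a measure ([frequency_measure_ex]). *)

Set Implicit Arguments.
Unset Strict Implicit.
Unset Printing Implicit Defensive.

Import Order.TTheory GRing.Theory Num.Theory.
Import numFieldNormedType.Exports.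

Local Open Scope classical_set_scope.
Local Open Scope ring_scope.


(** * Gibbs' inequality *)

Section gibbs.
Context {R : realType}.

Lemma ln_le_subr1 (x : R) : 0 < x -> ln x <= x - 1.
Proof.
move=> x0; have := @le_ln1Dx R (x - 1).
by rewrite [1 + _]addrC subrK; apply; lra.
Qed.

Lemma ln_lt_subr1 (x : R) : 0 < x -> x != 1 -> ln x < x - 1.
Proof.
move=> x0 x1; have lx : ln x != 0 by rewrite ln_eq0.
by have := expR_gt1Dx lx; rewrite lnK ?posrE// ltrBrDl.
Qed.

Lemma gibbs_term (p q : R) : 0 <= p -> 0 <= q -> (0 < p -> 0 < q) ->
  p * ln q - p * ln p <= q - p.
Proof.
rewrite le0r => /orP[/eqP->|p0] q0 pq; first by rewrite !mul0r !subr0.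
have q1 := pq p0.
rewrite -mulrBr -ln_div ?posrE//.
apply: (@le_trans _ _ (p * (q / p - 1))).
  by rewrite ler_pM2l// ln_le_subr1// divr_gt0.
by rewrite mulrBr mulr1 mulrCA divff ?gt_eqF// mulr1.
Qed.

Lemma gibbs_term_eq (p q : R) : 0 <= p -> 0 <= q -> (0 < p -> 0 < q) ->
  q - p <= p * ln q - p * ln p -> p = q.
Proof.
rewrite le0r => /orP[/eqP->|p0] q0 pq.
  by rewrite !mul0r !subr0 => q0'; apply/eqP; rewrite eq_le q0 q0'.
have q1 := pq p0; rewrite -mulrBr -ln_div ?posrE// => H.
have [|qp] := eqVneq (q / p) 1.
  by move=> /(congr1 ( *%R^~ p)); rewrite mul1r divfK ?gt_eqF.
have : p * ln (q / p) < p * (q / p - 1).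
  by rewrite ltr_pM2l// ln_lt_subr1// divr_gt0.
by rewrite mulrBr mulr1 mulrCA divff ?gt_eqF// mulr1 ltNge H.
Qed.

Context {J : finType}.
Implicit Types p q : J -> R.

Lemma gibbs p q : (forall j, 0 <= p j) -> (forall j, 0 <= q j) ->
  (forall j, 0 < p j -> 0 < q j) -> \sum_j q j <= \sum_j p j ->
  \sum_j p j * ln (q j) <= \sum_j p j * ln (p j).
Proof.
move=> p0 q0 pq s; rewrite -subr_le0 -sumrB.
apply: (@le_trans _ _ (\sum_j (q j - p j))).
  by apply: ler_sum => j _; apply: gibbs_term; rewrite ?p0 ?q0//; exact: pq.
by rewrite sumrB subr_le0.
Qed.

(** The terms [p ln q - p ln p - (q - p)] are nonpositive, and by hypothesis they sum
    to at least 0; so each of them vanishes, and [ln] meets its tangent line at 1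
    only at 1. *)
Lemma gibbs_eq p q : (forall j, 0 <= p j) -> (forall j, 0 <= q j) ->
  (forall j, 0 < p j -> 0 < q j) -> \sum_j q j <= \sum_j p j ->
  \sum_j p j * ln (p j) <= \sum_j p j * ln (q j) -> forall j, p j = q j.
Proof.
move=> p0 q0 pq s H j.
apply: (gibbs_term_eq (p0 j) (q0 j) (pq j)); rewrite leNgt; apply/negP => lt.
have : \sum_j (p j * ln (q j) - p j * ln (p j)) < \sum_j (q j - p j).
  rewrite [ltLHS](bigD1 j)//= [ltRHS](bigD1 j)//=.
  by apply: ltr_leD => //; apply: ler_sum => i _; apply: gibbs_term; rewrite ?p0 ?q0//; exact: pq.
apply/negP; rewrite -leNgt; apply: (@le_trans _ _ 0).
  by rewrite sumrB subr_le0.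
by rewrite sumrB subr_ge0.
Qed.

(** A weight on a finer description of the outcome bounds the entropy of the
    coarser one: the law of a function of [j] dominates each of its atoms. *)
Lemma entropy_le_cross (I : finType) (g : J -> I) p q :
  (forall j, 0 <= p j) -> (forall j, 0 <= q j) ->
  (forall j, 0 < p j -> 0 < q j) -> \sum_j q j <= \sum_j p j ->
  - \sum_i (\sum_(j | g j == i) p j) * ln (\sum_(j | g j == i) p j) <=
  - \sum_j p j * ln (q j).
Proof.
move=> p0 q0 pq s; rewrite lerN2; apply: (le_trans (gibbs p0 q0 pq s)).
rewrite [leLHS](partition_big g xpredT)//=; apply: ler_sum => i _.
rewrite mulr_suml; apply: ler_sum => j /eqP ji.
have := p0 j; rewrite le0r => /orP[/eqP->|pj]; first by rewrite !mul0r.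
rewrite ler_pM2l// ler_ln ?posrE//; last first.
  apply: (lt_le_trans pj); rewrite (bigD1 j) ?ji//= lerDl.
  by rewrite sumr_ge0.
by rewrite (bigD1 j) ?ji//= lerDl sumr_ge0.
Qed.

End gibbs.

(** * Random images of words *)

Section laws.
Context {R : realType} {A : alphabetType}.
Implicit Types (law : seq (R * seq A)) (f g : seq A -> R).

Lemma law_expectationD law f g :
  law_expectation law (fun w => f w + g w) =
  law_expectation law f + law_expectation law g.
Proof.
by rewrite /law_expectation -big_split; apply: eq_bigr => p _; rewrite mulrDr.
Qed.

Lemma law_expectationZ law c f :
  law_expectation law (fun w => c * f w) = c * law_expectation law f.
Proof.
by rewrite /law_expectation mulr_sumr; apply: eq_bigr => p _; rewrite mulrCA.
Qed.

Lemma law_expectation_sum law (I : Type) (r : seq I) (Q : pred I)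
    (F : I -> seq A -> R) :
  law_expectation law (fun w => \sum_(i <- r | Q i) F i w) =
  \sum_(i <- r | Q i) law_expectation law (F i).
Proof.
rewrite /law_expectation exchange_big /=; apply: eq_bigr => p _.
by rewrite mulr_sumr.
Qed.

Lemma eq_law_expectation law f g :
  (forall w, w \in [seq p.2 | p <- law] -> f w = g w) ->
  law_expectation law f = law_expectation law g.
Proof.
move=> fg; rewrite /law_expectation big_seq [RHS]big_seq.
by apply: eq_bigr => p pl; rewrite fg// map_f.
Qed.

Lemma le_law_expectation law f g : all (fun p => 0 < p.1) law ->
  (forall w, w \in [seq p.2 | p <- law] -> f w <= g w) ->
  law_expectation law f <= law_expectation law g.
Proof.
move=> /allP l0 fg; rewrite /law_expectation big_seq [leRHS]big_seq.
by apply: ler_sum => p pl; rewrite ler_pM2l ?l0// fg// map_f.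
Qed.

End laws.

Section words.
Context {A : alphabetType} (theta : A -> {fset seq A}).

Notation img := (iter_realisations theta).

Lemma realisations_catP u v w :
  reflect (exists w1 w2, [/\ w1 \in realisations theta u,
             w2 \in realisations theta v & w = w1 ++ w2])
          (w \in realisations theta (u ++ v)).
Proof.
elim: u w => [|a u IH] w /=.
  apply: (iffP idP) => [wv|[w1 [w2 []]]]; first by exists [::], w; rewrite inE.
  by rewrite inE => /eqP -> ? ->.
apply: (iffP allpairsP) => [[[s x] /= [sa /IH [w1 [w2 [u1 v2 ->]]] ->]]|].
  exists (s ++ w1), w2; split; rewrite ?catA//; apply/allpairsP.
  by exists (s, w1).
move=> [_ [w2 [/allpairsP [[s x] /= [sa xu ->]] v2 ->]]].
exists (s, x ++ w2); split; rewrite ?catA//=.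
by apply/IH; exists x, w2.
Qed.

Lemma iter_realisationsS n u w :
  reflect (exists2 v, v \in img n u & w \in realisations theta v)
          (w \in img n.+1 u).
Proof.
apply: (iffP allpairsPdep) => [[v [w' [vu wv ->]]]|[v vu wv]]; first by exists v.
by exists v, w.
Qed.

Lemma iter_realisationsD n m u w :
  reflect (exists2 v, v \in img n u & w \in img m v) (w \in img (n + m) u).
Proof.
elim: m w => [|m IH] w.
  rewrite addn0; apply: (iffP idP) => [?|[v vu]]; first by exists w; rewrite ?inE.
  by rewrite inE => /eqP ->.
rewrite addnS; apply: (iffP (iter_realisationsS _ _ _)).
  move=> [v /IH [x xu vx] wv]; exists x => //.
  by apply/iter_realisationsS; exists v.
move=> [v vu /iter_realisationsS [x xv wx]]; exists x => //.
by apply/IH; exists v.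
Qed.

Lemma iter_realisations_catP n u v w :
  reflect (exists w1 w2, [/\ w1 \in img n u, w2 \in img n v & w = w1 ++ w2])
          (w \in img n (u ++ v)).
Proof.
elim: n w => [|n IH] w /=.
  rewrite inE; apply: (iffP eqP) => [->|[w1 [w2]]].
    by exists u, v; rewrite !inE.
  by rewrite !inE => -[/eqP -> /eqP -> ->].
apply: (iffP (iter_realisationsS _ _ _)).
  move=> [x /IH [x1 [x2 [xu xv ->]]] /realisations_catP [w1 [w2 [w11 w22 ->]]]].
  exists w1, w2; split => //; apply/iter_realisationsS; first by exists x1.
  by exists x2.
move=> [w1 [w2 [/iter_realisationsS [x1 xu w11]]]].
move=> /iter_realisationsS [x2 xv w22] ->.
exists (x1 ++ x2); first by apply/IH; exists x1, x2.
by apply/realisations_catP; exists w1, w2.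
Qed.

Lemma realisations1 a : realisations theta [:: a] =i theta a.
Proof.
move=> w; apply/allpairsP/idP => [[[s x] /= []]|wa].
  by rewrite inE => sa /eqP -> ->; rewrite cats0.
by exists (w, [::]); rewrite /= cats0 inE.
Qed.

Lemma iter_realisations_nil n : img n [::] =i [:: [::]].
Proof.
elim: n => // n IH w.
apply/idP/idP => [/iter_realisationsS[v]|wn]; first by rewrite IH inE => /eqP -> /=.
move: wn; rewrite inE => /eqP ->; apply/iter_realisationsS.
by exists [::]; rewrite ?IH ?inE.
Qed.

Hypothesis th0 : forall a, theta a != fset0.

Lemma realisations_ex u : exists w, w \in realisations theta u.
Proof.
elim: u => [|a u [w wu]]; first by exists [::]; rewrite inE.
have /fset0Pn [s sa] := th0 a.
by exists (s ++ w); apply/allpairsP; exists (s, w).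
Qed.

Lemma iter_realisations_ex n u : exists w, w \in img n u.
Proof.
elim: n => [|n [v vu]]; first by exists u; rewrite inE.
have [w wv] := realisations_ex v.
by exists w; apply/iter_realisationsS; exists v.
Qed.

Context {l : nat} (hl : constant_length theta l).

Lemma size_realisations u w : w \in realisations theta u ->
  size w = (l * size u)%N.
Proof.
elim: u w => [|a u IH] w /=; first by rewrite inE muln0 => /eqP ->.
move=> /allpairsP[[s x] /= [sa /IH xu ->]].
by rewrite size_cat (hl sa) xu mulnS.
Qed.

Lemma size_iter_realisations n u w : w \in img n u ->
  size w = (l ^ n * size u)%N.
Proof.
elim: n w => [|n IH] w; first by rewrite inE mul1n => /eqP ->.
move=> /iter_realisationsS [v /IH vu /size_realisations ->].
by rewrite vu mulnA expnS.
Qed.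

(** As all images have the same length, the positions of the images of the letters
    of [u] inside [w] do not depend on the choices made. *)
Lemma iter_realisations_flatten n u w : w \in img n u ->
  forall i c, (i < size u)%N ->
  take (l ^ n) (drop (i * l ^ n) w) \in img n [:: nth c u i].
Proof.
elim: u w => // a u IH w.
rewrite -cat1s => /iter_realisations_catP [w1 [w2 [w1a w2u ->]]] [|i] c iu.
  rewrite mul0n drop0 take_size_cat//.
  by rewrite (size_iter_realisations w1a) muln1.
rewrite mulSn addnC -drop_drop drop_size_cat; last first.
  by rewrite (size_iter_realisations w1a) muln1.
exact: IH.
Qed.

Lemma flatten_iter_realisations n u w : size w = (l ^ n * size u)%N ->
  (forall i c, (i < size u)%N ->
    take (l ^ n) (drop (i * l ^ n) w) \in img n [:: nth c u i]) ->
  w \in img n u.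
Proof.
elim: u w => [|a u IH] w sw H.
  by rewrite iter_realisations_nil inE -size_eq0 sw muln0.
rewrite -cat1s; apply/iter_realisations_catP.
exists (take (l ^ n) w), (drop (l ^ n) w); rewrite cat_take_drop; split => //.
  by have := H 0 a isT; rewrite mul0n drop0.
apply: IH => [|i c iu]; first by rewrite size_drop sw mulnS addKn.
by have := H i.+1 c iu; rewrite mulSn addnC drop_drop.
Qed.

End words.

Section random_words.
Context {R : realType} {A : alphabetType}.
Context {theta : A -> {fset seq A}} {P : A -> seq A -> R}.
Hypothesis rs : random_substitution theta P.

Notation img := (iter_realisations theta).

Definition expect n (u : seq A) (f : seq A -> R) : R :=
  law_expectation (iter_law theta P n u) f.

Let E1 u f := law_expectation (subst_law theta P u) f.

Lemma iter_law_supp n u : [seq p.2 | p <- iter_law theta P n u] = img n u.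
Proof.
elim: n => //= n <-; rewrite map_allpairs allpairs_mapl.
elim: (iter_law _ _ _ _) => //= p s ->; congr (_ ++ _).
by rewrite -(subst_law_supp _ P) -[RHS]map_comp.
Qed.

Lemma iter_law_gt0 n u : all (fun p => 0 < p.1) (iter_law theta P n u).
Proof.
elim: n => [|n IH] /=; first by rewrite ltr01.
apply/allP => _ /allpairsPdep[p [q [pn qp ->]]] /=.
exact: mulr_gt0 (allP IH _ pn) (allP (subst_law_gt0 _ rs) _ qp).
Qed.

Lemma eq_expect n u f g : (forall w, w \in img n u -> f w = g w) ->
  expect n u f = expect n u g.
Proof. by move=> fg; apply: eq_law_expectation; rewrite iter_law_supp. Qed.

Lemma le_expect n u f g : (forall w, w \in img n u -> f w <= g w) ->
  expect n u f <= expect n u g.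
Proof.
move=> fg; apply: le_law_expectation; rewrite ?iter_law_supp//.
exact: iter_law_gt0.
Qed.

Lemma expect0 u f : expect 0 u f = f u.
Proof. by rewrite /expect /law_expectation /= big_seq1 mul1r. Qed.

Lemma expectS n u f : expect n.+1 u f = expect n u (fun v => E1 v f).
Proof.
rewrite /expect /E1 /law_expectation /= big_allpairs_dep /=.
apply: eq_bigr => p _; rewrite mulr_sumr; apply: eq_bigr => q _.
by rewrite mulrA.
Qed.

Let E1_nil f : E1 [::] f = f [::].
Proof. by rewrite /E1 /law_expectation /= big_seq1 mul1r. Qed.

Let E1_cons a u f :
  E1 (a :: u) f = \sum_(s <- theta a) P a s * E1 u (fun q => f (s ++ q)).
Proof.
rewrite /E1 /law_expectation /= big_allpairs_dep /=.
apply: eq_bigr => s _; rewrite mulr_sumr; apply: eq_bigr => q _.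
by rewrite mulrA.
Qed.

Lemma expect1_cons a u f : expect 1 (a :: u) f =
  \sum_(s <- theta a) P a s * expect 1 u (fun q => f (s ++ q)).
Proof.
rewrite expectS expect0 E1_cons; apply: eq_bigr => s _.
by rewrite expectS expect0.
Qed.

Let E1_cst u c : E1 u (fun=> c) = c.
Proof.
elim: u => [|a u IH]; first exact: E1_nil.
rewrite E1_cons; under eq_bigr do rewrite IH.
by rewrite -mulr_suml; case: rs => _ _ _ ->; rewrite mul1r.
Qed.

Lemma expect_cst n u c : expect n u (fun=> c) = c.
Proof.
elim: n => [|n IH]; first exact: expect0.
rewrite expectS -[RHS]IH; apply: eq_expect => v _; exact: E1_cst.
Qed.

Lemma expectD n u f g :
  expect n u (fun w => f w + g w) = expect n u f + expect n u g.
Proof. exact: law_expectationD. Qed.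

Lemma expectZ n u c f : expect n u (fun w => c * f w) = c * expect n u f.
Proof. exact: law_expectationZ. Qed.

Lemma expect_sum n u (I : Type) (r : seq I) (Q : pred I)
    (F : I -> seq A -> R) :
  expect n u (fun w => \sum_(i <- r | Q i) F i w) =
  \sum_(i <- r | Q i) expect n u (F i).
Proof. exact: law_expectation_sum. Qed.

Lemma expectB n u f g :
  expect n u (fun w => f w - g w) = expect n u f - expect n u g.
Proof.
rewrite expectD; congr (_ + _); rewrite -mulN1r -expectZ.
by apply: eq_expect => w _; rewrite mulN1r.
Qed.

Lemma expect_ge0 n u f : (forall w, w \in img n u -> 0 <= f w) ->
  0 <= expect n u f.
Proof. by move=> f0; rewrite -(expect_cst n u 0); exact: le_expect. Qed.

Lemma norm_expect n u f : `|expect n u f| <= expect n u (fun w => `|f w|).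
Proof.
rewrite ler_norml -mulN1r -expectZ !le_expect// => w _.
  by rewrite ler_norm.
by rewrite mulN1r lerNl ler_normr lexx orbT.
Qed.

Lemma expect_gt0 n u f w : w \in img n u -> 0 < f w ->
  (forall v, v \in img n u -> 0 <= f v) -> 0 < expect n u f.
Proof.
move=> wn fw f0.
apply: (@lt_le_trans _ _ (expect n u (fun v => f w * (v == w)%:R))).
  by rewrite expectZ mulr_gt0// -(iter_realisationsP _ _ _ rs).
apply: le_expect => v vn; have [->|_] := eqVneq v w; first by rewrite mulr1.
by rewrite mulr0 f0.
Qed.

(** The Markov property. *)
Lemma expect_add n m u f :
  expect (n + m) u f = expect n u (fun v => expect m v f).
Proof.
elim: m f => [|m IH] f.
  by rewrite addn0; apply: eq_expect => v _; rewrite expect0.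
by rewrite addnS expectS IH; apply: eq_expect => v _; rewrite expectS.
Qed.

Let E1_cat u v f : E1 (u ++ v) f = E1 u (fun s => E1 v (fun t => f (s ++ t))).
Proof.
elim: u f => [|a u IH] f /=; first by rewrite E1_nil.
rewrite !E1_cons; apply: eq_bigr => s _; rewrite IH; congr (_ * _).
apply: eq_law_expectation => x _; apply: eq_law_expectation => y _.
by rewrite catA.
Qed.

(** Distinct letters are substituted independently. *)
Lemma expect_cat n u v f :
  expect n (u ++ v) f = expect n u (fun s => expect n v (fun t => f (s ++ t))).
Proof.
elim: n f => [|n IH] f; first by rewrite !expect0.
rewrite !expectS IH; apply: eq_expect => s _.
under eq_expect do rewrite E1_cat.
rewrite /expect /E1 /law_expectation.
under eq_bigr do rewrite mulr_sumr.
rewrite exchange_big /=; apply: eq_bigr => p _.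
rewrite -[X in _ = _ * X]/(expect n.+1 v (fun t => f (p.2 ++ t))) expectS.
by rewrite mulr_sumr; apply: eq_bigr => q _; rewrite mulrCA.
Qed.

Lemma expect_nil n f : expect n [::] f = f [::].
Proof.
elim: n f => [|n IH] f; first exact: expect0.
by rewrite expectS IH E1_nil.
Qed.

End random_words.
Arguments expect {R A} theta P n u f.

(** * Frequencies of almost additive functionals *)

Section almost_additive.
Context {R : realType} {A : alphabetType}.
Implicit Types (F : seq A -> R) (f : A -> R).

(** Counts of occurrences of a word are of this form, the defect coming from the
    occurrences that straddle the junction. *)
Definition almost_additive (D : R) F :=
  F [::] = 0 /\ forall s t, `|F (s ++ t) - (F s + F t)| <= D.

Definition letter_sum f (v : seq A) : R := \sum_(b <- v) f b.

Lemma letter_sum_cat f u v :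
  letter_sum f (u ++ v) = letter_sum f u + letter_sum f v.
Proof. exact: big_cat. Qed.

Lemma letter_sum_cons f a v : letter_sum f (a :: v) = f a + letter_sum f v.
Proof. exact: big_cons. Qed.

Lemma letter_sum_nil f : letter_sum f [::] = 0.
Proof. exact: big_nil. Qed.

Lemma letter_sum1 f a : letter_sum f [:: a] = f a.
Proof. exact: big_seq1. Qed.

Lemma letter_sum_le f g v : (forall a, f a <= g a) ->
  letter_sum f v <= letter_sum g v.
Proof. by move=> fg; exact: ler_sum. Qed.

Lemma letter_sum_cst c v : letter_sum (fun=> c) v = c * (size v)%:R.
Proof. by rewrite /letter_sum big_const_seq count_predT iter_addr_0 mulr_natr. Qed.

Lemma letter_sum_additive f : almost_additive 0 (letter_sum f).
Proof.
split; first exact: letter_sum_nil.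
by move=> s t; rewrite letter_sum_cat subrr normr0.
Qed.

Lemma norm_letter_sum f c v : (forall a, `|f a| <= c) ->
  `|letter_sum f v| <= c * (size v)%:R.
Proof.
move=> fc; rewrite -letter_sum_cst.
by apply: (le_trans (ler_norm_sum _ _ _)); apply: ler_sum.
Qed.

Lemma letter_bound f : exists2 c, 0 <= c & forall a, `|f a| <= c.
Proof.
exists (\sum_a `|f a|); first by rewrite sumr_ge0.
by move=> a; rewrite (bigD1 a)//= lerDl sumr_ge0.
Qed.

End almost_additive.

Section frequencies.
Context {R : realType} {A : alphabetType}.
Context {theta : A -> {fset seq A}} {P : A -> seq A -> R} {l : nat}.
Hypothesis rs : random_substitution theta P.
Hypothesis hl : constant_length theta l.
Hypothesis l2 : (2 <= l)%N.
Hypothesis irr : exists k, forall a b, exists2 w,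
  w \in iter_realisations theta k [:: a] & b \in w.

Notation img := (iter_realisations theta).
Notation "''E' n u f" := (expect theta P n u f) (at level 10, n, u, f at level 8).
Let L (n : nat) : R := (l ^ n)%:R.

Let L_gt0 n : 0 < L n. Proof. by rewrite ltr0n expn_gt0; lia. Qed.
Let LD n m : L (n + m) = L n * L m. Proof. by rewrite /L expnD natrM. Qed.

Lemma length_unbounded (C e : R) : 0 < e ->
  exists J, forall j, (J <= j)%N -> C <= e * (l ^ j)%:R.
Proof.
move=> e0; have [J HJ] : exists J : nat, C / e < J%:R.
  exists (Num.bound `|C / e|); apply: (le_lt_trans (ler_norm _)).
  exact: archi_boundP.
exists J => j Jj; rewrite mulrC -ler_pdivrMr//; apply/ltW/(lt_le_trans HJ).
by rewrite ler_nat (leq_trans Jj)// ltnW// ltn_expl.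
Qed.

Section one_functional.
Variables (D : R) (F : seq A -> R).
Hypothesis aF : almost_additive D F.

Let phi j a := 'E j [:: a] F.

Let D0 : 0 <= D.
Proof. by have [_ /(_ [::] [::])] := aF; apply: le_trans. Qed.

Lemma expect_almost_additive j u :
  `|'E j u F - letter_sum (phi j) u| <= D * (size u)%:R.
Proof.
elim: u => [|a u IH].
  by rewrite expect_nil (proj1 aF) letter_sum_nil subrr normr0 mulr0.
rewrite -cat1s expect_cat letter_sum_cat letter_sum1.
set X := 'E j [:: a] _.
have H : 'E j [:: a] (fun s => 'E j u (fun t => F (s ++ t) - (F s + F t))) =
    X - (phi j a + 'E j u F).
  rewrite -['E j u F](expect_cst rs j [:: a]) -expectD -expectB.
  by apply: eq_expect => s _; rewrite expectB expectD (expect_cst rs).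
have -> : X - (phi j a + letter_sum (phi j) u) =
    X - (phi j a + 'E j u F) + ('E j u F - letter_sum (phi j) u) by lra.
rewrite -H {H X}.
rewrite mulrSr mulrDr mulr1 addrC.
apply: (le_trans (ler_normD _ _)); apply: lerD => //.
apply: (le_trans (norm_expect rs _ _ _)); rewrite -[leRHS](expect_cst rs j [:: a]).
apply: (le_expect rs) => s _.
apply: (le_trans (norm_expect rs _ _ _)); rewrite -[leRHS](expect_cst rs j u).
by apply: (le_expect rs) => t _; case: aF.
Qed.

(** Up to a defect that is small relative to the length when [j] is large, the
    means at level [k + j] are letter sums of the means at level [j]: this is what
    makes the linear contraction below applicable. *)
Lemma expect_almost_additiveD k j a :
  `|phi (k + j) a - 'E k [:: a] (letter_sum (phi j))| <= D * L k.
Proof.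
rewrite /phi expect_add -expectB; apply: (le_trans (norm_expect rs _ _ _)).
rewrite -[leRHS](expect_cst rs k [:: a]); apply: (le_expect rs) => w wk.
have := size_iter_realisations hl wk; rewrite muln1 /L => <-.
exact: expect_almost_additive.
Qed.

Section contraction.
Variables (k : nat) (d : R).
Hypothesis d1 : d <= 1.
Hypothesis kd : forall a b, d * L k <= 'E k [:: a] (fun w => (count_mem b w)%:R).

(** Doeblin's argument: the image of every letter spends a proportion at least
    [d] of its length on a letter where [f] is minimal. *)
Lemma oscillation_contract f c : (forall a b, f a - f b <= c) ->
  forall a b, 'E k [:: a] (letter_sum f) - 'E k [:: b] (letter_sum f) <=
    (1 - d) * c * L k.
Proof.
move=> fc a a'.
have [b fb] : exists b, forall a, f b <= f a.
  exists [arg min_(i < (point : A)) f i]%O.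
  by case: Order.TotalTheory.arg_minP => // i _ Hi a0; exact: Hi.
have c0 : 0 <= c by have := fc b b; rewrite subrr.
have lo : f b * L k <= 'E k [:: a'] (letter_sum f).
  rewrite -[leLHS](expect_cst rs k [:: a']); apply: (le_expect rs) => w wk.
  have := size_iter_realisations hl wk; rewrite muln1 /L => <-.
  by rewrite -letter_sum_cst; exact: letter_sum_le.
suff up : 'E k [:: a] (letter_sum f) <= f b * L k + (1 - d) * c * L k by lra.
have : 'E k [:: a] (letter_sum f) <=
    'E k [:: a] (fun w => (f b + c) * L k - c * (count_mem b w)%:R).
  apply: (le_expect rs) => w wk.
  have := size_iter_realisations hl wk; rewrite muln1 /L => <-.
  elim: {wk} w => [|x w IH] /=; first by rewrite letter_sum_nil !mulr0 subrr.
  rewrite letter_sum_cons natrD mulrDr -[(size w).+1]addn1 natrD mulrDr mulr1.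
  have [->|xb] /= := eqVneq x b; first by rewrite mulr1; lra.
  by rewrite mulr0; have := fc x b; lra.
rewrite expectB (expect_cst rs) expectZ.
have : c * (d * L k) <= c * 'E k [:: a] (fun w => (count_mem b w)%:R).
  exact: ler_wpM2l.
by have := L_gt0 k; nra.
Qed.

Let osc0 : exists2 B, 0 <= B & forall j a b, phi j a - phi j b <= B * L j.
Proof.
have [c c0 Hc] := letter_bound (fun a => F [:: a]).
exists (2 * (D + c)); first by rewrite mulr_ge0// addr_ge0.
have H j a : `|phi j a| <= (D + c) * L j.
  have := expect_almost_additiveD j 0 a; rewrite addn0.
  have : `|'E j [:: a] (letter_sum (phi 0))| <= c * L j.
    apply: (le_trans (norm_expect rs _ _ _)).
    rewrite -[leRHS](expect_cst rs j [:: a]); apply: (le_expect rs) => w wk.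
    have := size_iter_realisations hl wk; rewrite muln1 /L => <-.
    by apply: norm_letter_sum => b; rewrite /phi expect0.
  by rewrite !ler_norml => /andP[] ? ? /andP[] ? ?; apply/andP; split; lra.
move=> j a b; have := H j a; have := H j b.
by rewrite !ler_norml => /andP[] ? ? /andP[] ? ?; lra.
Qed.

(** Each block of [k] levels contracts the oscillation of the normalised means by
    [1 - d], up to a defect [D] that has become negligible beyond level [j0]. *)
Lemma oscillation_decay e : 0 < d -> 0 < e ->
  exists J, forall j, (J <= j)%N -> forall a b, phi j a - phi j b <= e * L j.
Proof.
move=> d0 e0; have [B B0 HB] := osc0.
have [j0 Hj0] : exists j0, forall j, (j0 <= j)%N -> 4 * D <= d * e * L j.
  by apply: length_unbounded; rewrite mulr_gt0.
have step i j : (j0 <= j)%N -> forall a b,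
    phi (i * k + j) a - phi (i * k + j) b <=
    ((1 - d) ^+ i * B + e / 2) * L (i * k + j).
  move=> jj; elim: i => [|i IH] a b.
    rewrite mul0n add0n expr0 mul1r.
    by apply: (le_trans (HB j a b)); rewrite ler_pM2r//; lra.
  have -> : (i.+1 * k + j = k + (i * k + j))%N by rewrite mulSn addnA.
  have j1 : (j0 <= i * k + j)%N by rewrite (leq_trans jj) ?leq_addl.
  move: IH j1; set n := (i * k + j)%N => IH /Hj0 j1.
  have /oscillation_contract/(_ a b) := IH.
  have := expect_almost_additiveD k n a; have := expect_almost_additiveD k n b.
  rewrite !ler_norml => /andP[] h1 _ /andP[] _ h2 h3.
  rewrite LD exprS.
  have := L_gt0 k; have : 4 * D * L k <= d * e * L n * L k by rewrite ler_pM2r.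
  by nra.
have [i Hi] : exists i, (1 - d) ^+ i * B <= e / 2.
  have [B1|B1] := eqVneq B 0; first by exists 0%N; rewrite B1 mulr0; lra.
  have Bp : 0 < B by rewrite lt_neqAle eq_sym B1.
  have : (fun i => (1 - d) ^+ i) @ \oo --> (0 : R).
    by apply: cvg_expr; rewrite ger0_norm ?subr_ge0 // ltrBlDr ltrDl.
  move=> /cvgrPdist_le /(_ (e / 2 / B)) []; first by rewrite !divr_gt0.
  move=> i _ /(_ i (leqnn i)); rewrite sub0r normrN => Hi; exists i.
  by rewrite -ler_pdivlMr// (le_trans (ler_norm _)).
exists (i * k + j0)%N => j ij a b.
have -> : j = (i * k + (j - i * k))%N by lia.
apply: (le_trans (step i _ _ a b)); first by lia.
by rewrite ler_pM2r//; lra.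
Qed.

End contraction.

End one_functional.

Definition has_frequency F (lam : R) :=
  forall e, 0 < e -> exists J, forall j, (J <= j)%N -> forall a,
    `|'E j [:: a] F - lam * L j| <= e * L j.

Lemma positive_lower_bound (I : finType) (f : I -> R) : (forall i, 0 < f i) ->
  exists2 d, 0 < d <= 1 & forall i, d <= f i.
Proof.
move=> f0; pose s := 1 + \sum_i (f i)^-1.
have s1 : 1 <= s by rewrite lerDl sumr_ge0// => i _; rewrite invr_ge0 ltW.
have s0 : 0 < s by apply: lt_le_trans s1.
exists s^-1; first by rewrite invr_gt0 s0 invf_le1.
move=> i; rewrite -[leRHS]invrK lef_pV2 ?posrE ?invr_gt0//.
rewrite /s (bigD1 i)//= addrCA lerDl addr_ge0// sumr_ge0// => j _.
by rewrite invr_ge0 ltW.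
Qed.

(** At the level given by irreducibility every letter has a positive expected count
    in the images of every letter, and there are finitely many pairs of letters. *)
Lemma doeblin : exists k d, [/\ 0 < d, d <= 1 & forall a b : A,
  d * L k <= 'E k [:: a] (fun w => (count_mem b w)%:R)].
Proof.
have [k Hk] := irr; exists k.
have [|d /andP[d0 d1] Hd] := @positive_lower_bound (A * A)%type
    (fun ab => 'E k [:: ab.1] (fun w => (count_mem ab.2 w)%:R) / L k).
  move=> [a b] /=; rewrite divr_gt0//.
  have [w wk bw] := Hk a b; apply: (expect_gt0 rs wk) => //.
  by rewrite ltr0n -has_count has_pred1.
exists d; split => // a b; rewrite -ler_pdivlMr//; exact: (Hd (a, b)).
Qed.

(** The normalised means form a Cauchy sequence, uniformly in the letter: at level
    [n] they average those of level [J], whose oscillation is small. *)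
Lemma has_frequency_ex D F : almost_additive D F ->
  exists lam, has_frequency F lam.
Proof.
move=> aF; have [k [d [d0 d1 kd]]] := doeblin.
have D0 : 0 <= D by have [_ /(_ [::] [::])] := aF; apply: le_trans.
have close e : 0 < e -> exists J, forall n, (J <= n)%N -> forall a b,
    `|'E n [:: a] F / L n - 'E J [:: b] F / L J| <= e.
  move=> e0; have e2 : 0 < e / 2 by rewrite divr_gt0.
  have [J1 H1] := oscillation_decay aF d1 kd d0 e2.
  have [J2 H2] := length_unbounded D e2.
  exists (maxn J1 J2) => n Jn a b; set J := maxn J1 J2 in Jn *.
  have -> : n = (n - J + J)%N by lia.
  set k' := (n - J)%N; have {}H1 := H1 J (leq_maxl _ _).
  have {}H2 := H2 J (leq_maxr _ _).
  have h1 := expect_almost_additiveD aF k' J a.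
  have h2 : `|'E k' [:: a] (letter_sum (fun a => 'E J [:: a] F)) -
      'E J [:: b] F * L k'| <= e / 2 * L J * L k'.
    rewrite -[X in _ - X](expect_cst rs k' [:: a]) -expectB.
    apply: (le_trans (norm_expect rs _ _ _)).
    rewrite -[leRHS](expect_cst rs k' [:: a]); apply: (le_expect rs) => w wk.
    have := size_iter_realisations hl wk; rewrite muln1 /L => <-.
    elim: {wk} w => [|x w IH]; first by rewrite letter_sum_nil !mulr0 subrr normr0.
    rewrite letter_sum_cons -[size _]/(size w).+1 -addn1 natrD.
    have := H1 x b; have := H1 b x; move: IH; rewrite !ler_norml.
    by move=> /andP[] ? ? ? ?; apply/andP; split; lra.
  have LL : L (k' + J) = L k' * L J by exact: LD.
  rewrite LL -(ler_pM2r (mulr_gt0 (L_gt0 k') (L_gt0 J))).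
  rewrite -[X in _ * X](@gtr0_norm _ (L k' * L J)) ?mulr_gt0// -normrM.
  rewrite mulrBl divfK ?gt_eqF ?mulr_gt0// mulrCA divfK ?gt_eqF//.
  have : D * L k' <= e / 2 * L J * L k' by rewrite ler_pM2r.
  move: h1 h2; rewrite !ler_norml => /andP[] ? ? /andP[] ? ? ?.
  by apply/andP; split; lra.
pose u n := 'E n [:: (point : A)] F / L n.
have cu : cvgn u.
  apply/cauchy_cvgP/cauchy_exP => e e0.
  have [|J HJ] := close (e / 2); first by rewrite divr_gt0.
  exists (u J); exists J => // n /= Jn; rewrite /ball /= distrC.
  by apply: (le_lt_trans (HJ n Jn _ _)); lra.
exists (limn u) => e e0.
have e2 : 0 < e / 2 by rewrite divr_gt0.
have [J HJ] := close _ e2; exists J => n Jn a.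
have h : `|u J - limn u| <= e / 2.
  have : (fun n => `|u J - u n|) @ \oo --> `|u J - limn u|.
    by apply: cvg_norm; apply: cvgB => //; exact: cvg_cst.
  move=> h; rewrite -(cvg_lim (@Rhausdorff R) h); apply: limr_le.
    by apply/cvg_ex; exists `|u J - limn u|.
  by exists J => // m /= Jm; rewrite distrC HJ.
have := HJ n Jn a point; rewrite -/(u J) => h2.
rewrite -['E n [:: a] F](@divfK _ (L n)) ?gt_eqF// -mulrBl normrM (gtr0_norm (L_gt0 n)).
rewrite ler_pM2r// -[_ - _](subrKA (u J)); apply: (le_trans (ler_normD _ _)).
by lra.
Qed.

Lemma has_frequency_unique F x y :
  has_frequency F x -> has_frequency F y -> x = y.
Proof.
move=> Hx Hy; apply/eqP; rewrite -subr_eq0 -normr_le0.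
apply/ler_addgt0Pr => e e0; rewrite add0r; have e2 : 0 < e / 2 by rewrite divr_gt0.
have [J1 H1] := Hx _ e2; have [J2 H2] := Hy _ e2.
have := H1 _ (leq_maxl J1 J2) point; have := H2 _ (leq_maxr J1 J2) point.
set j := maxn _ _; have := L_gt0 j.
set z := 'E _ _ _ => Lj h1 h2; rewrite -(ler_pM2r Lj).
suff : `|(x - y) * L j| <= e * L j by rewrite normrM (gtr0_norm Lj).
move: h1 h2; rewrite !ler_norml => /andP[] ? ? /andP[] ? ?.
by apply/andP; split; lra.
Qed.

Lemma has_frequencyD F G x y : has_frequency F x -> has_frequency G y ->
  has_frequency (fun w => F w + G w) (x + y).
Proof.
move=> Hx Hy e e0; have e2 : 0 < e / 2 by rewrite divr_gt0.
have [J1 H1] := Hx _ e2; have [J2 H2] := Hy _ e2.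
exists (maxn J1 J2) => j Jj a; rewrite expectD.
have := H1 j (leq_trans (leq_maxl _ _) Jj) a.
have := H2 j (leq_trans (leq_maxr _ _) Jj) a.
by rewrite !ler_norml => /andP[] ? ? /andP[] ? ?; apply/andP; split; lra.
Qed.

(** Frequencies do not see bounded perturbations, such as boundary terms. *)
Lemma has_frequency_bounded F G C x : has_frequency F x ->
  (forall w, `|F w - G w| <= C) -> has_frequency G x.
Proof.
move=> Hx FG e e0; have e2 : 0 < e / 2 by rewrite divr_gt0.
have [J1 H1] := Hx _ e2; have [J2 H2] := length_unbounded C e2.
exists (maxn J1 J2) => j Jj a.
have h1 := H1 j (leq_trans (leq_maxl _ _) Jj) a.
have h2 := H2 j (leq_trans (leq_maxr _ _) Jj).
have : `|'E j [:: a] F - 'E j [:: a] G| <= C.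
  rewrite -expectB; apply: (le_trans (norm_expect rs _ _ _)).
  by rewrite -[leRHS](expect_cst rs j [:: a]); apply: (le_expect rs).
move: h1 h2; rewrite -/(L j) !ler_norml.
by move=> /andP[] ? ? ? /andP[] ? ?; apply/andP; split; lra.
Qed.

Lemma has_frequency_le F G C x y : has_frequency F x -> has_frequency G y ->
  (forall w, F w <= G w + C) -> x <= y.
Proof.
move=> Hx Hy FG; apply/ler_addgt0Pr => z z0.
have e2 : 0 < z / 3 by rewrite divr_gt0.
have [J1 H1] := Hx _ e2; have [J2 H2] := Hy _ e2.
have [J3 H3] := length_unbounded C e2.
pose j := maxn J1 (maxn J2 J3).
have := H1 j (leq_maxl _ _) point.
have := H2 j _ point; rewrite {1}/j => /(_ ltac:(lia)).
have := H3 j; rewrite {1}/j => /(_ ltac:(lia)).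
have : 'E j [:: (point : A)] F <= 'E j [:: (point : A)] G + C.
  rewrite -[C](expect_cst rs j [:: (point : A)]) -expectD.
  exact: (le_expect rs).
rewrite -/(L j) !ler_norml => ? ? /andP[] ? ? /andP[] ? ?.
have Lj := L_gt0 j; rewrite -(ler_pM2r Lj).
by lra.
Qed.

Lemma has_frequency_cst x : has_frequency (fun w => x * (size w)%:R) x.
Proof.
move=> e e0; exists 0%N => j _ a.
have -> : 'E j [:: a] (fun w => x * (size w)%:R) = x * L j.
  rewrite -[RHS](expect_cst rs j [:: a]); apply: eq_expect => w wk.
  by rewrite (size_iter_realisations hl wk) muln1.
by rewrite subrr normr0 mulr_ge0// ltW.
Qed.

(** The letter [a] has a positive frequency, and by superadditivity each of its
    occurrences contributes at least the mean of [F] over its level [k] images. *)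
Lemma has_frequency_gt0 F D x k a w : almost_additive D F -> has_frequency F x ->
  (forall v, 0 <= F v) -> (forall s t, F s + F t <= F (s ++ t)) ->
  w \in img k [:: a] -> 0 < F w -> 0 < x.
Proof.
move=> aF Hx F0 Fsup wk Fw.
have [k0 [d [d0 d1 kd]]] := doeblin.
have Fk : 0 < 'E k [:: a] F by exact: (expect_gt0 rs wk).
(* superadditivity transports the mean over [a] to all large levels *)
have lo j b : 'E k [:: a] F * 'E j [:: b] (fun v => (count_mem a v)%:R) <=
    'E (j + k) [:: b] F.
  rewrite expect_add -expectZ; apply: (le_expect rs) => v _.
  elim: v => [|c v IH]; first by rewrite expect_nil mulr0 F0.
  rewrite -(cat1s c v) expect_cat.
  apply: (@le_trans _ _ ('E k [:: c] F + 'E k v F)).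
    rewrite count_cat natrD mulrDr lerD//= addn0.
    have [->|_] := eqVneq c a; first by rewrite mulr1.
    by rewrite mulr0 (expect_ge0 rs).
  rewrite -['E k v F](expect_cst rs k [:: c]) -expectD.
  apply: (le_expect rs) => s _.
  rewrite -[F s](expect_cst rs k v) -expectD.
  by apply: (le_expect rs) => t _.
have up j b : d * L (j + k0) <= 'E (j + k0) [:: b] (fun v => (count_mem a v)%:R).
  rewrite expect_add LD mulrCA -[leLHS](expect_cst rs j [:: b]).
  apply: (le_expect rs) => v vj.
  have := size_iter_realisations hl vj; rewrite muln1 /L => <-.
  elim: {vj} v => [|c v IH].
    by rewrite mul0r (expect_ge0 rs).
  rewrite -(cat1s c v) expect_cat size_cat natrD mulrDl mul1r.
  apply: (le_trans (lerD (kd c a) IH)).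
  rewrite -[X in _ + X](expect_cst rs k0 [:: c]) -expectD.
  apply: (le_expect rs) => s _.
  rewrite -[(count_mem a s)%:R](expect_cst rs k0 v) -expectD.
  by apply: (le_expect rs) => t _; rewrite count_cat natrD.
pose e := 'E k [:: a] F * d / L k.
have e0 : 0 < e by rewrite divr_gt0// mulr_gt0.
apply: (@lt_le_trans _ _ (e / 2)); first by rewrite divr_gt0.
have [J HJ] := Hx _ (divr_gt0 e0 (ltr0n R 2)).
have := HJ (J + k0 + k)%N _ point; rewrite -addnA => /(_ (leq_addr _ _)).
rewrite addnA ler_norml => /andP[_ H].
have h1 := lo (J + k0)%N point.
have h2 : e * L (J + k0 + k) <= 'E (J + k0 + k) [:: point] F.
  apply: (le_trans _ h1); rewrite LD /e mulrCA divfK ?gt_eqF//.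
  by rewrite mulrC -mulrA ler_pM2l.
have Lj := L_gt0 (J + k0 + k); rewrite -(ler_pM2r Lj).
by lra.
Qed.

End frequencies.
Arguments has_frequency {R A} theta P l F lam.

(** * Topology and Borel sets of the full shift *)

Section full_shift.
Context {A : alphabetType}.
Implicit Types (x y : int -> A) (C : set (full_shift A)).

Definition agree (n : nat) x y := forall i : int, (`|i| <= n)%N -> x i = y i.

(** Finite unions of cylinders, recorded with the window that they depend on. *)
Definition local (n : nat) (C : set (int -> A)) :=
  forall x y, agree n x y -> C x -> C y.

Lemma agree_sym n x y : agree n x y -> agree n y x.
Proof. by move=> h i ni; rewrite h. Qed.

Lemma agreeW m n x y : (m <= n)%N -> agree n x y -> agree m x y.
Proof. by move=> mn h i im; apply: h; rewrite (leq_trans im). Qed.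

Lemma localW m n C : (m <= n)%N -> local m C -> local n C.
Proof. by move=> mn lC x y /(agreeW mn); exact: lC. Qed.

Lemma localC n C : local n C -> local n (~` C).
Proof. by move=> lC x y /agree_sym xy Cx /(lC _ _ xy). Qed.

Lemma localI n C D : local n C -> local n D -> local n (C `&` D).
Proof. by move=> lC lD x y xy [/(lC _ _ xy) ? /(lD _ _ xy)]. Qed.

Lemma localU n C D : local n C -> local n D -> local n (C `|` D).
Proof.
by move=> lC lD x y xy [/(lC _ _ xy) ?|/(lD _ _ xy) ?]; [left|right].
Qed.

Lemma local0 n : local n (set0 : set (int -> A)). Proof. by []. Qed.

Lemma localT n : local n (setT : set (int -> A)). Proof. by []. Qed.

Lemma local_shift n (m : int) C : local n C ->
  local (n + `|m|) (left_shift m @^-1` C).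
Proof.
move=> lC x y xy; apply: lC => i ni; apply: xy.
by lia.
Qed.

Lemma agree_nbhs n (x : full_shift A) : nbhs x [set y | agree n x y].
Proof.
have H (i : int) : nbhs x [set y : full_shift A | x i = y i].
  have nx : nbhs (proj i x : discrete_topology A) [set x i].
    exact/principal_filterP.
  have H := @proj_continuous int (fun=> discrete_topology A) i x _ nx.
  have /= {}H : nbhs x (proj i @^-1` [set x i]) := H.
  by rewrite (_ : [set _ | _] = proj i @^-1` [set x i])//; apply/seteqP; split.
have Hs (s : seq int) : nbhs x [set y : full_shift A | {in s, x =1 y}].
  elim: s => [|i s IH]; first by apply: filterS filterT.
  apply: filterS (filterI (H i) IH) => y [xi xs] j.
  by rewrite inE => /predU1P[->//|]; exact: xs.
apply: filterS (Hs [seq k%:Z - n%:Z | k <- iota 0 (n + n).+1]) => y xy i ni.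
apply: xy; apply/mapP; exists `|(i + n%:Z)%R|%N; first by rewrite mem_iota; lia.
by lia.
Qed.

Lemma nbhs_agree (x : full_shift A) U : nbhs x U ->
  exists n, forall y, agree n x y -> U y.
Proof.
pose G := filter_from [set: nat] (fun n => [set y : full_shift A | agree n x y]).
have FG : Filter G.
  apply: filter_fromT_filter; first by exists 0%N.
  move=> i j; exists (maxn i j) => y /= xy.
  by split; apply: agreeW xy; rewrite ?leq_maxl ?leq_maxr.
suff : G --> x by move=> /(_ U) /[apply] -[n _ nU]; exists n => y /nU.
apply/cvg_sup => i V [W] [[Z] oZ <-] Zx WV.
by exists `|i|%N => // y xy; apply: WV; rewrite /= -(xy i).
Qed.

Lemma local_open n C : local n C -> open C.
Proof.
move=> lC; rewrite openE => x Cx; apply: filterS (agree_nbhs n x) => y xy.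
exact: lC Cx.
Qed.

Lemma local_closed n C : local n C -> closed C.
Proof. by move=> /localC/local_open; rewrite -closedC setCK. Qed.

Lemma full_shift_compact : compact [set: full_shift A].
Proof.
have := @tychonoff int (fun=> discrete_topology A) (fun=> setT).
move=> /(_ _); rewrite (_ : [set _ | _] = setT); last by apply/seteqP.
apply => i; apply: finite_compact; exact: finite_finset.
Qed.

(** The form in which compactness of the full shift is used throughout. *)
Lemma decreasing_closed_meet (B : nat -> set (full_shift A)) :
  (forall n, closed (B n)) -> (forall n, B n.+1 `<=` B n) ->
  (forall n, B n !=set0) -> exists x, forall n, B n x.
Proof.
move=> cB dB nB.
have dB' m n : (m <= n)%N -> B n `<=` B m.
  move=> /subnK <-; elim: (n - m)%N => // k IH; rewrite addSn.
  exact: subset_trans (dB _) IH.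
pose G := filter_from [set: nat] B.
have FG : ProperFilter G.
  apply: filter_from_proper => [|n _]; last exact: nB.
  apply: filter_fromT_filter; first by exists 0%N.
  move=> i j; exists (maxn i j) => y Bx.
  by split; apply: dB' Bx; rewrite ?leq_maxl ?leq_maxr.
have [|x [_ xG]] := full_shift_compact FG; first by exists 0%N.
exists x => n; apply: cB => V Vx; have [] := xG (B n) V _ Vx; first by exists n.
by move=> y [By Vy]; exists y.
Qed.

(** Lebesgue number of an open cover, for the windows [[-n, n]]. *)
Lemma lebesgue_window C (U : set (set (full_shift A))) : closed C ->
  (forall V, U V -> open V) -> C `<=` \bigcup_(V in U) V ->
  exists n, forall x, C x -> exists2 V, U V & forall y, agree n x y -> V y.
Proof.
move=> cC oU CU; apply/not_existsP => H.
pose B n := C `&` [set x | forall V, U V -> ~ (forall y, agree n x y -> V y)].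
have [||n|x Bx] := @decreasing_closed_meet B.
- move=> n; apply: closedI => //; apply: (@local_closed n) => x y xy + V UV h.
  by move=> /(_ V UV); apply => z xz; apply: h => i ni; rewrite -xy// xz.
- move=> n x [Cx Bx]; split => // V UV h; apply: (Bx V UV) => y xy.
  by apply: h; apply: agreeW xy.
- have /existsNP[x /not_implyP[Cx /forall2NP h]] := H n.
  by exists x; split => // V UV h'; case: (h V).
have [V UV Vx] := CU x (Bx 0%N).1.
have [n nV] := nbhs_agree (open_nbhs_nbhs (conj (oU V UV) Vx)).
exact: ((Bx n).2 V UV).
Qed.

Lemma separating_window C D : closed C -> closed D -> C `&` D = set0 ->
  exists n, forall x y, C x -> D y -> ~ agree n x y.
Proof.
move=> cC cD CD.
have [||n Hn] := @lebesgue_window C [set ~` D] cC.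
- by move=> V ->; rewrite openC.
- move=> x Cx; exists (~` D) => // Dx.
  by have : (C `&` D) x by []; rewrite CD.
exists n => x y Cx Dy xy; have [V -> /(_ y xy)] := Hn x Cx; exact.
Qed.

Lemma left_shift0 x : left_shift 0 x = x.
Proof. by apply/funext => i; rewrite /left_shift addr0. Qed.

Lemma left_shiftD m n x : left_shift m (left_shift n x) = left_shift (m + n) x.
Proof. by apply/funext => i; rewrite /left_shift addrA. Qed.

Definition window (n : nat) x : (n + n).+1.-tuple A :=
  [tuple x (k%:Z - n%:Z) | k < (n + n).+1].

Lemma windowP n x y : window n x = window n y <-> agree n x y.
Proof.
split=> [xy i ni|xy]; last by apply: eq_mktuple => k; apply: xy; have := ltn_ord k; lia.
have k1 : (`|(i + n%:Z)%R| < (n + n).+1)%N by lia.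
have := congr1 (fun t => tnth t (Ordinal k1)) xy.
by rewrite !tnth_mktuple /= (_ : `|(i + n%:Z)%R|%N%:Z - n%:Z = i) //; lia.
Qed.

Definition word (n : nat) x : n.-tuple A := [tuple x i%:Z | i < n].

Lemma val_word n x : val (word n x) = subword x 0 n.
Proof.
rewrite /subword -val_enum_ord -map_comp; apply: eq_map => i /=.
by rewrite add0r.
Qed.

Lemma word_local n w : local n [set x | word n x = w].
Proof.
move=> x y xy <-; apply: eq_mktuple => k; rewrite -xy//.
by have := ltn_ord k; lia.
Qed.

End full_shift.

Section measurability.
Context {A : alphabetType}.
Implicit Types (C : set (borel_shift A)).

Lemma open_measurable_shift C : open (C : set (full_shift A)) -> measurable C.
Proof. by move=> oC; apply: sub_sigma_algebra. Qed.

Lemma closed_measurable_shift C :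
  closed (C : set (full_shift A)) -> measurable C.
Proof.
move=> cC; rewrite -[C]setCK; apply: measurableC.
by apply: open_measurable_shift; rewrite openC.
Qed.

Lemma local_measurable n C : local n C -> measurable C.
Proof. by move=> /local_open/open_measurable_shift. Qed.

Lemma open_bigcup_local C : open (C : set (full_shift A)) ->
  C = \bigcup_n [set x | forall y, agree n x y -> C y].
Proof.
move=> oC; apply/seteqP; split=> [x Cx|x [n _ /(_ x)]]; last exact.
have [n nC] := nbhs_agree (open_nbhs_nbhs (conj oC Cx)).
by exists n.
Qed.

Lemma interior_window_local n C : local n [set x | forall y, agree n x y -> C y].
Proof.
by move=> x y xy /= h z yz; apply: h => i ni; rewrite xy// yz.
Qed.

(** An open set is the countable union of the local sets that it contains. *)
Lemma borel_shift_generated (D : set (set (borel_shift A))) :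
  sigma_algebra setT D -> (forall n C, local n C -> D C) ->
  forall C, measurable C -> D C.
Proof.
move=> sD lD; apply: smallest_sub => // C oC.
rewrite (open_bigcup_local oC); have [_ _ sU] := sD; apply: sU => n.
apply: (lD n); exact: interior_window_local.
Qed.

Lemma left_shift_measurable (m : int) C : measurable C ->
  measurable (left_shift m @^-1` C : set (borel_shift A)).
Proof.
move: C; apply: borel_shift_generated.
  split=> [|C mC|F mF].
  - by rewrite /= preimage_set0.
  - by rewrite /= setTD preimage_setC; exact: measurableC.
  - by rewrite /= preimage_bigcup; exact: bigcupT_measurable.
move=> n C lC; apply: (@local_measurable (n + `|m|)%N); exact: local_shift.
Qed.

End measurability.

(** * Finite observables and invariant measures *)

Section probability.
Context {R : realType} {A : alphabetType}.
Variable nu : probability (borel_shift A) R.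
Implicit Types (B C : set (borel_shift A)).

Definition pr B : R := fine (nu B).

Lemma prE B : measurable B -> nu B = (pr B)%:E.
Proof. by move=> mB; rewrite /pr fineK// fin_num_measure. Qed.

Lemma pr_ge0 B : 0 <= pr B.
Proof. exact: fine_ge0. Qed.

Lemma pr_le B C : measurable B -> measurable C -> B `<=` C -> pr B <= pr C.
Proof.
by move=> mB mC BC; rewrite -lee_fin -!prE//; apply: le_measure; rewrite ?inE.
Qed.

Lemma prT : pr setT = 1.
Proof. by rewrite /pr probability_setT. Qed.

Lemma pr0 : pr set0 = 0.
Proof. by rewrite /pr measure0. Qed.

Lemma pr_disjointU B C : measurable B -> measurable C -> B `&` C = set0 ->
  pr (B `|` C) = pr B + pr C.
Proof.
move=> mB mC BC; rewrite /pr measureU// fineD// fin_num_measure//.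
Qed.

Lemma pr_subU B C D : measurable B -> measurable C -> measurable D ->
  B `<=` C `|` D -> pr B <= pr C + pr D.
Proof.
move=> mB mC mD BCD.
have CDC : C `|` D = C `|` (D `\` C).
  apply/seteqP; split=> x [Cx|]; [by left| |by left|by case=> ? _; right].
  by move=> Dx; have [Cx|Cx] := pselect (C x); [left|right].
apply: (@le_trans _ _ (pr (C `|` D))); first exact: pr_le (measurableU _ _ _ _) _.
rewrite CDC pr_disjointU//; last 2 first.
- exact: measurableD.
- by rewrite setIDA setIC -setIDA setDv setI0.
by rewrite lerD2l pr_le//; exact: measurableD.
Qed.

Lemma prC B : measurable B -> pr (~` B) = 1 - pr B.
Proof.
move=> mB; have := @pr_disjointU B (~` B) mB (measurableC mB) (setICr _).
by rewrite setUCr prT => ->; rewrite addrC addKr.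
Qed.

Lemma pr_eq_on X B C : measurable X -> nu X = 1%E -> measurable B ->
  measurable C -> X `&` B = X `&` C -> pr B = pr C.
Proof.
move=> mX X1 mB mC XBC.
have Xc : pr (~` X) = 0 by rewrite prC// /pr X1 subrr.
have H D : measurable D -> pr D = pr (X `&` D).
  move=> mD; apply/eqP; rewrite eq_le; apply/andP; split; last first.
    by apply: pr_le => //; exact: measurableI.
  rewrite -[leRHS]addr0 -Xc; apply: pr_subU => //.
  - exact: measurableI.
  - exact: measurableC.
  by move=> x Dx; have [Xx|Xx] := pselect (X x); [left|right].
by rewrite H// [RHS]H// XBC.
Qed.

Section law.
Context {J : finType}.
Implicit Types (Phi : borel_shift A -> J).

Definition observable Phi := forall j, measurable (Phi @^-1` [set j]).

Definition law Phi (j : J) : R := pr (Phi @^-1` [set j]).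

Lemma law_ge0 Phi j : 0 <= law Phi j.
Proof. exact: pr_ge0. Qed.

Lemma observable_pred Phi (Q : pred J) : observable Phi -> measurable [set x | Q (Phi x)].
Proof.
move=> mPhi; rewrite (_ : [set x | _] =
    \bigcup_(j in [set` Q]) (Phi @^-1` [set j])); last first.
  apply/seteqP; split=> [x Qx|x [j Qj /= ->]//].
  by exists (Phi x).
by apply: fin_bigcup_measurable; [exact: finite_finset|move=> j _; exact: mPhi].
Qed.

Lemma pr_pred Phi (Q : pred J) : observable Phi ->
  pr [set x | Q (Phi x)] = \sum_(j | Q j) law Phi j.
Proof.
move=> mPhi; rewrite -big_filter.
have : forall s : seq J, uniq s ->
    pr [set x | Phi x \in s] = \sum_(j <- s) law Phi j.
  elim=> [|j s IH] /=; first by rewrite big_nil (_ : [set _ | _] = set0)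
    ?pr0//; apply/seteqP; split=> x //=; rewrite in_nil.
  move=> /andP[js us]; rewrite big_cons -IH// /law -pr_disjointU//.
  - congr pr; apply/seteqP; split=> x /=; rewrite inE.
      by move=> /orP[/eqP|]; [left|right].
    by move=> [->|->]; rewrite ?eqxx ?orbT.
  - exact: (@observable_pred Phi (mem s)).
  - by apply/seteqP; split=> // x [/= -> /=]; apply/negP.
move=> <-; last by rewrite filter_uniq// index_enum_uniq.
by congr pr; apply/seteqP; split=> x /=; rewrite mem_filter mem_index_enum andbT.
Qed.

Lemma law_sum1 Phi : observable Phi -> \sum_j law Phi j = 1.
Proof.
by move=> mPhi; rewrite -(pr_pred xpredT mPhi) -prT; congr pr; apply/seteqP.
Qed.

End law.

Lemma observable_comp (I J : finType) (g : J -> I) (Phi : borel_shift A -> J) :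
  observable Phi -> observable (g \o Phi).
Proof.
move=> mPhi i; have := observable_pred [pred j | g j == i] mPhi.
by congr measurable; apply/seteqP; split=> x /= /eqP.
Qed.

Lemma law_comp (I J : finType) (g : J -> I) (Phi : borel_shift A -> J) i :
  observable Phi -> law (g \o Phi) i = \sum_(j | g j == i) law Phi j.
Proof.
move=> mPhi; rewrite -(pr_pred _ mPhi); congr pr.
by apply/seteqP; split=> x /= /eqP.
Qed.

Lemma observable_pair (I J : finType) (Phi : borel_shift A -> I)
    (Psi : borel_shift A -> J) :
  observable Phi -> observable Psi -> observable (fun x => (Phi x, Psi x)).
Proof.
move=> mPhi mPsi [i j].
rewrite (_ : _ @^-1` _ = (Phi @^-1` [set i]) `&` (Psi @^-1` [set j])).
  exact: measurableI.
by apply/seteqP; split=> x /= [-> ->].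
Qed.

Lemma observable_ffun (I J : finType) (Phi : I -> borel_shift A -> J) :
  (forall i, observable (Phi i)) -> observable (fun x => [ffun i => Phi i x]).
Proof.
move=> mPhi f.
rewrite (_ : _ @^-1` _ = \bigcap_(i in setT) (Phi i @^-1` [set f i])).
  by apply: fin_bigcap_measurable => // i _; exact: mPhi.
apply/seteqP; split=> x /=; first by move=> <- i _ /=; rewrite ffunE.
by move=> H; apply/ffunP => i; rewrite ffunE; exact: H.
Qed.

Definition mean (J : finType) (Phi : borel_shift A -> J) (f : J -> R) : R :=
  \sum_j law Phi j * f j.

Lemma mean_comp (I J : finType) (g : J -> I) (Phi : borel_shift A -> J) f :
  observable Phi -> mean Phi (f \o g) = mean (g \o Phi) f.
Proof.
move=> mPhi; rewrite /mean (partition_big g xpredT)//=; apply: eq_bigr => i _.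
by rewrite law_comp// mulr_suml; apply: eq_bigr => j /eqP ->.
Qed.

Lemma mean_sum (J : finType) (Phi : borel_shift A -> J) (I : Type) (r : seq I)
    (Q : pred I) (F : I -> J -> R) :
  mean Phi (fun j => \sum_(i <- r | Q i) F i j) =
  \sum_(i <- r | Q i) mean Phi (F i).
Proof.
rewrite /mean exchange_big /=; apply: eq_bigr => j _; by rewrite mulr_sumr.
Qed.

Lemma meanD (J : finType) (Phi : borel_shift A -> J) f g :
  mean Phi (fun j => f j + g j) = mean Phi f + mean Phi g.
Proof. by rewrite /mean -big_split; apply: eq_bigr => j _; rewrite mulrDr. Qed.

Lemma meanZ (J : finType) (Phi : borel_shift A -> J) c f :
  mean Phi (fun j => c * f j) = c * mean Phi f.
Proof. by rewrite /mean mulr_sumr; apply: eq_bigr => j _; rewrite mulrCA. Qed.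

Lemma mean_cst (J : finType) (Phi : borel_shift A -> J) c : observable Phi ->
  mean Phi (fun=> c) = c.
Proof. by move=> mPhi; rewrite /mean -mulr_suml law_sum1// mul1r. Qed.

Lemma le_mean (J : finType) (Phi : borel_shift A -> J) f g :
  (forall j, 0 < law Phi j -> f j <= g j) -> mean Phi f <= mean Phi g.
Proof.
move=> fg; apply: ler_sum => j _.
have := law_ge0 Phi j; rewrite le0r => /orP[/eqP ->|lj]; first by rewrite !mul0r.
by rewrite ler_pM2l// fg.
Qed.

Lemma mean_indicator (J : finType) (Phi : borel_shift A -> J) (Q : pred J) :
  observable Phi -> mean Phi (fun j => (Q j)%:R) = pr [set x | Q (Phi x)].
Proof.
move=> mPhi; rewrite pr_pred// /mean [RHS]big_mkcond; apply: eq_bigr => j _.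
by case: (Q j); rewrite ?mulr1 ?mulr0.
Qed.

(** The sets with this approximation property form a sigma-algebra; for a countable
    union, continuity of the measure reduces to a finite one. *)
Lemma local_approximation B e : measurable B -> 0 < e ->
  exists n C, [/\ local n C, measurable C & pr ((B `\` C) `|` (C `\` B)) < e].
Proof.
pose D := [set B | measurable B /\ forall e, 0 < e ->
  exists n C, [/\ local n C, measurable C & pr ((B `\` C) `|` (C `\` B)) < e]].
suff H : forall B, measurable B -> D B by move=> /H [_ HB] /HB.
have DU B1 B2 : D B1 -> D B2 -> D (B1 `|` B2).
  move=> [mB1 H1] [mB2 H2]; split=> [|{}e e0]; first exact: measurableU.
  have [n1 [C1 [lC1 mC1 h1]]] := H1 (e / 2) (divr_gt0 e0 (@ltr0Sn R 1)).
  have [n2 [C2 [lC2 mC2 h2]]] := H2 (e / 2) (divr_gt0 e0 (@ltr0Sn R 1)).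
  exists (maxn n1 n2), (C1 `|` C2); split; [|exact: measurableU|].
    by apply: localU; [apply: localW lC1|apply: localW lC2];
      rewrite ?leq_maxl ?leq_maxr.
  rewrite (splitr e); apply: le_lt_trans (ltrD h1 h2).
  apply: pr_subU; do ?[exact: measurableU|exact: measurableD
    |apply: measurableU|apply: measurableD] => //.
  move=> x [[[b1|b2] /not_orP[c1 c2]]|[[c1|c2] /not_orP[b1 b2]]].
  - by left; left.
  - by right; left.
  - by left; right.
  - by right; right.
apply: borel_shift_generated; last first.
  move=> n C lC; split=> [|{}e e0]; first exact: (local_measurable lC).
  exists n, C; split => //; first exact: (local_measurable lC).
  by rewrite setDv setU0 pr0.
split.
- split=> // {}e e0; exists 0%N, set0; split => //.
  by rewrite setDv setU0 pr0.
- move=> C [mC HC]; rewrite setTD; split=> [|{}e e0]; first exact: measurableC.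
  have [n [C' [lC' mC' h]]] := HC e e0.
  exists n, (~` C'); split; [exact: localC|exact: measurableC|].
  rewrite (_ : _ `|` _ = (C `\` C') `|` (C' `\` C))//.
  by rewrite !setDE !setCK setUC; congr (_ `|` _); rewrite setIC.
move=> F DF; have mF i : measurable (F i) by have [] := DF i.
pose G n := \big[setU/set0]_(i < n.+1) F i.
have DG n : D (G n).
  rewrite /G; elim: n => [|n IH]; first by rewrite big_ord_recr big_ord0 /= set0U.
  by rewrite big_ord_recr /=; apply: DU.
have GF : \bigcup_n G n = \bigcup_n F n by rewrite /G bigcup_bigsetU_bigcup.
rewrite -GF; have mG n : measurable (G n) by have [] := DG n.
have mU : measurable (\bigcup_n G n) by exact: bigcupT_measurable.
split=> // {}e e0.
have ndG : nondecreasing_seq G.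
  move=> m n mn; apply/subsetPset; rewrite /G.
  by apply: (@subset_bigsetU _ F m.+1 n.+1).
have [N _ /(_ N (leqnn N)) HN] : \forall n \near \oo,
    pr (\bigcup_n G n) - e / 2 < pr (G n).
  have : nu \o G @ \oo --> (pr (\bigcup_n G n))%:E.
    by rewrite -prE//; exact: nondecreasing_cvg_mu.
  move=> /fine_cvgP[_] /cvgrPdist_lt /(_ (e / 2) (divr_gt0 e0 (@ltr0Sn R 1))).
  apply: filterS => n /=; rewrite -/(pr _) ltr_norml => /andP[_].
  by rewrite ltrBlDr addrC -ltrBlDr.
have [_ /(_ (e / 2) (divr_gt0 e0 (@ltr0Sn R 1)))] := DG N.
move=> [n [C [lC mC h]]]; exists n, C; split => //.
set S := (G N `\` C) `|` (C `\` G N) in h.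
have mS : measurable S by apply: measurableU; exact: measurableD.
have mUG : measurable (\bigcup_n G n `\` G N) by exact: measurableD.
apply: (@le_lt_trans _ _ (pr S + pr (\bigcup_n G n `\` G N))).
  apply: pr_subU => //; first by apply: measurableU; exact: measurableD.
  move=> x [[Ux Cx]|[Cx Ux]].
    by have [Gx|Gx] := pselect (G N x); [left; left|right].
  by left; right; split => // Gx; apply: Ux; exists N.
suff : pr (\bigcup_n G n) = pr (G N) + pr (\bigcup_n G n `\` G N).
  by move=> /eqP; rewrite addrC -subr_eq => /eqP <-; lra.
rewrite -pr_disjointU//; last by rewrite setIDA setIC -setIDA setDv setI0.
by congr pr; rewrite setDUK//; exact: bigcup_sup.
Qed.

Section invariance.
Hypothesis inv : forall B, measurable B -> nu (left_shift 1 @^-1` B) = nu B.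

Lemma pr_shift (m : int) B : measurable B -> pr (left_shift m @^-1` B) = pr B.
Proof.
have pos (n : nat) C : measurable C -> pr (left_shift n%:Z @^-1` C) = pr C.
  elim: n C => [|n IH] C mC.
    by congr pr; apply/seteqP; split=> x /=; rewrite left_shift0.
  rewrite (_ : _ @^-1` C = left_shift 1 @^-1` (left_shift n%:Z @^-1` C)).
    by rewrite -[RHS]IH// /pr inv//; exact: left_shift_measurable.
  by apply/seteqP; split=> x /=; rewrite left_shiftD -addn1 PoszD.
case: m => [n|n] mB; first exact: pos.
rewrite -[LHS](pos n.+1); last exact: left_shift_measurable.
congr pr; apply/seteqP; split=> x /=;
  by rewrite left_shiftD NegzE addNr left_shift0.
Qed.

Lemma observable_shift (J : finType) (Phi : borel_shift A -> J) m :
  observable Phi -> observable (Phi \o left_shift m).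
Proof. by move=> mPhi j; exact: (left_shift_measurable m (mPhi j)). Qed.

Lemma law_shift (J : finType) (Phi : borel_shift A -> J) m j :
  observable Phi -> law (Phi \o left_shift m) j = law Phi j.
Proof. by move=> mPhi; exact: (pr_shift m (mPhi j)). Qed.

Lemma mean_shift (J : finType) (Phi : borel_shift A -> J) m f :
  observable Phi -> mean (Phi \o left_shift m) f = mean Phi f.
Proof. by move=> mPhi; apply: eq_bigr => j _; rewrite law_shift. Qed.

End invariance.

Lemma observable_word n : observable (word n : borel_shift A -> _).
Proof. by move=> w; exact: (local_measurable (@word_local A n w)). Qed.

Lemma observable_window n : observable (window n : borel_shift A -> _).
Proof.
move=> w; apply: (@local_measurable A n) => x y xy /= <-.
by apply/windowP/agree_sym.
Qed.

End probability.

(** * Entropy of finite observables *)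

Section entropy_bounds.
Context {R : realType} {A : alphabetType}.
Variable nu : probability (borel_shift A) R.

Definition obs_entropy (J : finType) (Phi : borel_shift A -> J) : R :=
  - \sum_j law nu Phi j * ln (law nu Phi j).

Definition word_entropy n : R := obs_entropy (word n : borel_shift A -> _).

Lemma law_le1 (J : finType) (Phi : borel_shift A -> J) j : observable Phi ->
  law nu Phi j <= 1.
Proof. by move=> mPhi; rewrite -(prT nu); apply: pr_le. Qed.

Lemma obs_entropy_ge0 (J : finType) (Phi : borel_shift A -> J) :
  observable Phi -> 0 <= obs_entropy Phi.
Proof.
move=> mPhi; rewrite oppr_ge0; apply: sumr_le0 => j _.
by rewrite mulr_ge0_le0 ?law_ge0// ln_le0// law_le1.
Qed.

(** Any weights [q] on a finer observable bound the entropy from above; all upper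
    bounds of entropies below are obtained by choosing [q]. *)
Lemma obs_entropy_le_cross (I J : finType) (g : J -> I)
    (Phi : borel_shift A -> J) (q : J -> R) :
  observable Phi -> (forall j, 0 <= q j) -> (forall j, 0 < law nu Phi j -> 0 < q j) ->
  \sum_j q j <= 1 ->
  obs_entropy (g \o Phi) <= mean nu Phi (fun j => - ln (q j)).
Proof.
move=> mPhi q0 pq q1.
have -> : mean nu Phi (fun j => - ln (q j)) = - \sum_j law nu Phi j * ln (q j).
  by rewrite -sumrN; apply: eq_bigr => j _; rewrite mulrN.
rewrite /obs_entropy; under eq_bigr do rewrite law_comp//.
by apply: entropy_le_cross => //; [exact: law_ge0|rewrite law_sum1].
Qed.

(** Compare the law with the uniform weights on [S]. *)
Lemma obs_entropy_le_card (J : finType) (Phi : borel_shift A -> J)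
    (S : {set J}) : observable Phi -> (forall j, 0 < law nu Phi j -> j \in S) ->
  obs_entropy Phi <= ln (#|S|%:R).
Proof.
move=> mPhi HS.
have S0 : (0 < #|S|)%N.
  rewrite lt0n; apply/negP => /eqP S0.
  have := law_sum1 nu mPhi; rewrite big1 => [/eqP|j _].
    by rewrite eq_sym oner_eq0.
  apply/eqP; rewrite eq_le law_ge0 andbT leNgt; apply/negP => /HS.
  by rewrite (cards0_eq S0) inE.
have := @obs_entropy_le_cross J J id Phi
  (fun j => if j \in S then (#|S|%:R)^-1 else 0) mPhi.
move=> /(_ _ _ _)/le_trans; apply.
- by move=> j; case: ifP; rewrite ?invr_ge0.
- by move=> j /HS ->; rewrite invr_gt0 ltr0n.
- rewrite -big_mkcond sumr_const -(mulr_natl (#|S|%:R^-1)) divff//.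
  by rewrite pnatr_eq0 -lt0n.
apply: (@le_trans _ _ (mean nu Phi (fun=> ln #|S|%:R))); last by rewrite mean_cst.
by apply: le_mean => j /HS ->; rewrite lnV ?opprK// posrE ltr0n.
Qed.

Lemma ln_prod_pos (I : Type) (r : seq I) (Q : pred I) (F : I -> R) :
  (forall i, 0 < F i) -> ln (\prod_(i <- r | Q i) F i) =
  \sum_(i <- r | Q i) ln (F i).
Proof.
move=> F0; elim: r => [|i r IH]; first by rewrite !big_nil ln1.
rewrite !big_cons; case: ifP => // _; rewrite lnM ?IH// posrE//.
by apply: prodr_gt0.
Qed.

Lemma pr_bigU (J : finType) (D : J -> set (borel_shift A)) :
  (forall j, measurable (D j)) ->
  pr nu (\big[setU/set0]_j D j) <= \sum_j pr nu (D j).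
Proof.
move=> mD; elim: (index_enum J) => [|j s IH]; first by rewrite !big_nil pr0.
rewrite !big_cons; apply: (le_trans _ (lerD (lexx _) IH)).
by apply: pr_subU => //; [apply: measurableU => //|]; exact: bigsetU_measurable.
Qed.

(** Approximate the level sets of the observable by local sets; the guess is a value
    whose approximating set contains the point, and errs only on the symmetric
    differences. *)
Lemma guess_from_window (J : finType) (Phi : borel_shift A -> J) e :
  observable Phi -> 0 < e -> exists N (g : (N + N).+1.-tuple A -> J),
    pr nu [set x | g (window N x) != Phi x] <= e.
Proof.
move=> mPhi e0; pose K : R := #|J|%:R.
have K0 : 0 < K by rewrite ltr0n; apply/card_gt0P; exists (Phi point).
have eK : 0 < e / K by rewrite divr_gt0.
have /choice[F HF] : forall j, exists nC : nat * set (borel_shift A),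
    [/\ local nC.1 nC.2, measurable nC.2 &
    pr nu ((Phi @^-1` [set j] `\` nC.2) `|` (nC.2 `\` Phi @^-1` [set j])) < e / K].
  move=> j; have [n [C [lC mC h]]] := local_approximation nu (mPhi j) eK.
  by exists (n, C).
pose N := \max_j (F j).1.
have lF j : local N (F j).2.
  by have [lC _ _] := HF j; apply: localW lC; exact: leq_bigmax.
pose g (w : (N + N).+1.-tuple A) : J :=
  odflt (Phi point) [pick j | `[< exists2 x, window N x = w & (F j).2 x >]].
exists N, g.
pose D j := (Phi @^-1` [set j] `\` (F j).2) `|` ((F j).2 `\` Phi @^-1` [set j]).
have mD j : measurable (D j).
  by have [_ mF _] := HF j; apply: measurableU; exact: measurableD.
apply: (@le_trans _ _ (\sum_j pr nu (D j))); last first.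
  apply: (@le_trans _ _ (\sum_(j : J) e / K)).
    by apply: ler_sum => j _; have [_ _ /ltW] := HF j.
  by rewrite sumr_const -mulr_natr divfK// gt_eqF.
apply: le_trans (pr_bigU mD); apply: pr_le.
- have mw : observable (fun x : borel_shift A => (window N x, Phi x)).
    by apply: observable_pair => //; exact: observable_window.
  exact: (observable_pred (fun p => g p.1 != p.2) mw).
- exact: bigsetU_measurable.
move=> x /= gx.
have : exists j, D j x.
  move: gx; rewrite /g; case: pickP => [j /asboolP[y yx Cy] /= jx|H _].
    exists j; right; split; last by move=> /= e1; rewrite e1 eqxx in jx.
    by apply: lF Cy; exact/windowP.
  exists (Phi x); left; split=> // Cx; have /asboolP := H (Phi x).
  by apply; exists x.
by move=> [j Dj]; rewrite (bigD1 j)//=; left.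
Qed.

End entropy_bounds.

(** * Measure entropy through the entropy of words *)

Section generator.
Context {R : realType} {A : alphabetType}.
Variable nu : probability (borel_shift A) R.
Hypothesis inv : forall B : set (borel_shift A), measurable B ->
  nu (left_shift 1 @^-1` B) = nu B.

Definition itinerary (J : finType) (Phi : borel_shift A -> J) n
  (x : borel_shift A) : {ffun 'I_n -> J} :=
  [ffun i => Phi (left_shift (nat_of_ord i)%:Z x)].

Lemma observable_itinerary (J : finType) (Phi : borel_shift A -> J) n :
  observable Phi -> observable (itinerary Phi n).
Proof. by move=> mPhi; apply: observable_ffun => i; exact: observable_shift. Qed.

(** Words generate: the entropy of any finite observable exceeds that of words by
    at most [e] per step, because words predict the observable up to small
    errors, and the predictor can be mixed with a uniform guess. *)
Lemma itinerary_entropy_le (J : finType) (Phi : borel_shift A -> J) e :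
  observable Phi -> 0 < e -> exists N, forall n,
    obs_entropy nu (itinerary Phi n) <=
    word_entropy nu (n + (N + N)) + n%:R * e.
Proof.
move=> mPhi e0; pose K : R := #|J|%:R.
have K1 : 1 <= K by rewrite ler1n; apply/card_gt0P; exists (Phi point).
have K0 : 0 < K by apply: lt_le_trans K1.
pose c : R := 1 - expR (- (e / 2)).
have c0 : 0 < c by rewrite subr_gt0 expR_lt1 oppr_lt0 divr_gt0.
have c1 : c <= 1 by rewrite lerBlDr lerDl expR_ge0.
have cK : 0 < c / K by rewrite divr_gt0.
pose b := - ln (c / K).
have b0 : 0 <= b.
  by rewrite oppr_ge0 ln_le0// ler_pdivrMr// mul1r (le_trans c1).
have d0 : 0 < (e / 2) / (b + 1) by rewrite divr_gt0 ?divr_gt0// ltr_wpDl.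
have [N [g Hg]] := guess_from_window nu mPhi d0.
exists N => n.
(* a kernel that trusts the predictor with probability [1 - c] and otherwise
   guesses uniformly: correct guesses cost [e / 2], errors cost [b] *)
pose T w a : R := (1 - c) * (a == g w)%:R + c / K.
have T0 w a : 0 < T w a by rewrite ltr_wpDl// mulr_ge0 ?subr_ge0.
have T1 w : \sum_a T w a = 1.
  rewrite big_split /= -mulr_sumr sumr_const -(mulr_natr (c / K)) divfK ?gt_eqF//.
  rewrite (bigD1 (g w))//= eqxx big1 ?addr0 ?mulr1 ?subrK// => j /negPf ->//.
have lT w a : - ln (T w a) <= e / 2 + b * (a != g w)%:R.
  rewrite /T; have [_|_] /= := eqVneq a (g w); last
    by rewrite mulr0 add0r mulr1 lerDr divr_ge0 ?ltW.
  rewrite mulr0 addr0 mulr1 lerNl -[leLHS]expRK ler_ln ?posrE ?expR_gt0//.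
    by rewrite /c opprB addrCA subrr addr0 lerDl ltW.
  by rewrite ltr_wpDl// subr_ge0.
pose M := (n + (N + N))%N.
pose at_ (W : M.-tuple A) (i : nat) : (N + N).+1.-tuple A :=
  [tuple nth point W (i + k) | k < (N + N).+1].
pose lw := law nu (word M : borel_shift A -> _).
pose Psi (x : borel_shift A) := (itinerary Phi n x, word M (left_shift (- N%:Z) x)).
pose q (p : {ffun 'I_n -> J} * M.-tuple A) := lw p.2 * \prod_(i < n) T (at_ p.2 i) (p.1 i).
have mW : observable (fun x : borel_shift A => word M (left_shift (- N%:Z) x)).
  exact: (observable_shift (- N%:Z) (@observable_word A M)).
have mPsi : observable Psi by apply: observable_pair => //; exact: observable_itinerary.
have lPsi p : law nu Psi p <= lw p.2.
  rewrite /lw -(law_shift inv (- N%:Z) _ (@observable_word A M)).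
  rewrite (_ : _ \o _ = snd \o Psi)// law_comp// (bigD1 p)//= lerDl.
  by rewrite sumr_ge0// => j _; exact: law_ge0.
have q1 : \sum_p q p <= 1.
  rewrite -(law_sum1 nu (@observable_word A M)) -(pair_bigA _ (fun f W => q (f, W))) /=.
  rewrite exchange_big /=; apply: ler_sum => W _; rewrite /q /= -mulr_sumr.
  rewrite -(bigA_distr_bigA (fun (i : 'I_n) a => T (at_ W i) a)).
  by rewrite big1 ?mulr1// => i _; exact: T1.
have at_word x (i : 'I_n) :
    at_ (word M (left_shift (- N%:Z) x)) i = window N (left_shift i%:Z x).
  apply: eq_mktuple => k.
  have kM : (i + k < M)%N by have := ltn_ord i; have := ltn_ord k; rewrite /M; lia.
  rewrite -[(i + k)%N]/(nat_of_ord (Ordinal kM)) -tnth_nth tnth_mktuple /=.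
  by rewrite /left_shift; congr x; lia.
have := @obs_entropy_le_cross _ _ nu _ _ fst Psi q mPsi.
move=> /(_ _ _ q1)/le_trans; apply.
- by move=> p; rewrite mulr_ge0 ?law_ge0// prodr_ge0// => i _; exact: ltW.
- move=> p /lt_le_trans /(_ (lPsi p)) lp; rewrite mulr_gt0// prodr_gt0//.
apply: (@le_trans _ _ (mean nu Psi (fun p => - ln (lw p.2) +
    \sum_(i < n) (e / 2 + b * (p.1 i != g (at_ p.2 i))%:R)))).
  apply: le_mean => p /lt_le_trans /(_ (lPsi p)) lp.
  rewrite /q lnM ?posrE ?prodr_gt0// ln_prod_pos// opprD -sumrN lerD2l.
  by apply: ler_sum => i _; exact: lT.
rewrite meanD; apply: lerD.
  rewrite (@mean_comp _ _ nu _ _ snd Psi (fun W : M.-tuple A => - ln (lw W)))//.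
  rewrite (_ : snd \o Psi = word M \o left_shift (- N%:Z))// mean_shift//;
    last exact: observable_word.
  by rewrite /mean /word_entropy /obs_entropy -sumrN; apply: ler_sum => W _; rewrite mulrN.
rewrite mean_sum mulr_natl -[X in _ <= _ *+ X]card_ord -sumr_const.
apply: ler_sum => i _; rewrite meanD mean_cst// meanZ.
rewrite (@mean_indicator _ _ nu _ _
  (fun p : {ffun 'I_n -> J} * M.-tuple A => p.1 i != g (at_ p.2 i)))//.
have -> : [set x | (Psi x).1 i != g (at_ (Psi x).2 i)] =
    left_shift i%:Z @^-1` [set x | g (window N x) != Phi x].
  by apply/seteqP; split=> x; rewrite /= ffunE at_word eq_sym.
rewrite pr_shift//; last first.
  have mw : observable (fun x : borel_shift A => (window N x, Phi x)).
    by apply: observable_pair => //; exact: observable_window.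
  exact: (observable_pred (fun p => g p.1 != p.2) mw).
rewrite [leRHS](splitr e) lerD2l.
apply: (le_trans (ler_wpM2l b0 Hg)).
rewrite mulrA ler_pdivrMr ?ltr_wpDl// mulrC ler_pM2l ?divr_gt0//.
by rewrite lerDl.
Qed.

Section partitions.
Context {k : nat} (xi : 'I_k -> set (borel_shift A)).
Hypothesis mxi : measurable_partition xi.

Lemma partition_index : exists2 Phi : borel_shift A -> 'I_k, observable Phi &
  forall n, join_entropy nu xi n = obs_entropy nu (itinerary Phi n).
Proof.
have [mx tx ux] := mxi.
have /choice[Phi HPhi] : forall x, exists i, xi i x.
  by move=> x; have : [set: borel_shift A] x by []; rewrite -ux => -[i _ xix]; exists i.
have PhiE i : Phi @^-1` [set i] = xi i.
  apply/seteqP; split=> x /=; first by move=> <-.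
  by move=> xix; apply: tx => //; exists x.
exists Phi; first by move=> i; rewrite PhiE.
move=> n; rewrite /join_entropy /obs_entropy; congr (- _).
apply: eq_bigr => f _; rewrite /law.
suff -> : join_atom xi f = itinerary Phi n @^-1` [set f] by [].
apply/seteqP; split=> x /=.
  move=> H; apply/ffunP => i; rewrite ffunE.
  by have := H i I; rewrite /= -PhiE.
by move=> <- i _; rewrite /= ffunE.
Qed.

End partitions.

Lemma lt_partition_entropy k (xi : 'I_k -> set (borel_shift A)) (c : R) :
  0 <= c -> (c%:E < partition_entropy nu xi)%E ->
  exists n0, forall n, (n0 <= n)%N -> c * n%:R <= join_entropy nu xi n.
Proof.
move=> c0 cp; pose u n := (join_entropy nu xi n / n%:R)%:E.
have cu : cvgn u.
  apply/not_notP => ncu; move: cp; rewrite /partition_entropy.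
  by rewrite dvgP// lte_fin ltNge c0.
have [n0 _ Hn] : \forall n \near \oo, (c%:E < u n)%E.
  have : u @ \oo --> partition_entropy nu xi by [].
  by move=> /(_ (fun y => (c%:E < y)%E)); apply; apply: open_ereal_gt'.
exists n0.+1 => n nn; have := Hn n (ltnW nn); rewrite /= lte_fin => /ltW.
by rewrite ler_pdivlMr// ltr0n (leq_ltn_trans _ nn).
Qed.

Definition grows_at_most (u : nat -> R) (h : R) :=
  forall e, 0 < e -> exists n0, forall n, (n0 <= n)%N -> u n <= (h + e) * n%:R.

Definition grows_at_least (u : nat -> R) (h : R) :=
  forall e, 0 < e -> exists n0, forall n, (n0 <= n)%N -> (h - e) * n%:R <= u n.

(** A divergent entropy limit takes the value 0 by convention, whence [0 <= h]. *)
Lemma measure_entropy_le h : 0 <= h -> grows_at_most (word_entropy nu) h ->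
  (measure_entropy nu <= h%:E)%E.
Proof.
move=> h0 Hh; apply: ge_ereal_sup => _ [k [xi [mxi ->]]].
rewrite leNgt; apply/negP => lt.
have [c hc cp] : exists2 c : R, h < c & (c%:E < partition_entropy nu xi)%E.
  case: (partition_entropy nu xi) lt => [r||//]; rewrite ?lte_fin => hr.
    by exists ((h + r) / 2); rewrite ?lte_fin; lra.
  by exists (h + 1); rewrite ?ltry//; lra.
have [|n0 Hn0] := lt_partition_entropy _ cp; first by lra.
have [Phi mPhi HPhi] := partition_index mxi.
have e0 : 0 < (c - h) / 4 by rewrite divr_gt0// subr_gt0.
have [N HN] := itinerary_entropy_le mPhi e0.
have [n1 Hn1] := Hh _ e0.
pose n2 := Num.bound ((h + (c - h) / 4) * (N + N)%:R).
have Hn2 : (h + (c - h) / 4) * (N + N)%:R < n2%:R.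
  by apply: archi_boundP; rewrite mulr_ge0//; lra.
pose n3 := Num.bound (4 / (c - h)).
have Hn3 : 4 / (c - h) < n3%:R by apply: archi_boundP; rewrite divr_ge0//; lra.
pose n := (n0 + n1 + n2 * n3)%N.
have := Hn0 n; rewrite HPhi {1}/n -addnA leq_addr => /(_ isT) h1.
have := HN n; have := Hn1 (n + (N + N))%N.
rewrite {1}/n => /(_ ltac:(lia)) h2 h3.
have : (c - h) / 2 * n%:R <= n2%:R.
  apply: le_trans (ltW Hn2); move: h1 h2 h3; rewrite natrD; lra.
apply/negP; rewrite -ltNge.
have n23 : n2%:R * n3%:R <= n%:R :> R by rewrite -natrM ler_nat /n leq_addl.
have n20 : 0 < n2%:R :> R by apply: le_lt_trans Hn2; rewrite mulr_ge0//; lra.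
have h4 : 4 < n3%:R * (c - h) by rewrite -ltr_pdivrMr ?subr_gt0.
have h5 : (c - h) / 2 * (n2%:R * n3%:R) <= (c - h) / 2 * n%:R.
  by rewrite ler_pM2l// divr_gt0// subr_gt0.
by nra.
Qed.

Lemma le_measure_entropy h : (h%:E <= measure_entropy nu)%E ->
  grows_at_least (word_entropy nu) h.
Proof.
move=> hm e e0.
have [he|he] := lerP (h - e) 0.
  exists 0%N => n _; apply: (@le_trans _ _ 0); last first.
    exact: (obs_entropy_ge0 nu (@observable_word A n)).
  by rewrite mulr_le0_ge0.
have : ((h - e / 4)%:E < measure_entropy nu)%E.
  by apply: lt_le_trans hm; rewrite lte_fin; lra.
move=> /ereal_sup_gt[_ [k [xi [mxi ->]]] cp].
have [|n0 Hn0] := lt_partition_entropy _ cp; first by lra.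
have [Phi mPhi HPhi] := partition_index mxi.
have e2 : 0 < e / 4 by rewrite divr_gt0.
have [N HN] := itinerary_entropy_le mPhi e2.
pose n1 := Num.bound ((h - e / 4) * (N + N)%:R / (e / 4)).
have Hn1 : (h - e / 4) * (N + N)%:R / (e / 4) < n1%:R.
  by apply: archi_boundP; rewrite divr_ge0// ?mulr_ge0//; lra.
exists (n0 + n1 + (N + N))%N => m mm.
have := Hn0 (m - (N + N))%N ltac:(lia); have := HN (m - (N + N))%N.
rewrite subnK; last by lia.
rewrite HPhi natrB; last by lia.
have : n1%:R <= m%:R :> R by rewrite ler_nat; lia.
move: Hn1; rewrite ltr_pdivrMr//.
have : 0 <= (N + N)%:R :> R by [].
set X := (N + N)%:R; set Y := m%:R; set Z := n1%:R.
by move=> ? ? ? ? ?; nra.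
Qed.

(** The partition by the letter at the origin has the words as its atoms. *)
Lemma measure_entropy_ge h : grows_at_most (word_entropy nu) h ->
  grows_at_least (word_entropy nu) h -> (h%:E <= measure_entropy nu)%E.
Proof.
move=> Hu Hl.
pose xi (i : 'I_#|A|) : set (borel_shift A) := [set x | x 0 = enum_val i].
have mxi : measurable_partition xi.
  split.
  - by move=> i; apply: (@local_measurable _ 0%N) => x y /(_ 0 isT) xy; rewrite /xi /= -xy.
  - move=> i j _ _ [x [xix xjx]]; apply: enum_val_inj.
    by move: xix xjx; rewrite /xi /= => <- <-.
  - apply/seteqP; split=> // x _; exists (enum_rank (x 0)) => //=.
    by rewrite /xi /= enum_rankK.
apply: ereal_sup_ubound; exists #|A|, xi; split => //.
have [Phi mPhi HPhi] := partition_index mxi.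
have je n : join_entropy nu xi n = word_entropy nu n.
  rewrite /word_entropy /obs_entropy /join_entropy; congr (- _).
  pose G (f : {ffun 'I_n -> 'I_#|A|}) : n.-tuple A := [tuple enum_val (f i) | i < n].
  pose G' (t : n.-tuple A) : {ffun 'I_n -> 'I_#|A|} := [ffun i => enum_rank (tnth t i)].
  rewrite [RHS](reindex G); last first.
    exists G' => [f|t] _; first by apply/ffunP => i; rewrite ffunE tnth_mktuple enum_valK.
    by apply: eq_from_tnth => i; rewrite tnth_mktuple ffunE enum_rankK.
  apply: eq_bigr => f _; rewrite /law.
  suff -> : join_atom xi f = word n @^-1` [set G f] by [].
  apply/seteqP; split=> x /=.
    move=> H; apply: eq_mktuple => i; have := H i I.
    by rewrite /xi /= /left_shift add0r.
  move=> H i _ /=; rewrite /xi /= /left_shift add0r.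
  by have := congr1 (fun t => tnth t i) H; rewrite !tnth_mktuple.
apply/esym/cvg_lim => //; apply: cvg_EFin; first by near=> n.
apply/cvgrPdist_le => e e0.
have [n0 Hn0] := Hu e e0; have [n1 Hn1] := Hl e e0.
exists (maxn n0 n1).+1 => // n /= nn.
rewrite je; have n00 : 0 < n%:R :> R by rewrite ltr0n; lia.
have := Hn0 n ltac:(lia); rewrite -ler_pdivrMr// => h1.
have := Hn1 n ltac:(lia); rewrite -ler_pdivlMr// => h2; rewrite ler_norml.
by apply/andP; split; lra.
Unshelve. all: by end_near. Qed.

End generator.

(** * Measures determined by their values on local sets *)

Section extension_of_contents.

(** An alias of the full shift, whose measurable sets are the local ones: the
    extension theorem starts from a measure on an algebra of sets. *)
Definition local_shift_space (A : alphabetType) := int -> A.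

HB.instance Definition _ (A : alphabetType) :=
  Pointed.copy (local_shift_space A) (int -> A).

Definition locals (A : alphabetType) : set (set (local_shift_space A)) :=
  [set C | exists n, local n C].

Lemma locals0 A : @locals A set0. Proof. by exists 0%N. Qed.

Lemma localsU A : setU_closed (@locals A).
Proof.
move=> C D [m lC] [n lD]; exists (maxn m n).
by apply: localU; [apply: localW lC|apply: localW lD];
  rewrite ?leq_maxl ?leq_maxr.
Qed.

Lemma localsC A : setC_closed (@locals A).
Proof. by move=> C [n lC]; exists n; exact: localC. Qed.

HB.instance Definition _ (A : alphabetType) :=
  @isAlgebraOfSets.Build (sigma_display (@locals A)) (local_shift_space A)
    (@locals A) (@locals0 A) (@localsU A) (@localsC A).

Context {R : realType} {A : alphabetType}.
Variable m : set (int -> A) -> R.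
Hypothesis m_ge0 : forall n C, local n C -> 0 <= m C.
Hypothesis m_setT : m setT = 1.
Hypothesis m_additive : forall n C D, local n C -> local n D ->
  C `&` D = set0 -> m (C `|` D) = m C + m D.

Let mE (C : set (local_shift_space A)) : \bar R :=
  if `[< locals C >] then (m C)%:E else 0%E.

Let mEE C : locals C -> mE C = (m C)%:E.
Proof. by move=> lC; rewrite /mE asboolT. Qed.

Let mE_ge0 C : (0 <= mE C)%E.
Proof.
rewrite /mE; case: ifPn => // /asboolP[n lC]; rewrite lee_fin; exact: m_ge0 lC.
Qed.

Let m_set0 : m set0 = 0.
Proof.
have := @m_additive 0%N set0 set0 (@local0 A 0) (@local0 A 0).
by rewrite setU0 setI0 => /(_ erefl); lra.
Qed.

Let mE_additive2 C D : locals C -> locals D -> C `&` D = set0 ->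
  mE (C `|` D) = (mE C + mE D)%E.
Proof.
move=> lC lD CD; rewrite !mEE//; last exact: localsU.
move: lC lD => [k lC] [n lD].
rewrite (@m_additive (maxn k n))//.
  by apply: localW lC; rewrite leq_maxl.
by apply: localW lD; rewrite leq_maxr.
Qed.

Let locals_bigU (F : nat -> set (int -> A)) n : (forall k, locals (F k)) ->
  locals (\big[setU/set0]_(k < n) F k).
Proof.
move=> lF; elim: n => [|n IH]; first by rewrite big_ord0; exact: locals0.
by rewrite big_ord_recr /=; exact: localsU.
Qed.

Let mE_semi_additive : measure_function.semi_additive mE.
Proof.
move=> F n mF tF _; elim: n => [|n IH].
  by rewrite !big_ord0 mEE ?m_set0//; exact: locals0.
rewrite !big_ord_recr /= mE_additive2 ?IH//; [exact: locals_bigU|exact: mF|].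
rewrite -(bigcup_mkord n F); apply/seteqP; split=> // x [[k /= kn Fk] Fn].
have kn' : k = n by apply: tF => //; exists x.
by rewrite kn' ltnn in kn.
Qed.

HB.instance Definition _ := isContent.Build _ (local_shift_space A) R mE
  mE_ge0 mE_semi_additive.

(* by compactness, a local set is never an infinite disjoint union *)
Let mE_semi_sigma_additive : semi_sigma_additive mE.
Proof.
move=> F mF tF [N lU].
have [n Hn] : exists n, \bigcup_k F k `<=` \big[setU/set0]_(k < n) F k.
  apply/not_existsP => H.
  pose B n : set (full_shift A) := \bigcup_k F k `&` ~` \big[setU/set0]_(k < n) F k.
  have [||n|x Bx] := @decreasing_closed_meet A B.
  - move=> n; apply: closedI; first exact: (local_closed lU).
    have [k lk] := locals_bigU n mF; apply: (@local_closed _ k); exact: localC.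
  - move=> n; apply: setIS; apply: subsetC; rewrite big_ord_recr /=.
    exact: subsetUl.
  - have /existsNP[x /not_implyP[Ux nx]] := H n; by exists x.
  have [[k _ Fk] _] := Bx 0%N; have [_] := Bx k.+1; apply.
  by rewrite big_ord_recr /=; right.
have UE j : (n <= j)%N -> \bigcup_k F k = \big[setU/set0]_(k < j) F k.
  move=> nj; apply/seteqP; split; last exact: bigsetU_bigcup.
  by apply: subset_trans Hn _; exact: subset_bigsetU.
apply: cvg_near_cst; exists n => // j /= nj.
by rewrite big_mkord -mE_semi_additive// -?UE//; exists N.
Qed.

HB.instance Definition _ := Content_isMeasure.Build _ (local_shift_space A) R mE
  mE_semi_sigma_additive.

Let ext (B : set (borel_shift A)) : \bar R :=
  measure_extension (mE : {measure set (local_shift_space A) -> \bar R}) B.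

Let borel_ext (B : set (borel_shift A)) : measurable B ->
  (@measurable _ (local_shift_space A)).-sigma.-measurable
    (B : set (local_shift_space A)).
Proof.
move: B; apply: borel_shift_generated; last first.
  by move=> n C lC; apply: sub_sigma_algebra; exists n.
split; [exact: measurable0 | by move=> C mC; rewrite setTD; exact: measurableC |].
by move=> F mF; exact: bigcupT_measurable.
Qed.

Let ext0 : ext set0 = 0%E. Proof. exact: measure0. Qed.

Let ext_ge0 B : (0 <= ext B)%E. Proof. exact: measure_ge0. Qed.

Let ext_sigma_additive : semi_sigma_additive ext.
Proof.
move=> F mF tF mU; apply: measure_semi_sigma_additive => //.
  by move=> i; exact: borel_ext.
exact: borel_ext.
Qed.

HB.instance Definition _ := isMeasure.Build _ (borel_shift A) R ext
  ext0 ext_ge0 ext_sigma_additive.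

Let ext_local n C : local n C -> ext C = (m C)%:E.
Proof.
move=> lC; have lC' : locals C by exists n.
by rewrite /ext /measure_extension measurable_mu_extE//; exact: mEE.
Qed.

Let extT : ext setT = 1%E.
Proof. by rewrite (@ext_local 0%N) ?m_setT. Qed.

HB.instance Definition _ := Measure_isProbability.Build _ (borel_shift A) R ext
  extT.

Lemma probability_of_content : exists mu : probability (borel_shift A) R,
  forall n C, local n C -> mu C = (m C)%:E.
Proof. by exists ext; exact: ext_local. Qed.

End extension_of_contents.

Section agreement.
Context {R : realType} {A : alphabetType}.

(** The local sets form a generating pi-system. *)
Lemma probability_eq (mu nu : probability (borel_shift A) R) :
  (forall n C, local n C -> mu C = nu C) ->
  forall B, measurable B -> mu B = nu B.
Proof.
move=> H B mB.
pose G : set (set (borel_shift A)) := [set C | exists n, local n C].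
apply: (@measure_unique _ R (borel_shift A) G (fun=> setT)) => //.
- apply/seteqP; split=> C.
    move: C; apply: borel_shift_generated; last first.
      by move=> n C lC; apply: sub_sigma_algebra; exists n.
    split; [exact: sigma_algebra0 | by move=> C mC; exact: sigma_algebraCD |].
    by move=> F mF; exact: sigma_algebra_bigcup.
  apply: smallest_sub; first exact: sigma_algebra_measurable.
  by move=> D [n lD]; exact: (local_measurable lD).
- move=> C D [m lC] [n lD]; exists (maxn m n).
  by apply: localI; [apply: localW lC|apply: localW lD];
    rewrite ?leq_maxl ?leq_maxr.
- by move=> n; exists 0%N.
- by rewrite bigcup_const//; exists 0%N.
- by move=> C [n lC]; exact: H lC.
- by move=> n; rewrite /= probability_setT ltry.
Qed.

Let shift1 : borel_shift A -> borel_shift A := left_shift 1.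

Let shift1_measurable : measurable_fun setT shift1.
Proof. by move=> _ B mB; rewrite setTI; exact: left_shift_measurable. Qed.

HB.instance Definition _ :=
  isMeasurableFun.Build _ _ (borel_shift A) (borel_shift A) shift1
    shift1_measurable.

(** Apply [probability_eq] to the image of [mu] under the shift. *)
Lemma invariant_of_local (mu : probability (borel_shift A) R) :
  (forall n C, local n C -> mu (left_shift 1 @^-1` C) = mu C) ->
  forall B : set (borel_shift A), measurable B -> mu (left_shift 1 @^-1` B) = mu B.
Proof.
move=> H; apply: (@probability_eq (distribution mu shift1) mu) => n C lC.
exact: H lC.
Qed.

End agreement.

(** * The frequency measure *)

Section subshift.
Context {A : alphabetType} (theta : A -> {fset seq A}).
Implicit Types (x : int -> A).

Lemma language_infix u v : language theta v -> infix u v -> language theta u.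
Proof.
move=> [k [a [w [k0 wk vw]]]] uv; exists k, a, w; split => //.
exact: infix_trans vw.
Qed.

Lemma subword_shift x (m : int) (p : int) n :
  subword (left_shift m x) p n = subword x (m + p) n.
Proof.
by apply: eq_map => i; rewrite /left_shift; congr x; lia.
Qed.

Lemma size_subword x m n : size (subword x m n) = n.
Proof. by rewrite size_map size_iota. Qed.

Lemma nth_subword c x m n i : (i < n)%N -> nth c (subword x m n) i = x (m + i%:Z).
Proof. by move=> ni; rewrite (nth_map 0%N) ?size_iota// nth_iota. Qed.

Lemma subword_cat x m n p :
  subword x m (n + p) = subword x m n ++ subword x (m + n%:Z) p.
Proof.
rewrite /subword iotaD map_cat add0n; congr (_ ++ _).
rewrite -[n in iota n p]addn0 iotaDl -map_comp; apply: eq_map => i /=.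
by congr x; lia.
Qed.

Lemma drop_subword x m n i : (i <= n)%N ->
  drop i (subword x m n) = subword x (m + i%:Z) (n - i).
Proof.
move=> i_n; rewrite -{1}(subnKC i_n) subword_cat drop_size_cat//.
by rewrite size_subword.
Qed.

Lemma take_subword x m n i : (i <= n)%N ->
  take i (subword x m n) = subword x m i.
Proof.
move=> i_n; rewrite -{1}(subnKC i_n) subword_cat take_size_cat//.
by rewrite size_subword.
Qed.

Lemma infix_subword x (m p : int) n k : m <= p -> p + k%:Z <= m + n%:Z ->
  infix (subword x p k) (subword x m n).
Proof.
move=> mp pk; pose a := `|(p - m)%R|%N; pose b := `|(m + n%:Z - (p + k%:Z))%R|%N.
apply/infixP; exists (subword x m a), (subword x (p + k%:Z) b).
have -> : n = (a + (k + b))%N by rewrite /a /b; lia.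
rewrite !subword_cat; have -> : m + a%:Z = p by rewrite /a; lia.
by [].
Qed.

Lemma val_window n x : val (window n x) = subword x (- n%:Z) (n + n).+1.
Proof.
rewrite /subword -val_enum_ord -map_comp; apply: eq_map => i /=.
by rewrite addrC.
Qed.

Lemma subword_local n (w : seq A) : local n [set x | subword x 0 n = w].
Proof.
move=> x y xy /= <-; apply/eq_in_map => i; rewrite mem_iota => /= i_n.
by apply/esym/xy; lia.
Qed.

Lemma subshift_windowP x :
  subshift theta x <-> forall n, language theta (window n x).
Proof.
split=> [Xx n|H m n]; first by rewrite val_window; exact: Xx.
apply: (language_infix (H (`|m| + n)%N)); rewrite val_window.
by apply: infix_subword; lia.
Qed.

Lemma subshift_shift m x : subshift theta x -> subshift theta (left_shift m x).
Proof. by move=> Xx p n; rewrite subword_shift; exact: Xx. Qed.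

Lemma subshift_closed : closed (subshift theta).
Proof.
rewrite (_ : subshift theta =
    \bigcap_n [set x | language theta (window n x)]); last first.
  apply/seteqP; split=> x; first by move=> /subshift_windowP H n _; exact: H.
  by move=> H; apply/subshift_windowP => n; exact: H.
apply: closed_bigI => n _; apply: (@local_closed _ n) => x y xy.
by rewrite /mkset ((windowP n x y).2 xy).
Qed.

Lemma subshift_measurable : measurable (subshift theta : set (borel_shift A)).
Proof. apply: closed_measurable_shift; exact: subshift_closed. Qed.

End subshift.

Section frequency_measures.
Context {R : realType} {A : alphabetType}.
Context {theta : A -> {fset seq A}} {P : A -> seq A -> R} {l : nat}.
Hypothesis rs : random_substitution theta P.
Hypothesis hl : constant_length theta l.
Hypothesis l2 : (2 <= l)%N.
Hypothesis irr : exists k, forall a b, exists2 w,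
  w \in iter_realisations theta k [:: a] & b \in w.

(** A finite word as a bi-infinite one; what lies outside is a convention that
    only affects boundary terms. *)
Definition pad (w : seq A) : int -> A :=
  fun z => if z is Posz n then @nth A point w n else point.

(** The expected visits to [C] along a random word define the measure of [C]. *)
Definition visits (C : set (int -> A)) (w : seq A) : R :=
  \sum_(0 <= i < size w) (`[< C (left_shift i%:Z (pad w)) >])%:R.

Lemma sum_close (f g : nat -> R) (bad : pred nat) a n :
  (forall i, (i < a)%N -> `|f i - g i| <= (bad i)%:R) ->
  (count bad (iota 0 a) <= n)%N ->
  `|\sum_(0 <= i < a) f i - \sum_(0 <= i < a) g i| <= n%:R.
Proof.
move=> fg cn; rewrite -sumrB; apply: (le_trans (ler_norm_sum _ _ _)).
apply: (@le_trans _ _ (count bad (iota 0 a))%:R); last by rewrite ler_nat.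
rewrite -sum1_count natr_sum /index_iota subn0 [leRHS]big_mkcond.
rewrite big_seq [leRHS]big_seq; apply: ler_sum => i.
by rewrite mem_iota => /fg; case: (bad i).
Qed.

Lemma count_tail a n : (count (fun i => a <= i + n)%N (iota 0 a) <= n)%N.
Proof.
have [an|/ltnW na] := leqP a n.
  by apply: (leq_trans (count_size _ _)); rewrite size_iota.
rewrite -{2}(subnK na) iotaD count_cat.
rewrite (@eq_in_count _ _ pred0) ?count_pred0 ?add0n.
  by apply: (leq_trans (count_size _ _)); rewrite size_iota.
by move=> i; rewrite mem_iota /= => ?; lia.
Qed.

Lemma count_head b n : (count (fun i => i < n)%N (iota 0 b) <= n)%N.
Proof.
have [bn|/ltnW nb] := leqP b n.
  by apply: (leq_trans (count_size _ _)); rewrite size_iota.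
rewrite -(subnKC nb) iotaD count_cat.
rewrite [X in (_ + X)%N](@eq_in_count _ _ pred0) ?count_pred0 ?addn0.
  by apply: (leq_trans (count_size _ _)); rewrite size_iota.
by move=> i; rewrite mem_iota /= => ?; lia.
Qed.

Lemma bool_close (b c : bool) : `|b%:R - c%:R| <= 1 :> R.
Proof. by case: b c => [] []; rewrite ?subrr ?subr0 ?sub0r ?normrN ?normr0 ?normr1. Qed.

Lemma local_asbool n (C : set (int -> A)) x y : local n C -> agree n x y -> `[< C x >] = `[< C y >].
Proof.
move=> lC xy; apply/asboolP/asboolP; first exact: lC xy.
exact: lC (agree_sym xy).
Qed.

(** A visit at a position depends on the [n] letters on each side, so only the
    positions at distance at most [n] from a junction are affected by it. *)
Lemma visits_almost_additive n (C : set (int -> A)) : local n C ->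
  almost_additive (n + n)%:R (visits C).
Proof.
move=> lC; split; first by rewrite /visits big_geq.
move=> s t; rewrite /visits size_cat (big_cat_nat (n := size s))//=; last first.
  by rewrite leq_addr.
rewrite -{2}[size s]add0n big_addn addKn opprD addrACA natrD.
apply: (le_trans (ler_normD _ _)); apply: lerD.
  apply: (@sum_close _ _ (fun i => size s <= i + n)%N); last exact: count_tail.
  move=> i si; case: leqP => /= h; first exact: bool_close.
  rewrite (@local_asbool n _ _ (left_shift i%:Z (pad s)) lC) ?subrr ?normr0//.
  move=> z zn; rewrite /left_shift /pad; case E : (z + i%:Z) => [k|//].
  have {}E : (z + i%:Z)%R = k%:Z :> int by exact: E.
  by rewrite nth_cat ifT//; lia.
apply: (@sum_close _ _ (fun i => i < n)%N); last exact: count_head.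
move=> i si; case: ltnP => /= h; first exact: bool_close.
rewrite (@local_asbool n _ _ (left_shift i%:Z (pad t)) lC) ?subrr ?normr0//.
move=> z zn; rewrite /left_shift /pad.
have [k zk] : exists k : nat, (z + i%:Z)%R = k%:Z :> int.
  by exists `|(z + i%:Z)%R|%N; lia.
have -> : (z + (i + size s)%N%:Z)%R = (size s + k)%N%:Z :> int by lia.
by rewrite zk nth_cat ifN ?addKn//; lia.
Qed.

Lemma visits_word n (w : n.-tuple A) s :
  `|visits (word n @^-1` [set w]) s - (occurrences w s)%:R| <= n%:R.
Proof.
have -> : (occurrences w s)%:R =
    \sum_(0 <= i < size s) (prefix w (drop i s))%:R :> R.
  rewrite /occurrences -sum1_count natr_sum big_mkcond /index_iota subn0.
  by apply: eq_bigr => i _; case: prefix.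
rewrite /visits.
apply: (@sum_close _ _ (fun i => size s <= i + n)%N); last exact: count_tail.
move=> i si; case: leqP => /= h; first exact: bool_close.
suff -> : `[< word n (left_shift i%:Z (pad s)) = w >] = prefix w (drop i s).
  by case: prefix; rewrite subrr normr0.
rewrite prefixE size_tuple.
have -> : take n (drop i s) = word n (left_shift i%:Z (pad s)) :> seq A.
  apply: (@eq_from_nth A point).
    by rewrite size_tuple size_takel// size_drop; lia.
  move=> j; rewrite size_takel ?size_drop; last lia.
  move=> jn; rewrite nth_take// nth_drop.
  rewrite -[j]/(nat_of_ord (Ordinal jn)) -tnth_nth tnth_mktuple /left_shift /=.
  by rewrite addnC.
by apply/asboolP/eqP => [-> //|/val_inj].
Qed.

Lemma occurrences_almost_additive (w : seq A) :
  exists D, almost_additive D (fun s => (occurrences w s)%:R : R).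
Proof.
pose t := in_tuple w.
have aV := visits_almost_additive (@word_local A (size w) t).
exists ((size w + size w)%:R + 3 * (size w)%:R); split; first by [].
move=> u v; have := visits_word t (u ++ v); have := visits_word t u.
have := visits_word t v; have := (proj2 aV) u v; rewrite /=.
set V := visits _; rewrite !ler_norml.
by do 4![move=> /andP[] ? ?]; apply/andP; split; lra.
Qed.

Lemma occurrences_super (w s t : seq A) :
  (occurrences w s + occurrences w t <= occurrences w (s ++ t))%N.
Proof.
rewrite /occurrences size_cat iotaD count_cat leq_add//.
  rewrite -!sum1_count big_mkcond [leqRHS]big_mkcond big_seq [leqRHS]big_seq.
  apply: leq_sum => i; rewrite mem_iota /= => si; rewrite drop_cat si.
  by case: prefixP => // [[x ->]]; rewrite -catA prefix_prefix.
have -> : iota (0 + size s) (size t) = map (addn (size s)) (iota 0 (size t)).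
  by rewrite -iotaDl addn0.
rewrite count_map.
apply: sub_count => i /=; rewrite drop_cat ltnNge leq_addr /=.
by rewrite addKn.
Qed.

Lemma occurrences_gt0 (w s : seq A) : (0 < size s)%N ->
  (0 < occurrences w s)%N = infix w s.
Proof.
move=> s0; rewrite -has_count; apply/hasP/infixP => [[i _ /prefixP[x ix]]|].
  by exists (take i s), x; rewrite -ix cat_take_drop.
move=> [p [q pq]]; have [ps|sp] := ltnP (size p) (size s).
  exists (size p); first by rewrite mem_iota.
  by rewrite pq drop_size_cat// prefix_prefix.
exists 0%N; first by rewrite mem_iota add0n.
move: pq sp => ->; rewrite !size_cat -[leqRHS]addn0 leq_add2l leqn0 addn_eq0.
by move=> /andP[/eqP/size0nil -> _]; exact: prefix0s.
Qed.

Definition frequency F : R := xget 0 [set x | has_frequency theta P l F x].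

Lemma frequencyP D F : almost_additive D F ->
  has_frequency theta P l F (frequency F).
Proof.
move=> /(has_frequency_ex rs hl l2 irr) [x Hx]; rewrite /frequency.
by case: xgetP => [y _ //|/(_ x)].
Qed.

Let frequency_eq D F G x : almost_additive D F ->
  has_frequency theta P l G x -> (forall w, F w = G w) -> frequency F = x.
Proof.
move=> aF Hx /funext FG; move: (frequencyP aF); rewrite FG => H.
exact: (has_frequency_unique l2 H Hx).
Qed.

(** Frequencies of visits are finitely additive, and invariant because shifting [C]
    changes the visits along a word by at most one. *)
Lemma frequency_measure_visits : exists mu : probability (borel_shift A) R,
  (forall B : set (borel_shift A), measurable B ->
    mu (left_shift 1 @^-1` B) = mu B) /\
  forall n (C : set (borel_shift A)), local n C ->
    has_frequency theta P l (visits C) (pr mu C).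
Proof.
have aV n C lC := @visits_almost_additive n C lC.
have hV n C lC := frequencyP (aV n C lC).
have [|||mu Hmu] := @probability_of_content R A (fun C => frequency (visits C)).
- move=> n C lC.
  apply: (has_frequency_le rs l2 (C := 0)
    (has_frequency_cst rs hl 0) (hV n C lC)) => w.
  by rewrite mul0r addr0 sumr_ge0.
- apply: (frequency_eq (aV 0%N _ (@localT A 0)) (has_frequency_cst rs hl 1)).
  move=> w; rewrite mul1r /visits.
  under eq_bigr do rewrite asboolT//.
  by rewrite big_const_nat subn0 iter_addr_0.
- move=> n C D lC lD CD.
  apply: (frequency_eq (aV n _ (localU lC lD))
    (has_frequencyD (hV n C lC) (hV n D lD))) => w.
  rewrite /visits -big_split; apply: eq_bigr => i _ /=.
  set x := left_shift _ _; have [Cx|Cx] := asboolP (C x).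
    rewrite asboolT; last by left.
    rewrite asboolF ?addr0// => Dx.
    by have : (C `&` D) x by []; rewrite CD.
  rewrite add0r; congr (_%:R); congr nat_of_bool.
  by apply/asboolP/asboolP => [[//|//]|]; right.
have prmu n C : local n C -> pr mu C = frequency (visits C).
  by move=> lC; rewrite /pr (Hmu n C lC).
exists mu; split; last by move=> n C lC; rewrite (prmu n C lC); exact: hV lC.
apply: invariant_of_local => n C lC.
have lC1 := local_shift (m := 1) lC.
rewrite (Hmu _ _ lC1) (Hmu n C lC); congr (_%:E).
apply: (has_frequency_unique l2 (F := visits C)); last exact: hV lC.
apply: (has_frequency_bounded rs l2 (C := 1) (hV _ _ lC1)) => w.
(* the two sums of visits telescope *)
rewrite /visits -sumrB.
under eq_bigr do rewrite /= left_shiftD -PoszD add1n.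
rewrite telescope_sumr//; exact: bool_close.
Qed.

(** Illegal words do not occur at any level, so they are null, and they are
    countably many. *)
Lemma frequency_measure_ex : exists mu : probability (borel_shift A) R,
  invariant_probability (subshift theta) mu /\
  forall w : seq A, has_frequency theta P l (fun s => (occurrences w s)%:R)
    (pr mu [set x | subword x 0 (size w) = w]).
Proof.
have [mu [inv Hmu]] := frequency_measure_visits.
have Hocc (w : seq A) : has_frequency theta P l (fun s => (occurrences w s)%:R)
    (pr mu [set x | subword x 0 (size w) = w]).
  have -> : [set x | subword x 0 (size w) = w] =
      word (size w) @^-1` [set in_tuple w].
    apply/seteqP; split=> x /=; rewrite -val_word.
      by move=> xw; apply: val_inj.
    by move=> ->.
  have lw := @word_local A (size w) (in_tuple w).
  apply: (has_frequency_bounded rs l2 (Hmu _ _ lw)) => s.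
  exact: (visits_word (in_tuple w)).
exists mu; split => //; split => //.
have zero (w : seq A) : ~ language theta w ->
    pr mu [set x | subword x 0 (size w) = w] = 0.
  move=> nw; apply: (has_frequency_unique l2 (Hocc w)) => e e0.
  exists 1%N => j j1 a; rewrite mul0r subr0.
  rewrite (@eq_expect _ _ theta P j [:: a] _ (fun=> 0)).
    by rewrite (expect_cst rs) normr0 mulr_ge0// ltW.
  move=> s sj; have := @occurrences_gt0 w s.
  rewrite (size_iter_realisations hl sj) muln1 expn_gt0.
  have -> : (0 < l)%N by lia.
  move=> /(_ isT); case: occurrences => //= n /esym ws.
  by case: nw; exists j, a, s.
pose B n := [set x : borel_shift A | ~ language theta (window n x)].
have mB n : measurable (B n).
  by apply: (@local_measurable A n) => x y xy; rewrite /B /mkset ((windowP n x y).2 xy).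
have B0 n : mu (B n) = 0%E.
  rewrite prE//; congr (_%:E).
  pose Q (w : (n + n).+1.-tuple A) := `[< ~ language theta w >].
  have -> : B n = [set x | Q (window n x)].
    by apply/seteqP; split=> x /asboolP.
  rewrite (pr_pred mu Q (@observable_window A n)).
  apply: big1 => w /asboolP /zero; rewrite size_tuple => w0.
  rewrite -[RHS]w0 -[RHS](pr_shift inv (- n%:Z)); last first.
    exact: (local_measurable (@subword_local A (n + n).+1 w)).
  congr pr; apply/seteqP; split=> x /=.
    by move=> <-; rewrite val_window subword_shift addr0.
  rewrite subword_shift addr0 -val_window => xw; exact: val_inj.
have : mu (~` subshift theta) = 0%E.
  have -> : ~` subshift theta = \bigcup_n B n.
    apply/seteqP; split=> x /=.
      move=> nX; apply: contrapT => H; apply: nX; apply/subshift_windowP => n.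
      by apply: contrapT => nn; apply: H; exists n.
    by move=> [n _ Bn] Xx; apply: Bn; exact: (subshift_windowP theta x).1.
  apply/eqP; rewrite eq_le measure_ge0 andbT.
  apply: le_trans (measure_sigma_subadditive mu mB _ (@subset_refl _ _)) _.
    exact: bigcupT_measurable.
  by rewrite eseries0// => n _ _; exact: B0.
rewrite probability_setC; last exact: subshift_measurable.
move=> H; have := subshift_measurable theta; move=> /(prE mu) E.
move: H; rewrite E -EFinB => -[] H; congr (_%:E); lra.
Qed.

Lemma language_frequency_gt0 w x : language theta w ->
  has_frequency theta P l (fun s => (occurrences w s)%:R) x -> 0 < x.
Proof.
move=> [k [a [v [k0 vk wv]]]] Hx.
have [D aD] := occurrences_almost_additive w.
apply: (has_frequency_gt0 rs hl l2 irr aD Hx _ _ vk).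
- by move=> s; rewrite ler0n.
- by move=> s t; rewrite -natrD ler_nat occurrences_super.
rewrite ltr0n occurrences_gt0// (size_iter_realisations hl vk) muln1 expn_gt0.
by have -> : (0 < l)%N by lia.
Qed.

(** A legal word has positive measure, while the complement of the subshift is
    null. *)
Lemma language_extends w : language theta w ->
  exists2 x, subshift theta x & subword x 0 (size w) = w.
Proof.
move=> Lw; have [mu [[X1 _] Hocc]] := frequency_measure_ex.
have := language_frequency_gt0 Lw (Hocc w).
apply: contraPP => H; apply/negP; rewrite -leNgt.
rewrite (_ : [set _ | _] = ~` subshift theta `&` [set x | subword x 0 (size w) = w]).
  apply: (@le_trans _ _ (pr mu (~` subshift theta))).
    apply: pr_le.
    - apply: measurableI; first by apply: measurableC; exact: subshift_measurable.
      exact: (local_measurable (@subword_local A (size w) w)).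
    - by apply: measurableC; exact: subshift_measurable.
    - by move=> x [].
  by rewrite prC /pr ?X1 ?subrr//; exact: subshift_measurable.
apply/seteqP; split=> x /=; last by case.
by move=> xw; split=> // Xx; apply: H; exists x.
Qed.

End frequency_measures.

(** * Recognisability at all levels *)

Lemma concat_blocks (A : alphabetType) N (v : int -> seq A) : (0 < N)%N ->
  (forall i, size (v i) = N) ->
  exists z : int -> A, forall i, subword z (i * N%:Z) N = v i.
Proof.
move=> N0 sv.
have L0 : N%:Z != 0 by lia.
exists (fun p => nth (point : A) (v (p %/ N%:Z)%Z) `|(p %% N%:Z)%Z|%N) => i.
apply: (@eq_from_nth A point); first by rewrite size_subword sv.
move=> k; rewrite size_subword => kL; rewrite nth_subword//.
have kk : 0 <= k%:Z < `|N%:Z| by apply/andP; split; lia.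
by rewrite divzMDl// modzMDl divz_small// addr0 modz_small.
Qed.

Section recognisability.
Context {A : alphabetType} {theta : A -> {fset seq A}} {l : nat}.
Hypothesis th0 : forall a, theta a != fset0.
Hypothesis hl : constant_length theta l.
Hypothesis l2 : (2 <= l)%N.
Hypothesis rec : recognisable theta.
Implicit Types (x y z : int -> A).

Notation img := (iter_realisations theta).
Notation X := (subshift theta).

Let l_gt0 j : (0 < l ^ j)%N. Proof. by rewrite expn_gt0; lia. Qed.

(** [x] is obtained from [y] by [j] substitution steps, the image of [y 0]
    starting at the origin. *)
Definition desubst j x y := forall i : int,
  subword x (i * (l ^ j)%:Z) (l ^ j) \in img j [:: y i].

Lemma iter_realisations1 a : img 1 [:: a] =i theta a.
Proof.
move=> w; rewrite -realisations1; apply/iter_realisationsS/idP.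
  by move=> [v]; rewrite inE => /eqP ->.
by move=> wa; exists [:: a]; rewrite ?inE.
Qed.

Lemma desubst1P x y : subst_sequence theta y x <-> desubst 1 x y.
Proof.
split=> [[v [c [vy c0 cS cv]]] i|H].
  have sv j : size (v j) = l by exact: hl (vy j).
  have cE : forall j : int, c j = j * l%:Z.
    have pos (n : nat) : c n%:Z = n%:Z * l%:Z.
      elim: n => [|n IH]; first by rewrite c0 mul0r.
      by rewrite -addn1 PoszD cS IH sv; lia.
    have neg (n : nat) : c (- n%:Z) = - n%:Z * l%:Z.
      elim: n => [|n IH]; first by rewrite oppr0 c0 mul0r.
      have := cS (- n.+1%:Z); rewrite sv.
      have -> : - n.+1%:Z + 1 = - n%:Z :> int by lia.
      by rewrite IH; lia.
    by case=> n; [exact: pos|rewrite NegzE; exact: neg].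
  by rewrite iter_realisations1 expn1 -cE -(sv i) cv.
exists (fun i => subword x (i * l%:Z) l), (fun i => i * l%:Z); split.
- by move=> i; have := H i; rewrite iter_realisations1 expn1.
- by rewrite mul0r.
- by move=> i; rewrite size_subword; lia.
- by move=> i; rewrite size_subword.
Qed.

Lemma subst_lengthE a : subst_length theta a = l.
Proof.
rewrite /subst_length; have /fset0Pn [s sa] := th0 a.
apply/eqP; rewrite eqn_leq; apply/andP; split.
  by apply/bigmax_leqP_seq => t ta _; rewrite (hl ta).
by rewrite -{1}(hl sa); exact: leq_bigmax_seq.
Qed.

Lemma desubst_word j x y (i : int) n : desubst j x y ->
  subword x (i * (l ^ j)%:Z) (l ^ j * n) \in img j (subword y i n).
Proof.
move=> xy; apply: (flatten_iter_realisations (l := l)).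
  by rewrite !size_subword.
move=> k c; rewrite size_subword => kn.
have kN : (l ^ j + k * l ^ j <= l ^ j * n)%N.
  by rewrite -mulSn mulnC leq_mul2l kn orbT.
rewrite drop_subword; last by apply: leq_trans kN; rewrite leq_addl.
rewrite take_subword; last first.
  by rewrite leq_subRL 1?addnC//; apply: leq_trans kN; rewrite leq_addl.
rewrite nth_subword//.
rewrite (_ : _ + _ = (i + k%:Z) * (l ^ j)%:Z); first exact: xy.
by rewrite mulrDl PoszM.
Qed.

Lemma desubst_shift j x y m : desubst j x y ->
  desubst j (left_shift (m * (l ^ j)%:Z) x) (left_shift m y).
Proof.
move=> xy i; rewrite subword_shift /left_shift.
by rewrite -mulrDl addrC; exact: xy.
Qed.

Lemma language_image j u w : language theta u -> w \in img j u ->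
  language theta w.
Proof.
move=> [k [a [v [k0 vk /infixP[p [q vE]]]]]] wu.
have [p' pp'] := iter_realisations_ex th0 j p.
have [q' qq'] := iter_realisations_ex th0 j q.
exists (k + j)%N, a, (p' ++ w ++ q'); split; first by rewrite addn_gt0 k0.
  apply/iter_realisationsD; exists v => //; rewrite vE.
  apply/iter_realisations_catP; exists p', (w ++ q'); split=> //.
  by apply/iter_realisations_catP; exists w, q'.
by apply/infixP; exists p', q'.
Qed.

Lemma desubst_subshift j x y : desubst j x y -> X y -> X x.
Proof.
move=> xy Xy; apply/subshift_windowP => n.
have := language_image (Xy (- n.+1%:Z) (n.+1 + n.+1)%N)
  (desubst_word (- n.+1%:Z) (n.+1 + n.+1) xy).
move=> /language_infix; apply; rewrite val_window; apply: infix_subword.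
  by have := l_gt0 j; nia.
by have := l_gt0 j; nia.
Qed.

Lemma desubst_comp j x y z : desubst 1 x z -> desubst j z y ->
  desubst j.+1 x y.
Proof.
move=> xz zy i; apply/iter_realisationsS; exists (subword z (i * (l ^ j)%:Z) (l ^ j)).
  exact: zy.
have := desubst_word (i * (l ^ j)%:Z) (l ^ j) xz.
rewrite expn1 -expnS => /iter_realisationsS [v]; rewrite inE => /eqP ->.
by rewrite -mulrA -PoszM -expnSr.
Qed.

(** The images at level [j] of the letters of [y], chosen one by one, are glued into
    the intermediate point. *)
Lemma desubst_split j x y : desubst j.+1 x y ->
  exists2 z, desubst 1 x z & desubst j z y.
Proof.
move=> xy.
have /choice[v Hv] : forall i : int, exists v, v \in img j [:: y i] /\
    subword x (i * (l ^ j.+1)%:Z) (l ^ j.+1) \in realisations theta v.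
  by move=> i; have /iter_realisationsS[v ? ?] := xy i; exists v.
have sv i : size (v i) = (l ^ j)%N.
  by rewrite (size_iter_realisations hl (Hv i).1) muln1.
have [z zv] := concat_blocks (l_gt0 j) sv.
exists z => [p|i]; last by rewrite zv; exact: (Hv i).1.
rewrite (divz_eq p (l ^ j)%:Z); set i := (p %/ _)%Z.
have [k kL ->] : exists2 k : nat, (k < l ^ j)%N & (p %% (l ^ j)%:Z)%Z = k%:Z.
  have L0 : (l ^ j)%:Z != 0 by have := l_gt0 j; case: (l ^ j)%N.
  have q0 : 0 <= (p %% (l ^ j)%:Z)%Z by exact: modz_ge0.
  have qL : (p %% (l ^ j)%:Z)%Z < (l ^ j)%:Z by rewrite ltz_pmod// ltz_nat.
  move: (l ^ j)%N (p %% (l ^ j)%:Z)%Z q0 qL => N q q0 qN.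
  by exists `|q|%N; lia.
have vi : subword x (i * (l ^ j.+1)%:Z) (l ^ j.+1) \in img 1 (v i).
  by apply/iter_realisationsS; exists (v i); rewrite ?inE//; exact: (Hv i).2.
have := iter_realisations_flatten hl vi; rewrite sv => /(_ k point kL).
have kl : (l + k * l <= l ^ j.+1)%N by rewrite -mulSn expnSr leq_mul2r kL orbT.
rewrite expn1 drop_subword; last by apply: leq_trans kl; rewrite leq_addl.
rewrite take_subword; last first.
  by rewrite leq_subRL 1?addnC//; apply: leq_trans kl; rewrite leq_addl.
rewrite -zv nth_subword// (_ : (i * (l ^ j)%:Z + k%:Z) * l%:Z =
  i * (l ^ j.+1)%:Z + (k * l)%N%:Z)//.
by rewrite mulrDl -mulrA -PoszM -expnSr.
Qed.

Lemma desubst_ex1 x : X x -> exists y k,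
  [/\ X y, (k < l)%N & desubst 1 (left_shift (- k%:Z) x) y].
Proof.
move=> Xx; have [_ /(_ x Xx) [[y k] [[Xy kl /desubst1P xy] _]]] := rec.
by exists y, k; split => //; move: kl; rewrite /= subst_lengthE.
Qed.

Lemma desubst_unique1 x y k y' k' : X x ->
  X y -> (k < l)%N -> desubst 1 (left_shift (- k%:Z) x) y ->
  X y' -> (k' < l)%N -> desubst 1 (left_shift (- k'%:Z) x) y' ->
  y = y' /\ k = k'.
Proof.
move=> Xx Xy kl xy Xy' kl' xy'.
have [_ /(_ x Xx) [yk [_ U]]] := rec.
have e1 := U (y, k) (And3 Xy _ _); rewrite subst_lengthE in e1.
have e2 := U (y', k') (And3 Xy' _ _); rewrite subst_lengthE in e2.
have := e1 kl ((desubst1P _ _).2 xy); rewrite (e2 kl' ((desubst1P _ _).2 xy')).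
by case.
Qed.

(** Recognisability is applied once per level: the phases add up to the expansion
    of [k] in base [l]. *)
Lemma desubst_ex j x : X x -> exists y k,
  [/\ X y, (k < l ^ j)%N & desubst j (left_shift (- k%:Z) x) y].
Proof.
elim: j x => [|j IH] x Xx.
  exists x, 0%N; split => // i; rewrite oppr0 left_shift0 mulr1 inE.
  by rewrite /subword /= addr0.
have [y [k [Xy kl xy]]] := desubst_ex1 Xx.
have [z [k' [Xz kl' yz]]] := IH y Xy.
exists z, (k + k' * l)%N; split=> //.
  have : (k'.+1 * l <= l ^ j * l)%N by rewrite leq_mul2r kl' orbT.
  by rewrite expnSr mulSn; move: (l ^ j * l)%N => M h; lia.
have := desubst_comp (desubst_shift (- k'%:Z) xy) yz.
by rewrite left_shiftD expn1 (_ : _ + _ = - (k + k' * l)%N%:Z)//; lia.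
Qed.

Lemma desubst_unique j x y k y' k' : X x ->
  X y -> (k < l ^ j)%N -> desubst j (left_shift (- k%:Z) x) y ->
  X y' -> (k' < l ^ j)%N -> desubst j (left_shift (- k'%:Z) x) y' ->
  y = y' /\ k = k'.
Proof.
elim: j x y k y' k' => [|j IH] x y k y' k' Xx Xy kl xy Xy' kl' xy'.
  have k0 : k = 0%N by move: kl; rewrite expn0; lia.
  have k0' : k' = 0%N by move: kl'; rewrite expn0; lia.
  split; last by rewrite k0 k0'.
  apply/funext => i; have := xy i; have := xy' i; rewrite k0 k0' !inE.
  by move=> /eqP -> /eqP [].
have l0 : (0 < l)%N by lia.
have key y0 k0 : X y0 -> (k0 < l ^ j.+1)%N ->
    desubst j.+1 (left_shift (- k0%:Z) x) y0 -> exists y1,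
    [/\ X y1, desubst 1 (left_shift (- (k0 %% l)%N%:Z) x) y1,
      (k0 %/ l < l ^ j)%N & desubst j (left_shift (- (k0 %/ l)%N%:Z) y1) y0].
  move=> Xy0 kl0 /desubst_split[z xz zy].
  have Xz := desubst_subshift zy Xy0.
  exists (left_shift (k0 %/ l)%N%:Z z); split.
  - exact: subshift_shift.
  - have := desubst_shift (k0 %/ l)%N%:Z xz; rewrite left_shiftD expn1.
    rewrite (_ : _ + _ = - (k0 %% l)%N%:Z)//.
    by rewrite {2}(divn_eq k0 l); lia.
  - by rewrite ltn_divLR// mulnC -expnS.
  - by rewrite left_shiftD addNr left_shift0.
have [y1 [Xy1 xy1 q1 r1]] := key _ _ Xy kl xy.
have [y2 [Xy2 xy2 q2 r2]] := key _ _ Xy' kl' xy'.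
have [y12 kk] := desubst_unique1 Xx Xy1 (ltn_pmod k l0) xy1 Xy2 (ltn_pmod k' l0) xy2.
rewrite -y12 in r2; have [-> qq] := IH _ _ _ _ _ Xy1 Xy q1 r1 Xy' q2 r2.
by split=> //; rewrite (divn_eq k l) (divn_eq k' l) kk qq.
Qed.

(** The points with a level [j] image of [a] starting at the origin; by
    recognisability their shifts partition the subshift. *)
Definition base j a : set (int -> A) :=
  [set x | exists y, [/\ X y, desubst j x y & y 0 = a]].

Lemma base_subshift j a : base j a `<=` X.
Proof. by move=> x [y [Xy xy _]]; exact: desubst_subshift Xy. Qed.

(** By compactness, a desubstitution exists once all finite windows have one. *)
Lemma base_closed j a : closed (base j a : set (full_shift A)).
Proof.
pose M n := [set xy : (int -> A) * (int -> A) | forall i : int, (`|i| <= n)%N ->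
  subword xy.1 (i * (l ^ j)%:Z) (l ^ j) \in img j [:: xy.2 i]].
have ME : base j a = \bigcap_n [set x | exists y, [/\ X y, M n (x, y) & y 0 = a]].
  apply/seteqP; split=> x.
    by move=> [y [Xy xy y0]] n _; exists y; split => // i _; exact: xy.
  move=> H; pose B n : set (full_shift A) := [set y | [/\ X y, M n (x, y) & y 0 = a]].
  have [|||y By] := @decreasing_closed_meet A B.
  - move=> n; rewrite (_ : B n = X `&` [set y | M n (x, y) /\ y 0 = a]).
      apply: closedI; first exact: subshift_closed.
      apply: (@local_closed A n) => y y' yy' [My ya].
      by split=> [i ni|]; rewrite /= -yy'//; exact: My.
    by apply/seteqP; split=> y; [case|case=> ? []].
  - by move=> n y [Xy My y0]; split=> // i ni; apply: My; rewrite (leq_trans ni).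
  - by move=> n; have [y] := H n I; exists y.
  exists y; split; [by have [] := By 0%N| |by have [] := By 0%N].
  by move=> i; have [_ My _] := By `|i|%N; exact: My.
rewrite ME; apply: closed_bigI => n _.
apply: (@local_closed A (n.+1 * l ^ j)%N) => x x' xx' [y [Xy My ya]].
exists y; split=> // i ni; have := My i ni => /=.
suff -> : subword x (i * (l ^ j)%:Z) (l ^ j) = subword x' (i * (l ^ j)%:Z) (l ^ j).
  by [].
apply/eq_in_map => k; rewrite mem_iota => /= kl.
by apply: xx'; nia.
Qed.

Lemma base_measurable j a : measurable (base j a : set (borel_shift A)).
Proof. apply: closed_measurable_shift; exact: base_closed. Qed.

Lemma base_word j a x : base j a x -> subword x 0 (l ^ j) \in img j [:: a].
Proof. by move=> [y [_ xy <-]]; have := xy 0; rewrite mul0r. Qed.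

Lemma base_ex j x : X x -> exists2 k, (k < l ^ j)%N &
  exists a, base j a (left_shift (- k%:Z) x).
Proof.
move=> /(desubst_ex j) [y [k [Xy kl xy]]].
by exists k => //; exists (y 0), y.
Qed.

Lemma base_unique j x k a k' a' : X x -> (k < l ^ j)%N -> (k' < l ^ j)%N ->
  base j a (left_shift (- k%:Z) x) -> base j a' (left_shift (- k'%:Z) x) ->
  k = k' /\ a = a'.
Proof.
move=> Xx kl kl' [y [Xy xy <-]] [y' [Xy' xy' <-]].
by have [-> ->] := desubst_unique Xx Xy kl xy Xy' kl' xy'.
Qed.

Lemma base_inj j x a a' : base j a x -> base j a' x -> a = a'.
Proof.
move=> xa xa'; have Xx := base_subshift xa; rewrite -[x]left_shift0 -oppr0 in xa xa'.
by have [] := base_unique Xx (l_gt0 j) (l_gt0 j) xa xa'.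
Qed.

Lemma base_orbit j a x : base j a x -> exists y, [/\ X y, y 0 = a &
  forall i : int, base j (y i) (left_shift (i * (l ^ j)%:Z) x)].
Proof.
move=> [y [Xy xy y0]]; exists y; split => // i.
exists (left_shift i y); split; first exact: subshift_shift.
  exact: desubst_shift.
by rewrite /left_shift add0r.
Qed.

(** Disjoint closed sets are separated by a window, so the letter from which a block
    comes can be read off a bounded neighbourhood of its first position. *)
Lemma base_window j : exists r, forall a b x x', base j a x -> base j b x' ->
  agree r x x' -> a = b.
Proof.
have /choice[r Hr] : forall ab : A * A, exists r, ab.1 != ab.2 -> forall x x',
    base j ab.1 x -> base j ab.2 x' -> ~ agree r x x'.
  move=> [a b] /=; have [->|ab] := eqVneq a b; first by exists 0%N.
  have [|r Hr] := separating_window (@base_closed j a) (@base_closed j b).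
    by apply/seteqP; split=> // x [xa /(base_inj xa)/eqP]; rewrite (negPf ab).
  by exists r => _; exact: Hr.
exists (\max_ab r ab) => a b x x' xa xb xx'.
apply/eqP/negP => /negP ab; apply: (Hr (a, b) ab x x' xa xb).
by apply: agreeW xx'; exact: leq_bigmax.
Qed.

End recognisability.
Arguments base {A} theta l j a.
Arguments desubst {A} theta l j x y.

(** * Uniform weights and potentials *)

Section uniform.
Context {R : realType} {A : alphabetType} {theta : A -> {fset seq A}} {l : nat}.

Notation U := (uniform_weights theta : A -> seq A -> R).
Notation img := (iter_realisations theta).

Lemma uniform_random_substitution (P : A -> seq A -> R) :
  random_substitution theta P -> random_substitution theta U.
Proof.
move=> [t0 tn _ _]; have c0 a : 0 < #|` theta a|%:R :> R.
  by rewrite ltr0n cardfs_gt0.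
split=> // [a s _|a]; first by rewrite invr_gt0.
rewrite /uniform_weights big_const_seq count_predT iter_addr_0.
by rewrite -[X in X = _]mulr_natl divff// gt_eqF.
Qed.

Hypothesis rs : random_substitution theta U.
Hypothesis hl : constant_length theta l.
Hypothesis l2 : (2 <= l)%N.
Hypothesis irr : exists k, forall a b, exists2 w,
  w \in img k [:: a] & b \in w.
Hypothesis rec : recognisable theta.

Let th0 a : theta a != fset0. Proof. by have [] := rs. Qed.

Definition log_choices (a : A) : R := ln #|` theta a|%:R.

Definition prob n (u v : seq A) : R := expect theta U n u (fun w => (w == v)%:R).

Lemma prob_ge0 n u v : 0 <= prob n u v.
Proof. by apply: (expect_ge0 rs) => w _; rewrite ler0n. Qed.

Lemma prob_eq0 n u v : v \notin img n u -> prob n u v = 0.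
Proof.
move=> vn; rewrite /prob -(expect_cst rs n u 0); apply: eq_expect => w wn.
by have [wv|//] := eqVneq w v; rewrite -wv wn in vn.
Qed.

Lemma expect_words n u N f : (forall w, w \in img n u -> size w = N) ->
  expect theta U n u f = \sum_(t : N.-tuple A) prob n u t * f t.
Proof.
move=> HN; transitivity (expect theta U n u (fun w =>
    \sum_(t : N.-tuple A) f t * (w == t)%:R)).
  apply: eq_expect => w wn; have /eqP sw := HN w wn.
  rewrite (bigD1 (Tuple sw))//= eqxx mulr1 big1 ?addr0// => t tw.
  have [wt|] := eqVneq w t; last by rewrite mulr0.
  by case/eqP: tw; apply: val_inj; rewrite /= wt.
by rewrite expect_sum; apply: eq_bigr => t _; rewrite expectZ mulrC.
Qed.

(** Constant length: a word is obtained from [u] in at most one way, and then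
    with the product of the uniform weights. *)
Lemma prob1E u s : prob 1 u s =
  (s \in realisations theta u)%:R * expR (- letter_sum log_choices u).
Proof.
rewrite /prob; elim: u s => [|a u IH] s.
  by rewrite expect_nil inE letter_sum_nil oppr0 expR0 mulr1 eq_sym.
rewrite expect1_cons letter_sum_cons opprD expRD.
have c0 : 0 < #|` theta a|%:R :> R by rewrite ltr0n cardfs_gt0.
have -> : expR (- log_choices a) = #|` theta a|%:R^-1 :> R.
  by rewrite expRN lnK.
set e := expR _; set c := _^-1.
transitivity (\sum_(t <- theta a) (t == take l s)%:R *
    (c * ((drop l s \in realisations theta u)%:R * e))).
  rewrite big_seq [RHS]big_seq; apply: eq_bigr => t ta.
  rewrite /uniform_weights mulrCA; congr (_ * _).
  rewrite -IH -expectZ; apply: eq_expect => q _.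
  rewrite -{1}(cat_take_drop l s).
  have [sl|sl] := leqP l (size s).
    by rewrite eqseq_cat ?size_takel ?(hl ta)//; case: eqP; rewrite ?mul1r ?mul0r.
  have -> : t == take l s = false.
    apply/eqP => H; have := congr1 size H; rewrite (hl ta) size_take.
    by rewrite ltnNge (ltnW sl) /= => ls; rewrite -ls ltnn in sl.
  rewrite cat_take_drop mul0r; case: eqP => // H.
  by move: sl; rewrite -H size_cat (hl ta) ltnNge leq_addr.
rewrite -mulr_suml.
have -> : \sum_(t <- theta a) (t == take l s)%:R = (take l s \in theta a)%:R :> R.
  rewrite -natr_sum; congr (_%:R).
  rewrite (eq_bigr (fun t => if pred1 (take l s) t then 1 else 0)%N); last first.
    by move=> t _ /=; case: eqP.
  by rewrite -big_mkcond sum1_count count_uniq_mem// fset_uniq.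
have -> : (s \in realisations theta (a :: u)) =
    (take l s \in theta a) && (drop l s \in realisations theta u).
  apply/allpairsP/andP => [[[t q] [/= ta qu ->]]|[ta qu]].
    by rewrite take_size_cat ?(hl ta)// drop_size_cat ?(hl ta).
  by exists (take l s, drop l s); rewrite cat_take_drop.
by rewrite -mulnb natrM; ring.
Qed.

(** By [base_window] a letter of a legal preimage is determined by the part of [s]
    around its image, except near the ends. Hence only boundedly many letters are
    free, whatever the length. *)
Lemma preimages_bounded : exists K : nat, forall M s,
  (#|[pred u : M.-tuple A | `[< language theta u >] &&
      (s \in realisations theta u)]| <= K)%N.
Proof.
have [r Hr] := base_window th0 hl l2 rec 1.
pose c := r.+1.
exists #|{ffun 'I_(c + c) -> A}| => M s.
pose W := [pred u : M.-tuple A | `[< language theta u >] &&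
      (s \in realisations theta u)].
pose ends (u : M.-tuple A) : {ffun 'I_(c + c) -> A} :=
  [ffun k : 'I_(c + c) => nth point u (if (k < c)%N then k : nat else (M - c + (k - c))%N)].
have ext (u : M.-tuple A) : u \in W -> exists2 x, subword x 0 (l * M) = s &
    forall i : nat, (i < M)%N -> base theta l 1 (nth point u i)
      (left_shift (i%:Z * l%:Z) x).
  rewrite inE => /andP[/asboolP Lu su].
  (* extend [u] to a point of the subshift and substitute it, using [s] for the
     images of the letters of [u] *)
  have [y Xy yu] := language_extends rs hl l2 irr Lu.
  rewrite size_tuple in yu.
  have /choice[b Hb] : forall a, exists t, t \in theta a.
    by move=> a; exact/fset0Pn/th0.
  have ss : size s = (l * M)%N by rewrite (size_realisations hl su) size_tuple.
  have su1 : s \in img 1 u.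
    by apply/iter_realisationsS; exists (u : seq A); rewrite ?inE.
  pose blk (i : int) : seq A := if (0 <= i) && (i < M%:Z)
    then take l (drop (`|i|%N * l) s) else b (y i).
  have blkE (i : nat) : (i < M)%N -> blk i%:Z = take l (drop (i * l) s).
    by move=> iM; rewrite /blk ifT//; apply/andP; split; lia.
  have blk1 i : blk i \in img 1 [:: y i].
    have [/andP[i0 iM]|iM] := boolP ((0 <= i) && (i < M%:Z)).
      have [k kM ki] : exists2 k : nat, (k < M)%N & i = k%:Z.
        by exists `|i|%N; lia.
      have := iter_realisations_flatten hl su1 (i := k) point.
      rewrite size_tuple expn1 => /(_ kM).
      by rewrite ki blkE// -yu nth_subword// add0r.
    by rewrite /blk (negPf iM) iter_realisations1.
  have l0 : (0 < l)%N by lia.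
  have sblk i : size (blk i) = l.
    by rewrite (size_iter_realisations hl (blk1 i)) muln1 expn1.
  have [x xblk] := concat_blocks l0 sblk.
  have xy : desubst theta l 1 x y by move=> i; rewrite expn1 xblk.
  exists x.
    apply: (@eq_from_nth A point); first by rewrite size_subword ss.
    move=> q; rewrite size_subword => ql; rewrite nth_subword// add0r.
    have qM : (q %/ l < M)%N by rewrite ltn_divLR// mulnC.
    have qk : (q %% l < l)%N by rewrite ltn_pmod.
    have -> : q%:Z = (q %/ l)%N%:Z * l%:Z + (q %% l)%N%:Z.
      by rewrite {1}(divn_eq q l); lia.
    rewrite -(nth_subword point x _ qk) xblk blkE// nth_take// nth_drop.
    by rewrite {3}(divn_eq q l).
  move=> i iM; exists (left_shift i%:Z y); split; first exact: subshift_shift.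
    by have := desubst_shift i%:Z xy; rewrite expn1.
  by rewrite /left_shift add0r -yu nth_subword// add0r.
rewrite -(card_in_imset (f := ends) (D := W)); first exact: max_card.
move=> u u' uW uW' ee; apply: val_inj; apply: (@eq_from_nth A point).
  by rewrite !size_tuple.
move=> i; rewrite size_tuple => iM.
have ek (k : nat) : (k < c + c)%N ->
    nth point u (if (k < c)%N then k else (M - c + (k - c))%N) =
    nth point u' (if (k < c)%N then k else (M - c + (k - c))%N).
  move=> kc; have := congr1 (fun f : {ffun 'I_(c + c) -> A} => f (Ordinal kc)) ee.
  by rewrite !ffunE.
have [ic|ci] := ltnP i c.
  by have := ek i (ltn_addr _ ic); rewrite ic.
have [Mi|iMc] := leqP (M - c) i.
  have kc : (c + (i - (M - c)) < c + c)%N by lia.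
  by have := ek _ kc; rewrite ltnNge leq_addr /= addKn subnKC.
have [x xs xb] := ext u uW; have [x' xs' xb'] := ext u' uW'.
apply: (Hr _ _ _ _ (xb i iM) (xb' i iM)) => z zr.
have iil : (i <= i * l)%N by rewrite leq_pmulr; lia.
have icl : (i * l + c <= l * M)%N.
  apply: (@leq_trans ((i + c) * l)); last by rewrite mulnC leq_mul2l; lia.
  by rewrite mulnDl leq_add2l leq_pmulr; lia.
rewrite /left_shift; have [p [pl ->]] : exists p : nat, (p < l * M)%N /\
    z + i%:Z * l%:Z = 0 + p%:Z :> int.
  rewrite /c in icl ci; exists `|(z + i%:Z * l%:Z)%R|%N.
  rewrite -PoszM; move: (i * l)%N (l * M)%N iil icl => a b' h1 h2.
  by split; lia.
by rewrite -(nth_subword point x 0 pl) xs -(nth_subword point x' 0 pl) xs'.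
Qed.

Section potential.
Variable G : A -> R.
Hypothesis G1 : forall a s, s \in theta a ->
  letter_sum G s = G a + log_choices a.

Lemma potential_realisations u s : s \in realisations theta u ->
  letter_sum G s = letter_sum G u + letter_sum log_choices u.
Proof.
elim: u s => [|a u IH] s /=.
  by rewrite inE => /eqP ->; rewrite !letter_sum_nil addr0.
move=> /allpairsP[[t q] [/= ta /IH qu ->]].
by rewrite letter_sum_cat !letter_sum_cons (G1 ta) qu addrACA.
Qed.

(** Along any history leading from [v] to [s] the weights multiply to
    [expR (G v - G s)], since the numbers of choices telescope through [G]. *)
Lemma prob_ge n v s : s \in img n v ->
  expR (letter_sum G v - letter_sum G s) <= prob n v s.
Proof.
elim: n s => [|n IH] s.
  rewrite inE => /eqP ->; rewrite subrr expR0 /prob expect0 eqxx.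
  by [].
move=> /iter_realisationsS [u uv su]; rewrite /prob -addn1 expect_add.
apply: (@le_trans _ _ (expect theta U n v (fun w => (w == u)%:R *
    expR (- letter_sum log_choices u)))).
  rewrite (eq_expect (g := fun w => expR (- letter_sum log_choices u) *
    (w == u)%:R)); last by move=> w _; rewrite mulrC.
  rewrite expectZ (potential_realisations su).
  have -> : letter_sum G v - (letter_sum G u + letter_sum log_choices u) =
    - letter_sum log_choices u + (letter_sum G v - letter_sum G u) by lra.
  by rewrite expRD ler_pM2l ?expR_gt0// IH.
apply: (le_expect rs) => w _; have [->|_] := eqVneq w u.
  by rewrite mul1r -[leRHS]/(prob 1 u s) prob1E su mul1r.
by rewrite mul0r -[leRHS]/(prob 1 w s) prob_ge0.
Qed.

(** Each step back multiplies the number of legal histories by at most the bound of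
    [preimages_bounded]. *)
Lemma prob_le : exists2 K : R, 1 <= K & forall n v s, language theta v ->
  prob n v s <= K ^+ n * expR (letter_sum G v - letter_sum G s).
Proof.
have [K0 HK] := preimages_bounded.
pose K : R := K0%:R + 1; exists K; first by rewrite lerDr.
have K00 : 0 <= K by rewrite addr_ge0.
move=> n v s Lv; elim: n s => [|n IH] s.
  rewrite /prob expect0 expr0 mul1r; have [->|_] := eqVneq v s.
    by rewrite subrr expR0.
  exact: expR_ge0.
rewrite /prob -addn1 expect_add.
rewrite (@expect_words n v (l ^ n * size v)); last first.
  by move=> w; exact: size_iter_realisations.
pose W := [pred u : (l ^ n * size v).-tuple A | `[< language theta u >] &&
      (s \in realisations theta u)].
set c := K ^+ n * expR (letter_sum G v - letter_sum G s).
have c0 : 0 <= c by rewrite mulr_ge0 ?expR_ge0 ?exprn_ge0.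
apply: (@le_trans _ _ (\sum_(u : (l ^ n * size v).-tuple A) if u \in W then c else 0)).
  apply: ler_sum => u _; rewrite -[expect _ _ _ _ _]/(prob 1 u s) prob1E.
  have [su|_] := boolP (s \in realisations theta u); last first.
    by rewrite mul0r mulr0; case: ifP.
  have [un|un] := boolP ((u : seq A) \in img n v); last first.
    by rewrite prob_eq0// mul0r; case: ifP.
  have Lu : language theta u by exact: (language_image th0 Lv un).
  rewrite inE su asboolT//= mul1r.
  apply: (le_trans (ler_wpM2r (expR_ge0 _) (IH u))).
  rewrite -mulrA -expRD /c (potential_realisations su).
  by rewrite (_ : _ + - letter_sum log_choices u = letter_sum G v -
    (letter_sum G u + letter_sum log_choices u))//; lra.
rewrite -big_mkcond sumr_const -(mulr_natl c) addn1 exprS -mulrA ler_wpM2r//.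
by rewrite /K; apply: (@le_trans _ _ K0%:R); rewrite ?ler_nat ?HK// lerDl.
Qed.

End potential.
End uniform.
Arguments log_choices {R A} theta a.
Arguments prob {R A} theta n u v.

(** * Partition functions and the upper entropy bound *)

Section supported_laws.
Context {R : realType} {A : alphabetType}.
Variables (nu : probability (borel_shift A) R) (Y : set (borel_shift A)).
Hypotheses (mY : measurable Y) (Y1 : nu Y = 1%E).

Lemma law_gt0_ex (J : finType) (Phi : borel_shift A -> J) j : observable Phi ->
  0 < law nu Phi j -> exists2 x, Y x & Phi x = j.
Proof.
move=> mPhi; apply: contraPP => H; apply/negP; rewrite -leNgt.
rewrite /law (@pr_eq_on _ _ nu Y _ set0)// ?pr0//.
by rewrite setI0; apply/seteqP; split=> // x [Yx xj]; apply: H; exists x.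
Qed.

Lemma law_eq_on (J : finType) (Phi Psi : borel_shift A -> J) j :
  observable Phi -> observable Psi -> (forall x, Y x -> Phi x = Psi x) ->
  law nu Phi j = law nu Psi j.
Proof.
move=> mPhi mPsi PP; apply: (@pr_eq_on _ _ nu Y) => //.
by apply/seteqP; split=> x /= [Yx xj]; split=> //=; rewrite -xj PP.
Qed.

End supported_laws.

Section potential_theory.
Context {R : realType} {A : alphabetType} {theta : A -> {fset seq A}} {l : nat}.

Notation U := (uniform_weights theta : A -> seq A -> R).
Notation img := (iter_realisations theta).
Notation X := (subshift theta).

Hypothesis rs : random_substitution theta U.
Hypothesis hl : constant_length theta l.
Hypothesis l2 : (2 <= l)%N.
Hypothesis irr : exists k, forall a b, exists2 w,
  w \in img k [:: a] & b \in w.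
Hypothesis rec : recognisable theta.

Let th0 a : theta a != fset0. Proof. by have [] := rs. Qed.
Let l_gt0 j : (0 < l ^ j)%N. Proof. by rewrite expn_gt0 (leq_trans _ l2). Qed.

Variable G : A -> R.
Hypothesis G1 : forall a s, s \in theta a ->
  letter_sum G s = G a + log_choices theta a.
Hypothesis G2 : forall k a s t, s \in img k [:: a] -> t \in img k [:: a] ->
  letter_sum G s = letter_sum G t.

(** This number will turn out to be the topological entropy. *)
Definition pressure_mean : R := frequency (theta := theta) (P := U) (l := l) (letter_sum G).
Local Notation h := pressure_mean.

(** The potential of a level [j] image depends on its letters only, so it equals its
    expectation, whose growth rate is the frequency. *)
Lemma potential_level e : 0 < e -> exists j, forall v s, s \in img j v ->
  `|letter_sum G s - h * (l ^ j * size v)%:R| <= e * (l ^ j * size v)%:R.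
Proof.
move=> e0; have [J HJ] := frequencyP rs hl l2 irr (letter_sum_additive G) e0.
exists J; elim=> [|a v IH] s.
  rewrite iter_realisations_nil inE => /eqP ->.
  by rewrite letter_sum_nil muln0 !mulr0 subrr normr0.
rewrite -cat1s => /iter_realisations_catP [s1 [s2 [s1a /IH s2v ->]]].
have : `|letter_sum G s1 - h * (l ^ J)%:R| <= e * (l ^ J)%:R.
  have := HJ J (leqnn J) a; congr (`|_ - _| <= _).
  rewrite -[RHS](expect_cst rs J [:: a]); apply: eq_expect => t ta.
  exact: G2 ta s1a.
move: s2v; rewrite letter_sum_cat size_cat mulnDr muln1 natrD !ler_norml.
by move=> /andP[? ?] /andP[? ?]; apply/andP; split; lra.
Qed.

(** Cut the word into images of letters of a high level, on which [G2] makes the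
    potential equal to its expectation; two incomplete images remain at the ends. *)
Lemma potential_subword e : 0 < e -> exists B, forall x n, X x ->
  `|letter_sum G (subword x 0 n) - h * n%:R| <= e * n%:R + B.
Proof.
move=> e0; have [j Hj] := potential_level e0.
have [C C0 HC] := letter_bound G; pose N := (l ^ j)%N.
exists (3 * C * N%:R + `|h| * N%:R) => x n Xx.
have [y [k [Xy kN xy]]] := desubst_ex th0 hl l2 rec j Xx.
pose m := (n %/ N)%N.
have mn : (N * m <= n)%N by rewrite mulnC leq_divM.
have nm : (n < N * m + N)%N by rewrite mulnC -mulSnr ltn_ceil// l_gt0.
have := Hj _ _ (desubst_word 0 m xy).
rewrite mul0r subword_shift addr0 size_subword -/N.
have e1 : subword x (- k%:Z) (k + n) = subword x (- k%:Z) k ++ subword x 0 n.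
  by rewrite subword_cat addNr.
have e2 : subword x (- k%:Z) (k + n) = subword x (- k%:Z) (N * m) ++
    subword x (- k%:Z + (N * m)%N%:Z) (k + n - N * m).
  by rewrite -subword_cat subnKC// (leq_trans mn)// leq_addl.
have := congr1 (letter_sum G) e1; rewrite e2 !letter_sum_cat.
have := norm_letter_sum (subword x (- k%:Z) k) HC; rewrite size_subword.
have := norm_letter_sum (subword x (- k%:Z + (N * m)%N%:Z) (k + n - N * m)) HC.
rewrite size_subword natrB; last by rewrite (leq_trans mn)// leq_addl.
rewrite natrD; set g1 := letter_sum _ _; set g2 := letter_sum _ _.
set g3 := letter_sum _ _; set g4 := letter_sum _ _.
have kN' : k%:R <= N%:R :> R by rewrite ler_nat ltnW.
have mn' : (N * m)%:R <= n%:R :> R by rewrite ler_nat.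
have nm' : n%:R <= (N * m)%:R + N%:R :> R by rewrite -natrD ler_nat ltnW.
have k0' : 0 <= k%:R :> R by [].
have hn : `|h * (N * m)%:R - h * n%:R| <= `|h| * N%:R.
  rewrite -mulrBr normrM ler_wpM2l// distrC ger0_norm ?subr_ge0//; lra.
have q1 : C * (k%:R + n%:R - (N * m)%:R) <= 2 * C * N%:R.
  by rewrite [2 * C]mulrC -mulrA ler_wpM2l//; lra.
have q2 : C * k%:R <= C * N%:R by rewrite ler_wpM2l.
have q3 : e * (N * m)%:R <= e * n%:R by rewrite ler_pM2l.
move: hn q1 q2 q3; rewrite !ler_norml.
do 4![move=> /andP[? ?]|move=> ?] => /andP[? ?] /andP[? ?] ? /andP[? ?].
by apply/andP; split; lra.
Qed.

Section invariant_measure.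
Variable nu : probability (borel_shift A) R.
Hypothesis nuX : invariant_probability (subshift theta) nu.

Let inv := proj2 nuX.

Lemma observable_letter (i : int) : observable (fun x : borel_shift A => x i).
Proof.
move=> a; apply: (@local_measurable A `|i|%N) => x y /(_ i (leqnn _)) xy.
by rewrite /preimage /= xy.
Qed.

Lemma mean_word n : mean nu (word n) (fun w => letter_sum G w) =
  n%:R * mean nu (fun x : borel_shift A => x 0) G.
Proof.
have -> : mean nu (word n) (fun w => letter_sum G w) =
    mean nu (word n) (fun w => \sum_(i < n) G (tnth w i)).
  apply: eq_bigr => w _; congr (_ * _); rewrite /letter_sum.
  by rewrite big_tuple.
rewrite mean_sum -[n%:R]/(n%:R) mulr_natl -[X in _ *+ X]card_ord -sumr_const.
apply: eq_bigr => i _.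
rewrite (@mean_comp _ _ nu _ _ (fun w : n.-tuple A => tnth w i) _ G); last first.
  exact: observable_word.
rewrite -[RHS](mean_shift inv i%:Z)//; last exact: observable_letter.
apply: eq_bigr => a _; congr (law nu _ _ * _); apply/funext => x /=.
by rewrite tnth_mktuple /left_shift add0r.
Qed.

(** Averaging [potential_subword] over long words: invariance turns the average into
    a multiple of the mean at the origin. *)
Lemma mean_potential : mean nu (fun x : borel_shift A => x 0) G = h.
Proof.
apply/eqP; rewrite -subr_eq0 -normr_le0; apply/ler_addgt0Pr => e e0.
rewrite add0r; have e2 : 0 < e / 2 by rewrite divr_gt0.
have [B HB] := potential_subword e2.
have [J HJ] := length_unbounded l2 B e2.
set g := mean _ _ _; pose n := (l ^ J)%N.
have n0 : 0 < n%:R :> R by rewrite ltr0n; exact: l_gt0.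
have key : `|n%:R * g - h * n%:R| <= e * n%:R.
  rewrite -mean_word ler_norml; have mw := @observable_word A n.
  have bnd w : 0 < law nu (word n) w ->
      `|letter_sum G w - h * n%:R| <= e * n%:R.
    move=> /(law_gt0_ex (subshift_measurable theta) (proj1 nuX) mw) [x Xx <-].
    rewrite val_word; apply: (le_trans (HB x n Xx)).
    by have := HJ J (leqnn J); rewrite -/n; lra.
  apply/andP; split.
    rewrite lerBrDl -[leLHS](mean_cst nu _ mw); apply: le_mean => w /bnd.
    by rewrite ler_norml => /andP[? _]; lra.
  rewrite lerBlDl -[leRHS](mean_cst nu _ mw); apply: le_mean => w /bnd.
  by rewrite ler_norml => /andP[_ ?]; lra.
by rewrite -(ler_pM2r n0) -[X in _ * X](gtr0_norm n0) -normrM mulrBl [g * _]mulrC.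
Qed.

End invariant_measure.

Definition legal n : pred (n.-tuple A) :=
  [pred w : n.-tuple A | `[< exists2 x, X x & word n x = w >]].
Arguments legal n : clear implicits.

(** A legal word sits inside the level [k] image of a word of length about
    [n / l ^ k], and by [prob_ge] the sum of [expR (- G)] over the images of a word
    is at most its value at that word; so only [n / l ^ k] letters contribute. *)
Lemma partition_function e : 0 < e -> exists B, forall n,
  \sum_(w in legal n) expR (- letter_sum G w) <= expR (e * n%:R + B).
Proof.
move=> e0; have [C C0 HC] := letter_bound G.
pose c : R := C + ln (#|A|%:R).
have A0 : 0 < #|A|%:R :> R by rewrite ltr0n; apply/card_gt0P; exists point.
have c0 : 0 <= c by rewrite addr_ge0// ln_ge0// ler1n -(ltr0n R).
have [k Hk] := length_unbounded l2 c e0.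
have {}Hk := Hk k (leqnn k); pose N := (l ^ k)%N; rewrite -/N in Hk.
have N0 : 0 < N%:R :> R by rewrite ltr0n l_gt0.
exists (ln N%:R + 2 * N%:R * C + 2 * c) => n.
pose M := (n %/ N).+2.
have nM : (n + N <= N * M)%N.
  by rewrite /M mulnC mulSn addnC leq_add2l ltnW// ltn_ceil// l_gt0.
have Mn : (N * M <= n + 2 * N)%N.
  by rewrite /M mulnC !mulSn addnA addnn -mul2n addnC leq_add2r leq_divM.
pose J := ('I_N * M.-tuple A * (N * M).-tuple A)%type.
pose g (j : J) : seq A := take n (drop j.1.1 j.2).
pose Q (j : J) : bool := (j.2 : seq A) \in img k j.1.2.
have cover w : w \in legal n -> exists2 j, Q j & g j = w.
  move=> wl; have /asboolP[x Xx xw] : `[< exists2 x, X x & word n x = w >] := wl.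
  have [y [p [Xy pN xy]]] := desubst_ex th0 hl l2 rec k Xx.
  exists (Ordinal pN, word M y, word (N * M) (left_shift (- p%:Z) x)).
    by have := desubst_word 0 M xy; rewrite mul0r -!val_word.
  rewrite -[LHS]/(take n (drop p (val (word (N * M) (left_shift (- p%:Z) x))))).
  rewrite val_word subword_shift addr0 drop_subword; last first.
    by apply: leq_trans nM; rewrite (leq_trans (ltnW pN)) ?leq_addl.
  rewrite addNr take_subword -?xw ?val_word// leq_subRL.
    by apply: leq_trans nM; rewrite addnC leq_add2l ltnW.
  by apply: leq_trans nM; rewrite (leq_trans (ltnW pN)) ?leq_addl.
have Gg (j : J) : size (g j) = n ->
    - letter_sum G (g j) <= - letter_sum G j.2 + 2 * N%:R * C.
  move=> sg; have e1 : (j.2 : seq A) = take j.1.1 j.2 ++ (g j ++ drop n (drop j.1.1 j.2)).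
    by rewrite /g !cat_take_drop.
  set a := take _ _ in e1; set b := drop n _ in e1.
  have sab : (size a)%:R + (size b)%:R <= 2 * N%:R :> R.
    rewrite -natrD -natrM ler_nat.
    have := congr1 size e1; rewrite size_tuple !size_cat sg.
    by move: Mn; lia.
  have := norm_letter_sum a HC; have := norm_letter_sum b HC.
  have -> : letter_sum G j.2 = letter_sum G a + (letter_sum G (g j) + letter_sum G b).
    by rewrite {1}e1 !letter_sum_cat.
  have : C * ((size a)%:R + (size b)%:R) <= C * (2 * N%:R) by rewrite ler_wpM2l.
  by rewrite !ler_norml => ? /andP[? ?] /andP[? ?]; lra.
have Hv (v : M.-tuple A) :
    \sum_(s : (N * M).-tuple A | (s : seq A) \in img k v) expR (- letter_sum G s) <=
    expR (C * M%:R).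
  apply: (@le_trans _ _ (\sum_(s : (N * M).-tuple A) prob theta k v s * expR (- letter_sum G v))).
    rewrite big_mkcond; apply: ler_sum => s _; case: ifP => sv; last first.
      by rewrite mulr_ge0 ?expR_ge0// prob_ge0.
    apply: (le_trans _ (ler_wpM2r (expR_ge0 _) (prob_ge rs hl G1 sv))).
    by rewrite -expRD ler_expR; lra.
  rewrite -mulr_suml -[leRHS]mul1r ler_pM ?expR_ge0//.
  - by rewrite sumr_ge0// => s _; exact: prob_ge0.
  - have := @expect_words R A theta k v (N * M) (fun=> 1).
    rewrite (expect_cst rs) => ->; last first.
      by move=> w wk; rewrite (size_iter_realisations hl wk) size_tuple.
    by apply: ler_sum => s _; rewrite mulr1.
  - rewrite ler_expR; have := norm_letter_sum v HC; rewrite size_tuple ler_norml.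
    by move=> /andP[? _]; lra.
apply: (@le_trans _ _ (\sum_(j | Q j) expR (- letter_sum G j.2 + 2 * N%:R * C))).
  apply: (@le_trans _ _ (\sum_(w : n.-tuple A)
      \sum_(j | Q j && (g j == w)) expR (- letter_sum G j.2 + 2 * N%:R * C))).
    rewrite big_mkcond; apply: ler_sum => w _; case: ifP => wl; last first.
      by rewrite sumr_ge0// => j _; exact: expR_ge0.
    have [j Qj gj] := cover w wl.
    rewrite (bigD1 j) ?Qj ?gj ?eqxx//= ler_wpDr//.
      by rewrite sumr_ge0// => i _; exact: expR_ge0.
    by rewrite ler_expR -gj Gg// gj size_tuple.
  rewrite (exchange_big_dep Q) /=; last by move=> w j _ /andP[].
  apply: ler_sum => j Qj; have [sg|sg] := boolP (size (g j) == n).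
    rewrite (big_pred1 (Tuple sg))//= => w; rewrite Qj /=.
    by apply/eqP/eqP => [gw|->//]; exact: val_inj.
  rewrite big_pred0 ?expR_ge0// => w; rewrite Qj /=; apply/eqP => gw.
  by rewrite gw size_tuple eqxx in sg.
rewrite (eq_bigl (fun j : J => true && ((j.2 : seq A) \in img k j.1.2)))//.
rewrite -(pair_big_dep xpredT (fun (pv : 'I_N * M.-tuple A) (s : (N * M).-tuple A) =>
  (s : seq A) \in img k pv.2) (fun pv s => expR (- letter_sum G s + 2 * N%:R * C))) /=.
apply: (@le_trans _ _ (\sum_(pv : 'I_N * M.-tuple A)
    expR (C * M%:R + 2 * N%:R * C))).
  apply: ler_sum => pv _; under eq_bigr do rewrite expRD.
  by rewrite -mulr_suml expRD ler_pM2r ?expR_gt0.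
rewrite sumr_const card_prod card_ord card_tuple -(mulr_natl (expR _)).
rewrite natrM natrX -[X in X * _ * _](@lnK _ N%:R) ?posrE//.
rewrite -[X in _ * X ^+ _ * _](@lnK _ #|A|%:R) ?posrE// -expRM_natl -!expRD ler_expR.
have MN : N%:R * M%:R <= n%:R + 2 * N%:R :> R by rewrite -!natrM -natrD ler_nat.
have : c * M%:R <= e * n%:R + 2 * c.
  rewrite -(ler_pM2l N0).
  have : c * (N%:R * M%:R) <= c * (n%:R + 2 * N%:R) by rewrite ler_wpM2l.
  have : c * n%:R <= e * N%:R * n%:R by rewrite ler_wpM2r.
  by nra.
by rewrite /c; nra.
Qed.

(** Each legal word contributes about [expR (- h * n)] to the partition function. *)
Lemma card_legal e : 0 < e -> exists B, forall n,
  #|legal n|%:R <= expR ((h + e) * n%:R + B).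
Proof.
move=> e0; have e2 : 0 < e / 2 by rewrite divr_gt0.
have [B1 H1] := partition_function e2; have [B2 H2] := potential_subword e2.
exists (B1 + B2) => n.
have -> : (h + e) * n%:R + (B1 + B2) =
  (e / 2 * n%:R + B1) + ((h + e / 2) * n%:R + B2) by lra.
rewrite expRD; apply: (le_trans _ (ler_wpM2r (expR_ge0 _) (H1 n))).
rewrite mulr_suml -sum1_card natr_sum; apply: ler_sum => w /asboolP[x Xx <-].
have := H2 x n Xx; rewrite -val_word ler_norml => /andP[_ ?].
by rewrite -expRD -[leLHS]/(1 : R) -[leLHS]expR0 ler_expR; lra.
Qed.

Lemma word_entropy_upper (nu : probability (borel_shift A) R) :
  invariant_probability X nu -> grows_at_most (word_entropy nu) h.
Proof.
move=> [X1 inv] e e0; have e2 : 0 < e / 2 by rewrite divr_gt0.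
have [B HB] := card_legal e2; have [J HJ] := length_unbounded l2 B e2.
exists (l ^ J)%N => n Jn.
have leg w : 0 < law nu (word n) w -> w \in [set w in legal n]%SET.
  move=> /(law_gt0_ex (subshift_measurable theta) X1 (@observable_word A n)) [x Xx xw].
  by rewrite inE; have : legal n w; [apply/asboolP; exists x|].
apply: (le_trans (obs_entropy_le_card (@observable_word A n) leg)).
rewrite cardsE; apply: (@le_trans _ _ ((h + e / 2) * n%:R + B)).
  have [z|z] := posnP #|legal n|.
    have := law_sum1 nu (@observable_word A n); rewrite big1 => [/eqP|w _].
      by rewrite eq_sym oner_eq0.
    apply/eqP; rewrite eq_le law_ge0 andbT leNgt; apply/negP => /leg.
    by rewrite inE => wl; move/card0_eq: z => /(_ w); rewrite wl.
  by rewrite -[leRHS]expRK ler_ln ?posrE ?expR_gt0 ?ltr0n.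
have : e / 2 * (l ^ J)%:R <= e / 2 * n%:R by rewrite ler_pM2l// ler_nat.
by have := HJ J (leqnn J); lra.
Qed.

End potential_theory.
Arguments legal {A} theta n w.
Arguments pressure_mean {R A} theta l G.

(** * Entropy of the frequency measure *)

Section gibbs_property.
Context {R : realType} {A : alphabetType} {theta : A -> {fset seq A}} {l : nat}.

Notation U := (uniform_weights theta : A -> seq A -> R).
Notation img := (iter_realisations theta).
Notation X := (subshift theta).

Hypothesis rs : random_substitution theta U.
Hypothesis hl : constant_length theta l.
Hypothesis l2 : (2 <= l)%N.
Hypothesis irr : exists k, forall a b, exists2 w,
  w \in img k [:: a] & b \in w.
Hypothesis rec : recognisable theta.

Let th0 a : theta a != fset0. Proof. by have [] := rs. Qed.
Let l_gt0 j : (0 < l ^ j)%N. Proof. by rewrite expn_gt0 (leq_trans _ l2). Qed.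

Variable G : A -> R.
Hypothesis G1 : forall a s, s \in theta a ->
  letter_sum G s = G a + log_choices theta a.
Hypothesis G2 : forall k a s t, s \in img k [:: a] -> t \in img k [:: a] ->
  letter_sum G s = letter_sum G t.
Local Notation h := (pressure_mean theta l G).

(** An occurrence of [w] in a level [k] image pins down the images of all but two
    of the letters it meets, and these images are independent. *)
Lemma occurrence_prob : exists K C : R, [/\ 1 <= K, 0 <= C,
  (forall a, `|G a| <= C) & forall k v w p, language theta v ->
  expect theta U k v (fun s => (prefix w (drop p s))%:R) <=
    K ^+ k * expR (C * (size w %/ l ^ k + 2 * l ^ k)%:R - letter_sum G w)].
Proof.
have [K K1 HK] := prob_le rs hl l2 irr rec G1; have [C C0 HC] := letter_bound G.
exists K, C; split => // k v w p Lv.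
pose N := (l ^ k)%N; rewrite -/N; pose n := size w; rewrite -/n.
have Kk : 1 <= K ^+ k by rewrite exprn_ege1.
set B := K ^+ k * _.
have B0 : 0 <= B by rewrite mulr_ge0 ?expR_ge0// (le_trans ler01).
have Gn := norm_letter_sum w HC; rewrite -/n in Gn.
have [nN|Nn] := ltnP n N.
  apply: (@le_trans _ _ 1).
    rewrite -[leRHS](expect_cst rs k v); apply: (le_expect rs) => s _.
    by case: prefix.
  rewrite -[leLHS]mulr1 ler_pM// -[leLHS]expR0 ler_expR subr_ge0.
  move: Gn; rewrite ler_norml => /andP[_] /le_trans; apply.
  rewrite ler_wpM2l// ler_nat (leq_trans (ltnW nN))//.
  by rewrite (leq_trans _ (leq_addl _ _))// leq_pmull.
have [pn|pn] := leqP (p + n) (N * size v); last first.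
  apply: le_trans B0; rewrite -[leRHS](expect_cst rs k v).
  apply: (le_expect rs) => s sk; rewrite -[leRHS]/(0%:R) ler_nat leqn0 eqb0.
  apply/negP => /size_prefix; rewrite size_drop (size_iter_realisations hl sk).
  by rewrite -/N -/n; lia.
pose m := (n %/ N).-1; pose i := (p %/ N).+1.
have N0 : (0 < N)%N by exact: l_gt0.
have nNm : (n %/ N = m.+1)%N by rewrite /m prednK// divn_gt0.
have mN : (m * N + N <= n)%N by have := leq_divM n N; rewrite nNm mulSn addnC.
have nm : (n < m * N + N + N)%N.
  by have := ltn_ceil n N0; rewrite nNm !mulSn; lia.
have ip : (p < i * N)%N by rewrite ltn_ceil.
have pi' : (i * N <= p + N)%N by rewrite mulSn addnC leq_add2r leq_divM.
have imv : (i + m <= size v)%N.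
  by rewrite -(leq_pmul2l N0) (leq_trans _ pn)// mulnC mulnDl; lia.
set f := fun s => _.
rewrite -(cat_take_drop i v) -(cat_take_drop m (drop i v)).
set v1 := take i v; set v2 := take m _; set v3 := drop m _.
have sv1 : size v1 = i by rewrite size_takel//; lia.
have sv2 : size v2 = m by rewrite size_takel// size_drop; lia.
have Lv2 : language theta v2.
  apply: (language_infix Lv); apply/infixP; exists v1, v3.
  by rewrite !cat_take_drop.
pose q := (i * N - p)%N; pose w' := take (m * N) (drop q w).
rewrite expect_cat; apply: (@le_trans _ _ (prob theta k v2 w')).
  rewrite -[leRHS](expect_cst rs k v1); apply: (le_expect rs) => s1 s1k.
  rewrite expect_cat; apply: (le_expect rs) => s2 s2k.
  rewrite -[leRHS](expect_cst rs k v3); apply: (le_expect rs) => s3 _.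
  rewrite /f; case: prefixP => [[r Hr]|_]; last by case: eqP.
  suff -> : s2 = w' by rewrite eqxx.
  have ss1 : size s1 = (i * N)%N by rewrite (size_iter_realisations hl s1k) sv1 mulnC.
  have ss2 : size s2 = (m * N)%N by rewrite (size_iter_realisations hl s2k) sv2 mulnC.
  have := congr1 (fun s => take (m * N) (drop q s)) Hr.
  rewrite drop_drop subnK; last exact: ltnW.
  rewrite (drop_size_cat _ ss1) (take_size_cat _ ss2) => ->; rewrite drop_cat.
  case: ltnP => qn; last first.
    have mN0 : (m * N = 0)%N by rewrite -/n /q in qn; lia.
    by rewrite /w' mN0 !take0.
  by rewrite takel_cat// size_drop -/n /q; lia.
apply: (le_trans (HK k v2 w' Lv2)); rewrite /B ler_pM2l; last by apply: lt_le_trans Kk.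
rewrite ler_expR.
have ew : w = take q w ++ (w' ++ drop (m * N) (drop q w)) by rewrite !cat_take_drop.
set a := take q w in ew; set b := drop (m * N) _ in ew.
have := norm_letter_sum a HC; have := norm_letter_sum b HC.
have := norm_letter_sum v2 HC; rewrite sv2.
have -> : letter_sum G w = letter_sum G a + (letter_sum G w' + letter_sum G b).
  by rewrite {1}ew !letter_sum_cat.
have sw' : size w' = (m * N)%N.
  by rewrite size_takel// size_drop -/n /q; lia.
have : C * ((size a)%:R + (size b)%:R + m%:R) <= C * (n %/ N + 2 * N)%:R.
  rewrite ler_wpM2l// -!natrD ler_nat nNm.
  have := congr1 size ew; rewrite !size_cat sw' -/n.
  by lia.
by rewrite !ler_norml => ? /andP[? ?] /andP[? ?] /andP[? ?]; lra.
Qed.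

Variable mu : probability (borel_shift A) R.
Hypothesis muX : invariant_probability (subshift theta) mu.
Hypothesis mu_freq : forall w : seq A,
  has_frequency theta U l (fun s => (occurrences w s)%:R)
    (pr mu [set x | subword x 0 (size w) = w]).

(** The measure of a word is the limit of its expected number of occurrences, each
    of which is controlled by [occurrence_prob] at a fixed level [k]. *)
Lemma cylinder_upper_bound : exists K C : R, [/\ 1 <= K, 0 <= C & forall k w,
  pr mu [set x | subword x 0 (size w) = w] <=
    K ^+ k * expR (C * (size w %/ l ^ k + 2 * l ^ k)%:R - letter_sum G w)].
Proof.
have [K [C [K1 C0 _ HB]]] := occurrence_prob.
exists K, C; split => // k w; set B := K ^+ k * _.
apply/ler_addgt0Pr => e e0; have [J HJ] := mu_freq w e0.
pose i := J.+1.
have Lk : 0 < (l ^ (i + k))%:R :> R by rewrite ltr0n l_gt0.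
have up : expect theta U (i + k) [:: point] (fun s => (occurrences w s)%:R) <=
    B * (l ^ (i + k))%:R.
  rewrite expect_add -[leRHS](expect_cst rs i [:: (point : A)]).
  apply: (le_expect rs) => v vi.
  have Lv : language theta v by exists i, point, v; rewrite infix_refl.
  have -> : B * (l ^ (i + k))%:R =
      \sum_(p <- iota 0 (l ^ (i + k))) B.
    by rewrite big_const_seq count_predT size_iota iter_addr_0 mulr_natr.
  rewrite (eq_expect (g := fun s =>
      \sum_(p <- iota 0 (l ^ (i + k))) (prefix w (drop p s))%:R)); last first.
    move=> s sk; rewrite /occurrences -sum1_count natr_sum big_mkcond /=.
    rewrite (size_iter_realisations hl sk) (size_iter_realisations hl vi) muln1.
    by rewrite -expnD addnC; apply: eq_bigr => p _; case: prefix.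
  by rewrite expect_sum; apply: ler_sum => p _; exact: HB.
have := HJ (i + k)%N (leq_trans (leqnSn J) (leq_addr _ _)) point.
rewrite ler_norml => /andP[lo _].
by rewrite -(ler_pM2r Lk); lra.
Qed.

(** The mean of [- ln (mu [w])] is at least the mean of the potential of [w], up to
    an error [C * n / l ^ k] which is small for large [k]. *)
Lemma word_entropy_lower : grows_at_least (word_entropy mu) h.
Proof.
move=> e e0; have [K [C [K1 C0 HB]]] := cylinder_upper_bound.
have e2 : 0 < e / 2 by rewrite divr_gt0.
have [k Hk] := length_unbounded l2 C e2; have {}Hk := Hk k (leqnn k).
pose N := (l ^ k)%N; rewrite -/N in Hk.
have K0 : 0 < K by apply: lt_le_trans K1.
pose D := k%:R * ln K + 2 * C * N%:R.
have [J HJ] := length_unbounded l2 D e2.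
exists (l ^ J)%N => n Jn.
have Nn : C * (n %/ N)%:R <= e / 2 * n%:R.
  have h1 : (n %/ N)%:R * N%:R <= n%:R :> R by rewrite -natrM ler_nat leq_divM.
  have h2 : C * (n %/ N)%:R <= e / 2 * N%:R * (n %/ N)%:R by rewrite ler_wpM2r.
  have : e / 2 * ((n %/ N)%:R * N%:R) <= e / 2 * n%:R by rewrite ler_pM2l.
  by lra.
have mw := @observable_word A n.
have lw (w : n.-tuple A) : 0 < law mu (word n) w ->
    letter_sum G w - (D + e / 2 * n%:R) <= - ln (law mu (word n) w).
  move=> w0; rewrite lerNr.
  have : law mu (word n) w <=
      K ^+ k * expR (C * (n %/ N + 2 * N)%:R - letter_sum G w).
    have := HB k w; rewrite size_tuple; apply: le_trans.
    rewrite /law le_eqVlt; apply/orP; left; apply/eqP; congr pr.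
    apply/seteqP; split=> x /=; first by move=> <-; rewrite val_word.
    by rewrite -val_word => xw; exact: val_inj.
  move=> le; apply: (@le_trans _ _
      (ln (K ^+ k * expR (C * (n %/ N + 2 * N)%:R - letter_sum G w)))).
    by rewrite ler_ln ?posrE// mulr_gt0 ?expR_gt0// exprn_gt0.
  rewrite lnM ?posrE ?exprn_gt0 ?expR_gt0// lnXn// expRK /D -mulr_natl natrD natrM.
  by lra.
have := mean_potential rs hl l2 irr rec G2 muX => mh.
apply: (@le_trans _ _ (mean mu (word n) (fun w => letter_sum G w - (D + e / 2 * n%:R)))).
  rewrite meanD mean_cst// (mean_word G muX) mh.
  have : e / 2 * (l ^ J)%:R <= e / 2 * n%:R by rewrite ler_pM2l// ler_nat.
  by have := HJ J (leqnn J); lra.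
apply: (@le_trans _ _ (mean mu (word n) (fun w => - ln (law mu (word n) w)))).
  exact: le_mean.
by rewrite /mean /word_entropy /obs_entropy -sumrN; apply: ler_sum => w _; rewrite mulrN.
Qed.

End gibbs_property.

(** * The block at the origin *)

Lemma observable_asbool (A : alphabetType) (E : set (borel_shift A)) :
  measurable E -> observable (fun x => `[< E x >]).
Proof.
move=> mE b; rewrite (_ : _ @^-1` _ = if b then E else ~` E).
  by case: b => //; exact: measurableC.
case: b; apply/seteqP; split=> x /=.
- by move=> /asboolP.
- by move=> Ex; apply/asboolP.
- by move=> H Ex; move: H; rewrite asboolT.
- by move=> H; rewrite asboolF.
Qed.

Lemma law_marginal (R : realType) (A : alphabetType)
    (nu : probability (borel_shift A) R) (I J : finType)
    (Phi : borel_shift A -> I) (Psi : borel_shift A -> J) b :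
  observable Phi -> observable Psi ->
  law nu Psi b = \sum_k law nu (fun x => (Phi x, Psi x)) (k, b).
Proof.
move=> mPhi mPsi; rewrite -[LHS]/(law nu (snd \o (fun x => (Phi x, Psi x))) b).
rewrite law_comp; last exact: observable_pair.
rewrite (reindex_onto (fun k : I => (k, b)) fst) /=; last by move=> [k c] /= /eqP ->.
by apply: eq_bigl => k; rewrite !eqxx.
Qed.

Section blocks.
Context {R : realType} {A : alphabetType} {theta : A -> {fset seq A}} {l : nat}.

Notation U := (uniform_weights theta : A -> seq A -> R).
Notation img := (iter_realisations theta).
Notation X := (subshift theta).

Hypothesis rs : random_substitution theta U.
Hypothesis hl : constant_length theta l.
Hypothesis l2 : (2 <= l)%N.
Hypothesis irr : exists k, forall a b, exists2 w,
  w \in img k [:: a] & b \in w.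
Hypothesis rec : recognisable theta.

Let th0 a : theta a != fset0. Proof. by have [] := rs. Qed.
Let l_gt0 j : (0 < l ^ j)%N. Proof. by rewrite expn_gt0 (leq_trans _ l2). Qed.

Variable j : nat.
Let N := (l ^ j)%N.
Let N_gt0 : (0 < N)%N. Proof. exact: l_gt0. Qed.
Notation Base := (base theta l j).
Implicit Types (x : borel_shift A).

(** The position of the origin in its level [j] block; the value 0 outside the
    subshift is a mere default. *)
Definition phase x : 'I_N := odflt (Ordinal N_gt0)
  [pick k : 'I_N | `[< exists a, Base a (left_shift (- (nat_of_ord k)%:Z) x) >]].

Definition base_letter x : A := odflt point [pick a | `[< Base a x >]].

(** The level [j] block at the origin, with the letter it comes from. *)
Definition block x : A * N.-tuple A :=
  let x' := left_shift (- (nat_of_ord (phase x))%:Z) x in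
  (base_letter x', word N x').

Lemma phaseP x : X x -> exists a, Base a (left_shift (- (nat_of_ord (phase x))%:Z) x).
Proof.
move=> Xx; rewrite /phase; case: pickP => [k /asboolP//|H].
have [k kN Hk] := base_ex th0 hl l2 rec j Xx.
by have /asboolP := H (Ordinal kN).
Qed.

Lemma phase_eq x a (k : 'I_N) : X x ->
  Base a (left_shift (- (nat_of_ord k)%:Z) x) -> phase x = k.
Proof.
move=> Xx xk; have [b xb] := phaseP Xx; apply: val_inj => /=.
by have [] := base_unique th0 hl l2 rec Xx (ltn_ord _) (ltn_ord _) xb xk.
Qed.

Lemma base_letter_eq x a : Base a x -> base_letter x = a.
Proof.
move=> xa; rewrite /base_letter; case: pickP => [b /asboolP xb|/(_ a)/asboolP//].
exact: (base_inj th0 hl l2 rec xb xa).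
Qed.

Lemma phase_block x i : X x ->
  phase (left_shift (i * N%:Z) x) = phase x.
Proof.
move=> Xx; have [a xa] := phaseP Xx.
have [y [_ _ Hy]] := base_orbit xa.
apply: (@phase_eq _ (y i)); first exact: subshift_shift.
by have := Hy i; rewrite !left_shiftD addrC.
Qed.

Lemma phase_shift x (k : 'I_N) : X x -> phase x = k <->
  phase (left_shift (- (nat_of_ord k)%:Z) x) = Ordinal N_gt0.
Proof.
move=> Xx; split=> [xk|xk].
  have [a xa] := phaseP Xx; apply: (@phase_eq _ a).
    exact: subshift_shift.
  by rewrite oppr0 left_shift0 -xk.
have [a] := phaseP (subshift_shift (- (nat_of_ord k)%:Z) Xx).
by rewrite xk oppr0 left_shift0; exact: phase_eq.
Qed.

Let observable_base : observable (fun x => [ffun a : A => `[< Base a x >]]).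
Proof.
by apply: observable_ffun => a; apply: observable_asbool; exact: base_measurable.
Qed.

Lemma observable_base_letter : observable base_letter.
Proof.
have := observable_comp (fun f : {ffun A -> bool} => odflt point [pick a | f a]) observable_base.
congr observable; apply/funext => x; rewrite /base_letter /=; congr odflt.
by apply: eq_pick => a; rewrite ffunE.
Qed.

Lemma observable_phase : observable phase.
Proof.
have mB : observable (fun x => [ffun k : 'I_N => (fun x => [ffun a : A => `[< Base a x >]])
    (left_shift (- (nat_of_ord k)%:Z) x)]).
  apply: observable_ffun => k; exact: (observable_shift (- (nat_of_ord k)%:Z) observable_base).
have := observable_comp (fun f : {ffun 'I_N -> {ffun A -> bool}} =>
  odflt (Ordinal N_gt0) [pick k : 'I_N | [exists a, f k a]]) mB.
congr observable; apply/funext => x; rewrite /phase /=; congr odflt.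
apply: eq_pick => k; rewrite ffunE; apply/existsP/asboolP => -[a].
  by rewrite ffunE => /asboolP xa; exists a.
by move=> xa; exists a; rewrite ffunE; apply/asboolP.
Qed.

Lemma observable_block : observable block.
Proof.
have mB : observable (fun x => [ffun k : 'I_N => (fun x => (base_letter x, word N x))
    (left_shift (- (nat_of_ord k)%:Z) x)]).
  apply: observable_ffun => k; apply: (observable_shift _
    (Phi := fun x => (base_letter x, word N x))).
  by apply: observable_pair; [exact: observable_base_letter|exact: observable_word].
have := observable_comp (fun p : 'I_N * {ffun 'I_N -> A * N.-tuple A} => p.2 p.1)
  (observable_pair observable_phase mB).
by congr observable; apply/funext => x; rewrite /= ffunE.
Qed.

(** The letters of consecutive blocks are those of the desubstituted point. *)
Lemma block_letters m x : X x -> exists2 y, X y &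
  word m y = [tuple (block (left_shift ((nat_of_ord i)%:Z * N%:Z) x)).1 | i < m].
Proof.
move=> Xx; have [a xa] := phaseP Xx; have [y [Xy _ Hy]] := base_orbit xa.
exists y => //; apply: eq_mktuple => i; rewrite /block /=.
apply/esym/base_letter_eq; rewrite phase_block//.
by have := Hy i%:Z; rewrite !left_shiftD addrC.
Qed.

Lemma block_realisation x : X x -> ((block x).2 : seq A) \in img j [:: (block x).1].
Proof.
move=> Xx; have [a xa] := phaseP Xx.
by rewrite /block (base_letter_eq xa) val_word; exact: base_word xa.
Qed.

Variable nu : probability (borel_shift A) R.
Hypothesis nuX : invariant_probability (subshift theta) nu.
Let inv := proj2 nuX.
Let mX := subshift_measurable theta.

(** The phase is uniform and independent of the block, because shifting by [k]
    carries the points of phase [k] to those of phase 0. *)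
Lemma phase_independent (E : set (borel_shift A)) (k : 'I_N) : measurable E ->
  pr nu [set x | E (left_shift (- (nat_of_ord (phase x))%:Z) x)] =
  N%:R * pr nu [set x | phase x = k /\ E (left_shift (- (nat_of_ord k)%:Z) x)].
Proof.
move=> mE; pose k0 := Ordinal N_gt0.
pose F (k : 'I_N) := [set x | phase x = k] `&` (left_shift (- (nat_of_ord k)%:Z) @^-1` E).
have mF k' : measurable (F k').
  by apply: measurableI; [exact: observable_phase|exact: left_shift_measurable].
have FE k' : pr nu (F k') = pr nu (F k0).
  rewrite -[RHS](pr_shift inv (- (nat_of_ord k')%:Z) (mF k0)).
  apply: (pr_eq_on mX (proj1 nuX)) => //; first exact: left_shift_measurable.
  apply/seteqP; split=> x [Xx [/= xk xE]]; split=> //; split=> /=.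
  - by apply/(phase_shift k' Xx).
  - by rewrite oppr0 left_shift0.
  - by apply/(phase_shift k' Xx).
  - by move: xE; rewrite oppr0 left_shift0.
have -> : [set x | E (left_shift (- (nat_of_ord (phase x))%:Z) x)] =
    \big[setU/set0]_(k : 'I_N) F k.
  apply/seteqP; split=> x /=.
    by move=> xE; rewrite (bigD1 (phase x))//=; left.
  elim/big_ind: _ => [//|P Q HP HQ [/HP//|/HQ//]|k' _ [/= <-]//].
transitivity (\sum_k' pr nu (F k')); last first.
  rewrite (eq_bigr (fun=> pr nu (F k))) => [|k' _]; last by rewrite FE [RHS]FE.
  by rewrite sumr_const card_ord mulr_natl.
elim: (index_enum _) (index_enum_uniq 'I_N) => [|k' s IH] /=.
  by rewrite !big_nil pr0.
move=> /andP[ks us]; rewrite !big_cons pr_disjointU ?IH//.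
  exact: bigsetU_measurable.
apply/seteqP; split=> // x [[/= xk _]] H.
suff : phase x \in s by rewrite xk (negPf ks).
elim: s {IH ks us} H => [|i s IH]; first by rewrite big_nil.
rewrite big_cons => -[[/= -> _]|/IH]; first by rewrite mem_head.
by rewrite inE orbC => ->.
Qed.

Lemma phase_uniform (k : 'I_N) : N%:R * pr nu [set x | phase x = k] = 1.
Proof.
have := @phase_independent setT k measurableT.
rewrite (_ : [set x | phase x = k /\ _] = [set x | phase x = k]); last first.
  by apply/seteqP; split=> x /=; [case|].
by move=> <-; rewrite -(prT nu); congr pr; apply/seteqP.
Qed.

(** As the phase is uniform, a uniformly chosen position of the block is a typical
    position of the point. *)
Lemma block_potential (G : A -> R) :
  mean nu block (fun p => letter_sum G p.2) =
  N%:R * mean nu (fun x => x 0) G.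
Proof.
transitivity (\sum_(k < N) mean nu block (fun p => G (tnth p.2 k))).
  rewrite -mean_sum; apply: eq_bigr => p _; congr (_ * _).
  by rewrite /letter_sum big_tuple.
have mb := observable_block.
have E (k : 'I_N) a : law nu ((fun p : A * N.-tuple A => tnth p.2 k) \o block) a =
    N%:R * pr nu [set x | phase x = k /\ x 0 = a].
  have ma : measurable [set x : borel_shift A | x (nat_of_ord k)%:Z = a].
    exact: (@observable_letter A (nat_of_ord k)%:Z).
  have := phase_independent k ma; rewrite /law.
  rewrite (_ : [set x | phase x = k /\ _] = [set x | phase x = k /\ x 0 = a]).
    move=> <-; congr pr; apply/seteqP; split=> x /=; by rewrite tnth_mktuple.
  by apply/seteqP; split=> x /=; rewrite /left_shift addrN.
under eq_bigr => k _ do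
  rewrite (@mean_comp _ _ nu _ _ (fun p : A * N.-tuple A => tnth p.2 k) _ G)//.
rewrite /mean exchange_big mulr_sumr; apply: eq_bigr => a _.
rewrite -mulr_suml mulrA; congr (_ * _).
rewrite (eq_bigr _ (fun k _ => E k a)) -mulr_sumr; congr (_ * _).
rewrite (law_marginal nu a observable_phase (@observable_letter A 0)).
apply: eq_bigr => k _; congr pr; apply/seteqP.
by split=> x /=; [case=> -> ->|case].
Qed.

(** The same averaging for occurrences; those that leave the block are at most
    [size w]. *)
Lemma block_occurrences (w : seq A) :
  `|mean nu block (fun p => (occurrences w p.2)%:R) -
    N%:R * pr nu [set x | subword x 0 (size w) = w]| <= (size w)%:R.
Proof.
pose W := [set x : borel_shift A | subword x 0 (size w) = w].
have mW : measurable W := local_measurable (@subword_local A (size w) w).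
have mb := observable_block.
pose D (k : 'I_N) := [set x | phase x = k /\ W x].
have mD k : measurable (D k).
  by apply: (measurableI _ _ (@observable_phase k) mW).
have sumD : pr nu W = \sum_k pr nu (D k).
  transitivity (law nu (fun x => `[< W x >]) true).
    by congr pr; apply/seteqP; split=> x /= /asboolP.
  rewrite (law_marginal nu true observable_phase (observable_asbool mW)).
  apply: eq_bigr => k _; congr pr.
  apply/seteqP; split=> x /= -[xk H]; last by rewrite xk asboolT.
  by split=> //; apply/asboolP.
have E (k : 'I_N) : mean nu block (fun p => (prefix w (drop k p.2))%:R) =
    if (k + size w <= N)%N then N%:R * pr nu (D k) else 0.
  rewrite (@mean_indicator _ _ nu _ _ (fun p : A * N.-tuple A => prefix w (drop k p.2)))//.
  case: ifPn => kw; last first.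
    rewrite (_ : [set x | _] = set0) ?pr0//; apply/seteqP; split=> // x /=.
    move=> /size_prefix; rewrite size_drop size_tuple card_ord.
    by rewrite (leq_subRL _ (ltnW (ltn_ord k))) => H; case/negP: kw.
  pose E := [set x : borel_shift A | prefix w (drop k (word N x))].
  have mE : measurable E.
    exact: (observable_pred (fun t : N.-tuple A => prefix w (drop k t)) (@observable_word A N)).
  rewrite -[LHS]/(pr nu [set x | E (left_shift (- (nat_of_ord (phase x))%:Z) x)]).
  rewrite (phase_independent k mE); congr (_ * pr nu _).
  have key x : prefix w (drop k (word N (left_shift (- (nat_of_ord k)%:Z) x))) =
      (subword x 0 (size w) == w).
    rewrite -[X in drop k X]/(val _) val_word subword_shift addr0.
    rewrite drop_subword ?(ltnW (ltn_ord k))// addNr prefixE take_subword//.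
    by rewrite (leq_subRL _ (ltnW (ltn_ord k))).
  apply/seteqP; split=> x [xk H]; split=> //.
    by apply/eqP; rewrite -key.
  by rewrite /E /mkset key; apply/eqP.
have -> : mean nu block (fun p => (occurrences w p.2)%:R) =
    \sum_(k < N) mean nu block (fun p => (prefix w (drop k p.2))%:R).
  rewrite -mean_sum; apply: eq_bigr => p _; congr (_ * _).
  rewrite /occurrences size_tuple -sum1_count natr_sum big_mkcond /=.
  rewrite -(big_mkord xpredT (fun k => (prefix w (drop k p.2))%:R)) /index_iota subn0.
  by apply: eq_bigr => k _; case: prefix.
rewrite sumD mulr_sumr -sumrB; apply: (le_trans (ler_norm_sum _ _ _)).
apply: (@le_trans _ _ (\sum_(k < N) (N <= k + size w)%:R)).
  apply: ler_sum => k _; rewrite E; case: ifPn => kw.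
    by rewrite subrr normr0.
  rewrite sub0r normrN ger0_norm ?mulr_ge0 ?pr_ge0//.
  rewrite leqNgt -leqNgt ltnW ?ltnNge// -[leRHS](phase_uniform k).
  rewrite ler_wpM2l//; apply: pr_le => //; first exact: observable_phase.
  by move=> x [].
rewrite (_ : \sum_(k < N) _ =
    (count (fun k => N <= k + size w)%N (iota 0 N))%:R).
  by rewrite ler_nat; exact: count_tail.
rewrite -(big_mkord xpredT (fun k => (N <= k + size w)%:R)) /index_iota subn0.
rewrite -sum1_count natr_sum [RHS]big_mkcond; apply: eq_bigr => k _.
by case: (N <= _)%N.
Qed.

End blocks.

(** * Measures of maximal entropy *)

Lemma slope_le0 (R : realType) (c C : R) (n0 : nat) :
  (forall n, (n0 <= n)%N -> n%:R * c <= C) -> c <= 0.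
Proof.
move=> H; rewrite leNgt; apply/negP => c0.
pose n := maxn n0 (Num.bound `|C / c|).
have := H n (leq_maxl _ _); rewrite -ler_pdivlMr// leNgt => /negP; apply.
apply: (le_lt_trans (ler_norm _)); apply: (lt_le_trans (archi_boundP _)) => //.
by rewrite ler_nat leq_maxr.
Qed.

Section block_entropy.
Context {R : realType} {A : alphabetType} {theta : A -> {fset seq A}} {l : nat}.

Notation U := (uniform_weights theta : A -> seq A -> R).
Notation img := (iter_realisations theta).
Notation X := (subshift theta).

Hypothesis rs : random_substitution theta U.
Hypothesis hl : constant_length theta l.
Hypothesis l2 : (2 <= l)%N.
Hypothesis irr : exists k, forall a b, exists2 w,
  w \in img k [:: a] & b \in w.
Hypothesis rec : recognisable theta.
Variable G : A -> R.
Hypothesis G1 : forall a s, s \in theta a ->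
  letter_sum G s = G a + log_choices theta a.
Hypothesis G2 : forall k a s t, s \in img k [:: a] -> t \in img k [:: a] ->
  letter_sum G s = letter_sum G t.
Local Notation h := (pressure_mean theta l G).

Variable nu : probability (borel_shift A) R.
Hypothesis nuX : invariant_probability (subshift theta) nu.
Let inv := proj2 nuX.
Let mX := subshift_measurable theta.

Hypothesis nuh : grows_at_least (word_entropy nu) h.

Section level.
Variable j : nat.
Let N := (l ^ j)%N.
Notation blk := (block (theta := theta) l2 j).
Let mblk : observable blk. Proof. exact: observable_block. Qed.
Let N_gt0 : (0 < N)%N. Proof. by rewrite expn_gt0 (leq_trans _ l2). Qed.

Let rho := law nu blk.
Let rho1 a := law nu (fst \o blk) a.

Let rho1E a : rho1 a = \sum_(p | p.1 == a) rho p.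
Proof. exact: law_comp. Qed.

Let rho_le p : rho p <= rho1 p.1.
Proof. by rewrite rho1E (bigD1 p)//= lerDl sumr_ge0// => q _; exact: law_ge0. Qed.

Let cond p : R := rho p / rho1 p.1.

Let cond_ge0 p : 0 <= cond p.
Proof. by rewrite divr_ge0// law_ge0. Qed.

Let cond_sum a : \sum_(p | p.1 == a) cond p <= 1.
Proof.
rewrite (eq_bigr (fun p => rho p / rho1 a)); last by move=> p /eqP <-.
rewrite -mulr_suml -rho1E; have [->|r0] := eqVneq (rho1 a) 0.
  by rewrite mul0r.
by rewrite divff.
Qed.

Let rho_realisation p : 0 < rho p -> (p.2 : seq A) \in img j [:: p.1].
Proof.
move=> /(law_gt0_ex mX (proj1 nuX) mblk) [x Xx <-].
exact: (block_realisation rs hl l2 rec j Xx).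
Qed.

(** Coding by phase, legal letter sequence and conditionally independent blocks:
    the entropy of words is at most the entropy of the letters, controlled by
    the partition function, plus one conditional block entropy per block. *)
Lemma word_entropy_le_blocks e : 0 < e -> exists B, forall m,
  word_entropy nu (m * N) <=
  B + m.+1%:R * (e + mean nu blk (fun p => G p.1 - ln (cond p))).
Proof.
move=> e0; have [B HB] := partition_function rs hl l2 rec G1 e0.
exists (ln N%:R + B) => m; pose M := m.+1.
pose Phi (x : borel_shift A) := (phase (theta := theta) l2 j x,
  [ffun i : 'I_M => blk (left_shift ((nat_of_ord i)%:Z * N%:Z) x)]).
have mPhi : observable Phi.
  apply: observable_pair; first exact: observable_phase.
  by apply: observable_ffun => i; exact: (observable_shift ((nat_of_ord i)%:Z * N%:Z) mblk).
pose J := ('I_N * {ffun 'I_M -> A * N.-tuple A})%type.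
pose letters (f : {ffun 'I_M -> A * N.-tuple A}) : M.-tuple A := [tuple (f i).1 | i < M].
pose F (u : M.-tuple A) : R :=
  if u \in legal theta M then expR (- letter_sum G u - (e * M%:R + B)) else 0.
have F0 u : 0 <= F u by rewrite /F; case: ifP => // _; exact: expR_ge0.
have F1 : \sum_u F u <= 1.
  rewrite /F -big_mkcond /=; under eq_bigr do rewrite expRB.
  by rewrite -mulr_suml ler_pdivrMr ?expR_gt0// mul1r HB.
(* uniform phase, letters weighted by [exp (- G)], blocks by their conditional
   law given the letters *)
pose q (p : J) : R := N%:R^-1 * (F (letters p.2) * \prod_i cond (p.2 i)).
have Nr : 0 < N%:R :> R by rewrite ltr0n.
have q0 p : 0 <= q p.
  by rewrite mulr_ge0 ?invr_ge0 ?mulr_ge0// prodr_ge0.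
have q1 : \sum_p q p <= 1.
  rewrite -(pair_bigA _ (fun k f => q (k, f))) /= /q /=.
  under eq_bigr do rewrite -mulr_sumr.
  rewrite -mulr_sumr sumr_const card_ord -[X in _ * X](mulr_natl _ N) mulrA.
  rewrite mulVf ?gt_eqF// mul1r.
  rewrite (partition_big letters xpredT)//=; apply: le_trans F1.
  apply: ler_sum => u _.
  rewrite (eq_bigr (fun f : {ffun 'I_M -> A * N.-tuple A} => F u * \prod_i cond (f i))); last first.
    by move=> f /eqP ->.
  rewrite -mulr_sumr -[leRHS]mulr1 ler_wpM2l//.
  rewrite (eq_bigl (fun f : {ffun 'I_M -> A * N.-tuple A} =>
    f \in family (fun i => [pred p : A * N.-tuple A | p.1 == tnth u i]))); last first.
    move=> f; apply/eqP/familyP => [<- i|H].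
      by rewrite inE tnth_mktuple.
    by apply: eq_from_tnth => i; rewrite tnth_mktuple; have := H i; rewrite inE => /eqP.
  rewrite -(bigA_distr_big_dep _ (fun _ p => cond p)) /=.
  apply: prodr_ile1 => i _; apply/andP; split; first by rewrite sumr_ge0.
  exact: cond_sum.
have legalPhi p : 0 < law nu Phi p -> letters p.2 \in legal theta M.
  move=> /(law_gt0_ex mX (proj1 nuX) mPhi) [x Xx <-].
  have [y Xy yx] := block_letters rs hl l2 rec j M Xx.
  suff : legal theta M (letters (Phi x).2) by [].
  apply/asboolP; exists y => //; rewrite yx; apply: eq_mktuple => i.
  by rewrite ffunE.
have blk_i i : (fun p : J => p.2 i) \o Phi =
    blk \o left_shift ((nat_of_ord i)%:Z * N%:Z).
  by apply/funext => x; rewrite /= ffunE.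
have law_i i b : law nu ((fun p : J => p.2 i) \o Phi) b = rho b.
  by rewrite blk_i (law_shift inv _ _ mblk).
have rhoPhi p i : 0 < law nu Phi p -> 0 < rho (p.2 i).
  move=> p0; apply: (lt_le_trans p0).
  rewrite -(law_i i) law_comp// (bigD1 p)//= lerDl.
  by rewrite sumr_ge0// => b _; exact: law_ge0.
have condPhi p i : 0 < law nu Phi p -> 0 < cond (p.2 i).
  move=> /(rhoPhi _ i) r0; rewrite divr_gt0//.
  exact: lt_le_trans (rho_le _).
have qPhi p : 0 < law nu Phi p -> 0 < q p.
  move=> p0; rewrite mulr_gt0 ?invr_gt0// mulr_gt0//.
    by rewrite /F legalPhi// expR_gt0.
  by apply: prodr_gt0 => i _; exact: condPhi.
(* the word at the origin is read off the blocks and the phase *)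
pose f (p : J) : (m * N).-tuple A :=
  [tuple nth point (p.2 (inord ((i + p.1) %/ N))).2 ((i + p.1) %% N) | i < m * N].
have wordf x : X x -> word (m * N) x = f (Phi x).
  move=> Xx; apply: eq_mktuple => i /=.
  set k := phase l2 j x; have kN : (k < N)%N := ltn_ord k.
  have iM : ((i + k) %/ N < M)%N.
    rewrite ltn_divLR// mulSn addnC; have := ltn_ord i.
    by move: kN; move: (m * N)%N (nat_of_ord i) (nat_of_ord k) => *; lia.
  rewrite ffunE inordK// /block (phase_block rs hl l2 rec)//= -/k.
  have rN : ((i + k) %% N < N)%N by rewrite ltn_mod.
  rewrite -[nth point _ _]/(nth point (val (word N _)) _) val_word nth_subword//.
  rewrite /left_shift; congr x.
  have e1 := divn_eq (i + k) N; move: e1.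
  move: (nat_of_ord i) (nat_of_ord k) => i' k'.
  move: ((i' + k') %/ N)%N ((i' + k') %% N)%N => d r; rewrite -PoszM.
  by move: (d * N)%N => dN; lia.
have -> : word_entropy nu (m * N) = obs_entropy nu (f \o Phi).
  rewrite /word_entropy /obs_entropy; congr (- _); apply: eq_bigr => w _.
  rewrite (law_eq_on mX (proj1 nuX) (Psi := f \o Phi))//.
    exact: observable_word.
  exact: observable_comp.
apply: (le_trans (@obs_entropy_le_cross _ _ nu _ _ f Phi q mPhi q0 qPhi q1)).
pose psi (p : A * N.-tuple A) := G p.1 - ln (cond p).
apply: (@le_trans _ _ (mean nu Phi (fun p => (ln N%:R + (e * M%:R + B)) +
    \sum_(i < M) psi (p.2 i)))).
  apply: le_mean => p p0; rewrite /q lnM ?posrE ?invr_gt0//; last first.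
    rewrite mulr_gt0//; first by rewrite /F legalPhi// expR_gt0.
    by apply: prodr_gt0 => i _; exact: condPhi.
  rewrite lnV ?posrE// lnM ?posrE; last 2 first.
  - by rewrite /F legalPhi// expR_gt0.
  - by apply: prodr_gt0 => i _; exact: condPhi.
  rewrite /F legalPhi// expRK sumrB.
  have -> : letter_sum G (letters p.2) = \sum_i G (p.2 i).1.
    rewrite /letter_sum big_tuple; apply: eq_bigr => i _.
    by rewrite tnth_mktuple.
  have -> : ln (\prod_i cond (p.2 i)) = \sum_i ln (cond (p.2 i)).
    by apply: ln_prod_pos => i; exact: condPhi.
  by lra.
rewrite meanD mean_cst// mean_sum.
have -> : \sum_(i < M) mean nu Phi (fun p => psi (p.2 i)) = M%:R * mean nu blk psi.
  rewrite mulr_natl -[X in _ *+ X]card_ord -sumr_const; apply: eq_bigr => i _.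
  rewrite (@mean_comp _ _ nu _ _ (fun p : J => p.2 i) Phi psi)//.
  by apply: eq_bigr => b _; rewrite law_i.
by rewrite -/M; lra.
Qed.

(** Divide [word_entropy_le_blocks] by [m] and let [m] grow. *)
Lemma block_entropy_ge :
  N%:R * h <= mean nu blk (fun p => G p.1 - ln (cond p)).
Proof.
set E := mean _ _ _.
have N1 : 0 < (N.+1)%:R :> R by rewrite ltr0n.
apply/ler_addgt0Pr => e e0; pose d := e / N.+1%:R.
have d0 : 0 < d by rewrite divr_gt0.
have [n0 Hn0] := nuh d0.
have [B HB] := word_entropy_le_blocks d0.
have : (h - d) * N%:R - d - E <= 0.
  apply: (@slope_le0 _ _ (B + d + E) n0) => m m0.
  have := HB m; rewrite -/N -/E => /(le_trans (Hn0 _ _)) H.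
  have := H (leq_trans m0 (leq_pmulr _ N_gt0)).
  by rewrite natrM -natr1; lra.
have : d * N.+1%:R = e by rewrite divfK ?gt_eqF.
by rewrite -natr1; lra.
Qed.

(** Blocks have mean potential [N * h] as well, so by [block_entropy_ge] and
    [prob_ge] the relative entropy of the law of the block, with respect to that of
    a random image of its letter, is at most 0: the equality case of Gibbs'
    inequality. *)
Lemma block_law_eq p : rho p = rho1 p.1 * prob theta j [:: p.1] p.2.
Proof.
pose q (p : A * N.-tuple A) : R := rho1 p.1 * prob theta j [:: p.1] p.2.
have r1 p' : 0 < rho p' -> 0 < rho1 p'.1 by move=> /lt_le_trans; apply.
have pg p' : 0 < rho p' ->
    expR (G p'.1 - letter_sum G p'.2) <= prob theta j [:: p'.1] p'.2.
  by move=> /rho_realisation /(prob_ge rs hl G1); rewrite letter_sum1.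
have pp p' : 0 < rho p' -> 0 < prob theta j [:: p'.1] p'.2 :> R.
  by move=> /pg; apply: lt_le_trans; exact: expR_gt0.
apply: (@gibbs_eq _ _ rho q) => [p'|p'|p' p0||].
- exact: law_ge0.
- by rewrite mulr_ge0 ?law_ge0 ?(prob_ge0 rs).
- by rewrite mulr_gt0 ?r1 ?pp.
- rewrite [leRHS](law_sum1 nu mblk) /q.
  rewrite -(pair_bigA _ (fun a s => rho1 a * prob theta j [:: a] (tval s))) /=.
  rewrite -(law_sum1 nu (observable_comp fst mblk)); apply: ler_sum => a _.
  rewrite -mulr_sumr; set S := \sum_s _.
  suff -> : S = 1 by rewrite mulr1.
  rewrite -(expect_cst rs j [:: a] 1) (expect_words (N := N)); last first.
    by move=> w /(size_iter_realisations hl); rewrite muln1.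
  by apply: eq_bigr => s _; rewrite mulr1.
- have H := block_entropy_ge.
  rewrite -(mean_potential rs hl l2 irr rec G2 nuX) in H.
  rewrite -(block_potential rs hl l2 rec j nuX) in H.
  rewrite -[leLHS]/(mean nu blk (fun p => ln (rho p))).
  rewrite -[leRHS]/(mean nu blk (fun p => ln (q p))).
  rewrite -[leLHS]addr0 -(subrr (mean nu blk (fun p => letter_sum G p.2))).
  apply: (@le_trans _ _ (mean nu blk (fun p => ln (rho p)) +
    (mean nu blk (fun p => G p.1 - ln (cond p)) -
     mean nu blk (fun p => letter_sum G p.2)))).
    by rewrite lerD2l lerD2r.
  rewrite -mulN1r -meanZ -!meanD; apply: le_mean => p' p0.
  rewrite /q /cond ln_div ?posrE ?r1// lnM ?posrE ?r1 ?pp//.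
  have := pg _ p0; rewrite -ler_ln ?posrE ?expR_gt0 ?pp// expRK.
  by lra.
Qed.

Lemma block_mean (f : seq A -> R) : mean nu blk (fun p => f p.2) =
  \sum_a rho1 a * expect theta U j [:: a] f.
Proof.
transitivity (\sum_(p : A * N.-tuple A)
    rho1 p.1 * prob theta j [:: p.1] p.2 * f p.2).
  by apply: eq_bigr => p _; rewrite -block_law_eq.
rewrite -(pair_bigA _ (fun a s => rho1 a * prob theta j [:: a] (tval s) * f s)) /=.
apply: eq_bigr => a _; rewrite (expect_words (N := N)).
  by rewrite mulr_sumr; apply: eq_bigr => s _; rewrite mulrA.
by move=> w /(size_iter_realisations hl); rewrite muln1.
Qed.

End level.

(** Up to [size w], the measure of [w] times [l ^ j] is the mean number of its
    occurrences in a block, which [block_mean] turns into expectations of the random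
    substitution. *)
Lemma word_measure_unique w lam :
  has_frequency theta U l (fun s => (occurrences w s)%:R) lam ->
  pr nu [set x | subword x 0 (size w) = w] = lam.
Proof.
move=> Hlam; set x := pr _ _.
apply/eqP; rewrite -subr_eq0 -normr_le0; apply/ler_addgt0Pr => e e0.
have e2 : 0 < e / 2 by rewrite divr_gt0.
have [J1 HJ1] := Hlam _ e2; have [J2 HJ2] := length_unbounded l2 (size w)%:R e2.
pose j := maxn J1 J2; pose L : R := (l ^ j)%:R.
have L0 : 0 < L by rewrite ltr0n expn_gt0 (leq_trans _ l2).
have := block_occurrences rs hl l2 rec j nuX w.
rewrite (block_mean j (fun s => (occurrences w s)%:R)) -/x -/L.
set M := \sum_a _ => HM.
have HM' : `|M - lam * L| <= e / 2 * L.
  have r1 := law_sum1 nu (observable_comp fst (@observable_block _ theta _ l2 j)).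
  pose p1 a := law nu (fst \o block (theta := theta) l2 j) a.
  have p1D c : c = \sum_a p1 a * c by rewrite -mulr_suml r1 mul1r.
  rewrite [lam * L]p1D /M -sumrB; apply: (le_trans (ler_norm_sum _ _ _)).
  rewrite [leRHS]p1D; apply: ler_sum => a _.
  rewrite -mulrBr normrM ger0_norm ?law_ge0// ler_wpM2l ?law_ge0//.
  by apply: HJ1; exact: leq_maxl.
have : L * `|x - lam| <= L * (0 + e).
  rewrite -[X in X * _ <= _](gtr0_norm L0) -normrM.
  have -> : L * (x - lam) = (M - lam * L) - (M - L * x) by ring.
  apply: (le_trans (ler_normB _ _)).
  have := HJ2 j (leq_maxr _ _); rewrite -/L => H2.
  by lra.
by rewrite ler_pM2l.
Qed.

End block_entropy.

(** A window is a word up to a shift, and local sets are finite unions of sets given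
    by a window. *)
Lemma invariant_probability_eq (R : realType) (A : alphabetType)
    (X : set (full_shift A)) (mu nu : probability (borel_shift A) R) :
  invariant_probability X mu -> invariant_probability X nu ->
  (forall w, pr mu [set x | subword x 0 (size w) = w] =
             pr nu [set x | subword x 0 (size w) = w]) ->
  forall B : set (borel_shift A), measurable B -> mu B = nu B.
Proof.
move=> [_ muI] [_ nuI] Hw; apply: probability_eq => n C Cn.
have mC : measurable (C : set (borel_shift A)) := local_measurable Cn.
rewrite !prE//; congr (_%:E).
pose Q (u : (n + n).+1.-tuple A) : bool := `[< exists2 x, C x & window n x = u >].
have CQ : C = [set x | Q (window n x)].
  apply/seteqP; split=> x /=; first by move=> Cx; apply/asboolP; exists x.
  by move=> /asboolP[y Cy /windowP yx]; exact: Cn yx Cy.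
rewrite CQ !pr_pred; try exact: observable_window.
apply: eq_bigr => u _.
have Eu (ka : probability (borel_shift A) R) :
    (forall B : set (borel_shift A), measurable B ->
      ka (left_shift 1 @^-1` B) = ka B) ->
    law ka (window n : borel_shift A -> _) u =
    pr ka [set x | subword x 0 (size u) = u].
  move=> kI; rewrite -(pr_shift kI (- n%:Z)); last first.
    exact: (local_measurable (@subword_local A (size u) u)).
  congr pr; apply/seteqP; split=> x /=.
    by move=> <-; rewrite subword_shift addr0 val_window size_tuple.
  by move=> H; apply: val_inj; rewrite val_window -[RHS]H subword_shift addr0 size_tuple.
by rewrite !Eu.
Qed.

(** * Topological entropy *)

Section topological_entropy.
Context {R : realType} {A : alphabetType} {theta : A -> {fset seq A}}.
Notation X := (subshift theta).
Implicit Types U : set (set (full_shift A)).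

Notation cover_number := (@cover_number R A X).

Lemma cover_number_le U m (f : 'I_m -> set (full_shift A)) :
  (forall i, U (f i)) -> X `<=` \bigcup_i f i -> cover_number U <= m%:R.
Proof.
move=> Uf Xf; apply: ge_inf; last by exists m => //; exists f.
by exists 0 => _ [k _ <-]; exact: ler0n.
Qed.

Lemma le_cover_number U c :
  (exists m, exists2 f : 'I_m -> set (full_shift A),
    forall i, U (f i) & X `<=` \bigcup_i f i) ->
  (forall m (f : 'I_m -> set (full_shift A)),
    (forall i, U (f i)) -> X `<=` \bigcup_i f i -> c <= m%:R) ->
  c <= cover_number U.
Proof.
move=> [m [f Uf Xf]] H; apply: lb_le_inf; first by exists m%:R, m => //; exists f.
by move=> _ [k [g Ug Xg] <-]; exact: H Ug Xg.
Qed.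

(** By compactness the member of [U] to which a point belongs can be chosen
    according to finitely many coordinates, hence the member of the join
    according to a slightly longer word. *)
Lemma subcover_legal U : open_cover X U -> exists n0, forall n,
  exists2 f : 'I_#|legal theta (n + (n0 + n0))| -> set (full_shift A),
    forall i, join_cover U n (f i) & X `<=` \bigcup_i f i.
Proof.
move=> [oU XU]; have [n0 Hn0] := lebesgue_window (@subshift_closed A theta) oU XU.
exists n0 => n; pose M := (n + (n0 + n0))%N.
have pt (i : 'I_#|legal theta M|) : {x : full_shift A | X x /\ word M x = enum_val i}.
  apply: cid; have := enum_valP i.
  by move=> /asboolP[x Xx xi]; exists x.
have mem (x : full_shift A) : {V : set (full_shift A) |
    X x -> U V /\ forall y, agree n0 x y -> V y}.
  apply: cid; have [Xx|] := pselect (X x); last by move=> H; exists set0.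
  by have [V UV HV] := Hn0 x Xx; exists V.
pose z i (k : 'I_n) : full_shift A := left_shift (nat_of_ord k + n0)%:Z (sval (pt i)).
have Xz i k : X (z i k) by apply: subshift_shift; have [] := svalP (pt i).
exists (fun i => \bigcap_(k : 'I_n)
    (left_shift (nat_of_ord k)%:Z @^-1` sval (mem (z i k)))).
  move=> i; exists (fun k => sval (mem (z i k))) => // k.
  by have [] := svalP (mem (z i k)) (Xz i k).
move=> y Xy; pose y' := left_shift (- n0%:Z) y.
have Ly : word M y' \in legal theta M.
  by apply/asboolP; exists y' => //; exact: subshift_shift.
exists (enum_rank_in Ly (word M y')) => // k _.
set i := enum_rank_in _ _.
have [_ /(_ (left_shift (nat_of_ord k)%:Z y))] := svalP (mem (z i k)) (Xz i k).
apply => j jn0; have [_] := svalP (pt i).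
rewrite [X in _ = X -> _](enum_rankK_in Ly Ly) => E.
have kn := ltn_ord k; have [p Hp] : exists p : nat, p%:Z = (nat_of_ord k + n0)%:Z + j :> int.
  exists (absz ((nat_of_ord k + n0)%:Z + j)); move: (nat_of_ord k) jn0 => k'; lia.
have pM : (p < M)%N by rewrite /M; move: (nat_of_ord k) kn jn0 Hp => k'; lia.
have := congr1 (fun t => tnth t (Ordinal pM)) E; rewrite !tnth_mktuple /=.
rewrite /z /y' /left_shift => e1.
rewrite [j + _]addrC -Hp e1; congr y.
by move: (nat_of_ord k) Hp => k'; lia.
Qed.

Variable h : R.
Hypothesis h0 : 0 <= h.
Hypothesis Hcard : forall e, 0 < e ->
  exists B, forall n, #|legal theta n|%:R <= expR ((h + e) * n%:R + B).

Lemma ln_cover_number_upper U : open_cover X U ->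
  grows_at_most (fun n => ln (cover_number (join_cover U n))) h.
Proof.
move=> oU e e0; have [n0 Hn0] := subcover_legal oU.
have e2 : 0 < e / 2 by rewrite divr_gt0.
have [B HB] := Hcard e2.
pose C := (h + e / 2) * (n0 + n0)%:R + B.
pose n1 := Num.bound (`|C| / (e / 2)).
have Hn1 : `|C| < e / 2 * n1%:R.
  rewrite mulrC -ltr_pdivrMr//; apply: archi_boundP.
  by rewrite divr_ge0// ltW.
exists n1 => n nn; have [f Uf Xf] := Hn0 n; have := cover_number_le Uf Xf.
set c := cover_number _ => cm.
have nn' : e / 2 * n1%:R <= e / 2 * n%:R by rewrite ler_pM2l// ler_nat.
have CC := ler_norm C.
have [c0|c0] := leP c 0.
  by rewrite ln0// mulr_ge0// addr_ge0// ltW.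
apply: (@le_trans _ _ ((h + e / 2) * n%:R + C)); last by lra.
rewrite -(expRK (_ + C)) ler_ln ?posrE ?expR_gt0//.
apply: (le_trans cm); apply: (le_trans (HB _)); rewrite ler_expR natrD /C.
by lra.
Qed.

Lemma cover_entropy_le U : open_cover X U -> (cover_entropy X U <= h%:E)%E.
Proof.
move=> oU; have H := ln_cover_number_upper oU; rewrite /cover_entropy.
set u := fun n => _; have [cu|ncu] := pselect (cvg (u @ \oo)); last first.
  by rewrite dvgP// lee_fin.
apply/lee_addgt0Pr => e e0; apply: lime_le => //.
have [n0 Hn0] := H e e0; exists n0.+1 => // n /= nn.
rewrite /u -EFinD lee_fin ler_pdivrMr ?ltr0n; last by lia.
by apply: Hn0; lia.
Qed.

Variable mu : probability (borel_shift A) R.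
Hypothesis muX : invariant_probability X mu.
Hypothesis Hmu : grows_at_least (word_entropy mu) h.

Definition letter_cover : set (set (full_shift A)) :=
  [set [set x : full_shift A | x 0 = a] | a in setT].

Lemma open_letter_cover : open_cover X letter_cover.
Proof.
split=> [_ [a _ <-]|x _].
  by apply: (@local_open _ 0%N) => x y /(_ 0 isT) /= <-.
by exists [set y : full_shift A | y 0 = x 0] => //; exists (x 0).
Qed.

(** A member of the join of the letter covers fixes a word, so a subcover with
    [m] members leaves at most [m] words. *)
Lemma word_entropy_le_cover n :
  word_entropy mu n <= ln (cover_number (join_cover letter_cover n)).
Proof.
have mX := subshift_measurable theta.
have [n0 Hn0] := subcover_legal open_letter_cover.
rewrite -(expRK (word_entropy mu n)).
suff H : expR (word_entropy mu n) <= cover_number (join_cover letter_cover n).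
  by rewrite ler_ln ?posrE ?expR_gt0// (lt_le_trans _ H) ?expR_gt0.
apply: le_cover_number; first by have [f] := Hn0 n; exists #|legal theta (n + (n0 + n0))|, f.
move=> m f Uf Xf.
have [u Hu] : {u : 'I_m -> n.-tuple A & forall i x, f i x -> word n x = u i}.
  apply: (@choice _ _ (fun i u => forall x, f i x -> word n x = u)) => i.
  have [g Ug ->] := Uf i.
  have [a Ha] : {a : 'I_n -> A & forall k, g k = [set x : full_shift A | x 0 = a k]}.
    apply: (@choice _ _ (fun k a => g k = [set x : full_shift A | x 0 = a])) => k.
    by have [a _ ak] := Ug k; exists a.
  exists [tuple a k | k < n] => x Hx; apply: eq_mktuple => k.
  by have := Hx k I; rewrite /= Ha /= /left_shift !add0r.
have Hm := obs_entropy_le_card (nu := mu) (S := [set u i | i : 'I_m]) (@observable_word A n).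
have m0 : (0 < m)%N.
  rewrite lt0n; apply/eqP => m0; have [X1 _] := muX.
  suff XE : X = set0 by move: X1; rewrite XE measure0 => /esym/eqP; rewrite onee_eq0.
  apply/seteqP; split=> // x /Xf [[i im] _ _].
  by move: im; rewrite m0.
have Sm : (#|[set u i | i : 'I_m]| <= m)%N.
  by rewrite (leq_trans (leq_imset_card _ _)) ?card_ord.
rewrite -(@lnK _ m%:R) ?posrE ?ltr0n// ler_expR; apply: (le_trans (Hm _)).
  move=> w /(law_gt0_ex mX (proj1 muX) (@observable_word A n)) [x Xx <-].
  by have [i _ /Hu ->] := Xf x Xx; exact: imset_f.
have [->|S0] := posnP #|[set u i | i : 'I_m]|; first by rewrite ln0// ln_ge0// ler1n.
by rewrite ler_ln ?posrE ?ltr0n// ler_nat.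
Qed.

Lemma topological_entropyE : topological_entropy X = h%:E.
Proof.
apply/eqP; rewrite eq_le; apply/andP; split.
  by apply: ge_ereal_sup => _ [U oU <-]; exact: cover_entropy_le.
apply: ereal_sup_ubound; exists letter_cover; first exact: open_letter_cover.
apply/cvg_lim => //; apply: cvg_EFin; first by near=> n.
apply/cvgrPdist_le => e e0.
have [n0 Hn0] := ln_cover_number_upper open_letter_cover e0.
have [n1 Hn1] := Hmu e0.
exists (maxn n0 n1).+1 => // n /= nn.
have n00 : 0 < n%:R :> R by rewrite ltr0n; lia.
have := Hn0 n ltac:(lia); rewrite -ler_pdivrMr// => h1.
have := le_trans (Hn1 n ltac:(lia)) (word_entropy_le_cover n).
rewrite -ler_pdivlMr// => h2; rewrite ler_norml.
by apply/andP; split; lra.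
Unshelve. all: by end_near. Qed.

End topological_entropy.

(** * Existence of potentials *)

Section potentials.
Context {R : realType} {A : alphabetType} {theta : A -> {fset seq A}} {l : nat}.
Variable P : A -> seq A -> R.
Notation img := (iter_realisations theta).
Hypothesis rs : random_substitution theta P.
Hypothesis hl : constant_length theta l.
Hypothesis l2 : (2 <= l)%N.

Let subst_expect a f :
  law_expectation (subst_law theta P [:: a]) f = expect theta P 1 [:: a] f.
Proof. by rewrite expectS expect0. Qed.

Let img1 a s : s \in img 1 [:: a] -> s \in theta a.
Proof.
by move=> /iter_realisationsS [v]; rewrite inE => /eqP ->; rewrite realisations1.
Qed.

Lemma subst_matrix_neq0 i j : subst_matrix theta P i j != 0 ->
  exists2 s, s \in theta (enum_val j) & enum_val i \in s.
Proof.
rewrite mxE subst_expect; apply: contraNP => H; apply/eqP.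
rewrite -[RHS](expect_cst rs 1 [:: enum_val j] 0); apply: eq_expect => s /img1 sj.
rewrite (count_memPn _)//; apply/negP => si; apply: H; by exists s.
Qed.

(** Powers of the substitution matrix are expected counts, so their nonzero entries
    come from actual occurrences. *)
Lemma subst_matrix_exp_neq0 k i j : (subst_matrix theta P ^+ k) i j != 0 ->
  exists2 w, w \in img k [:: enum_val j] & enum_val i \in w.
Proof.
elim: k j => [|k IH] j.
  rewrite expr0 mxE; have [->|] := eqVneq i j; last by rewrite eqxx.
  by move=> _; exists [:: enum_val j]; rewrite ?mem_seq1.
rewrite exprSr mxE => H.
have [t] : exists t, (subst_matrix theta P ^+ k) i t * subst_matrix theta P t j != 0.
  apply: contra_neqP H => H; apply: big1 => t _; apply/eqP/negPn/negP => Ht.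
  by apply: H; exists t.
rewrite mulf_eq0 negb_or => /andP[/IH[w wt iw] /subst_matrix_neq0[s sj]].
move=> ts; case/path.splitPr: ts sj => s1 s2 sj.
have th0 a : theta a != fset0 by have [] := rs.
have [w1 Hw1] := iter_realisations_ex th0 k s1.
have [w2 Hw2] := iter_realisations_ex th0 k s2.
exists (w1 ++ (w ++ w2)); last by rewrite !mem_cat iw orbT.
rewrite -add1n; apply/iter_realisationsD; exists (s1 ++ enum_val t :: s2).
  apply/iter_realisationsS; exists [:: enum_val j]; first by rewrite inE.
  by rewrite realisations1.
apply/iter_realisations_catP; exists w1, (w ++ w2); split=> //.
by rewrite -cat1s; apply/iter_realisations_catP; exists w, w2.
Qed.

Lemma primitive_irreducible : primitive theta P ->
  exists k, forall a b, exists2 w, w \in img k [:: a] & b \in w.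
Proof.
move=> [[k _ Hk] _]; exists k => a b.
have := subst_matrix_exp_neq0 (lt0r_neq0 (Hk (enum_rank b) (enum_rank a))).
by rewrite !enum_rankK.
Qed.

(** The first condition makes the uniform weights Gibbs weights for [G]; the second
    one makes the sums of [G] along images deterministic. *)
Definition is_potential (G : A -> R) :=
  (forall a s, s \in theta a -> letter_sum G s = G a + log_choices theta a) /\
  (forall k a s t, s \in img k [:: a] -> t \in img k [:: a] ->
    letter_sum G s = letter_sum G t).

Lemma potential_equal_cardinality :
  (forall a b, #|` theta a| = #|` theta b|) -> exists G, is_potential G.
Proof.
move=> E; pose c : R := log_choices theta point / (l%:R - 1).
exists (fun=> c); split=> [a s sa|k a s t sa ta].
  rewrite letter_sum_cst (hl sa).
  have -> : log_choices theta a = log_choices theta point :> R.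
    by rewrite /log_choices (E a point).
  have l1 : l%:R - 1 != 0 :> R by rewrite gt_eqF// subr_gt0 ltr1n.
  by rewrite -[in RHS](divfK l1 (log_choices theta point)) -/c; ring.
by rewrite !letter_sum_cst (size_iter_realisations hl sa) (size_iter_realisations hl ta).
Qed.

Lemma letter_sum_count (f : A -> R) v :
  letter_sum f v = \sum_b (count_mem b v)%:R * f b.
Proof.
elim: v => [|a v IH].
  by rewrite letter_sum_nil big1// => b _; rewrite mul0r.
rewrite letter_sum_cons IH (bigD1 a)//= [in RHS](bigD1 a)//= eqxx addrA.
rewrite natrD mulrDl mul1r; congr (_ + _); apply: eq_bigr => b ba.
by rewrite eq_sym (negPf ba).
Qed.

Section compatible.
Hypothesis comp : compatible theta.

Let letter_sum_images f a s t : s \in theta a -> t \in theta a ->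
  letter_sum f s = letter_sum f t :> R.
Proof.
move=> sa ta; rewrite !letter_sum_count; apply: eq_bigr => b _.
by rewrite (comp b sa ta).
Qed.

(** Every letter sum over an image is again a letter sum, of the transported
    function; so letter sums do not depend on the choices at any level. *)
Let transport (f : A -> R) a := letter_sum f (nth [::] (theta a) 0).

Let transportE f a s : s \in theta a -> letter_sum f s = transport f a.
Proof.
move=> sa; apply: (letter_sum_images f sa); apply: mem_nth.
by move: sa; rewrite -[s \in _]/(s \in (theta a : seq _)); case: (theta a : seq _).
Qed.

Let letter_sum_realisations f u s : s \in realisations theta u ->
  letter_sum f s = letter_sum (transport f) u.
Proof.
elim: u s => [|a u IH] s /=; first by rewrite inE => /eqP ->; rewrite !letter_sum_nil.
move=> /allpairsP[[s1 s2] [/= s1a /IH s2u ->]].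
by rewrite letter_sum_cat letter_sum_cons s2u (transportE f s1a).
Qed.

Lemma letter_sum_iter_realisations k f u s : s \in img k u ->
  letter_sum f s = letter_sum (iter k transport f) u.
Proof.
elim: k f s => [|k IH] f s; first by rewrite inE => /eqP ->.
move=> /iter_realisationsS[v vu /letter_sum_realisations ->].
by rewrite (IH _ _ vu) -iterSr.
Qed.

Lemma letter_sum_mx (g : 'rV[R]_#|A|) a s : s \in theta a ->
  letter_sum (fun b => g 0 (enum_rank b)) s =
  (g *m subst_matrix theta P) 0 (enum_rank a).
Proof.
move=> sa; rewrite letter_sum_count mxE (reindex (enum_val : 'I_#|A| -> A)) /=.
  apply: eq_bigr => i _; rewrite enum_valK mulrC mxE enum_rankK subst_expect.
  congr (_ * _); rewrite -[LHS](expect_cst rs 1 [:: a]); apply: eq_expect => t /img1 ta.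
  by rewrite (comp (enum_val i) sa ta).
exact: onW_bij (@enum_val_bij A).
Qed.

(** The equation defining the potential is linear, and solvable since [1] is not
    an eigenvalue of the substitution matrix. *)
Lemma potential_compatible : only_nonzero_eigenvalue theta P l%:R ->
  exists G, is_potential G.
Proof.
move=> only; pose M := subst_matrix theta P.
have Mu : M - 1%:M \in unitmx.
  rewrite -row_free_unit -kermx_eq0 -/(eigenspace M 1); apply/negPn/negP => M1.
  have : complex_eigenvalue M 1.
    rewrite /complex_eigenvalue -(rmorph1 (real_complex R)).
    by rewrite eigenvalue_map.
  move=> /(only 1 (oner_neq0 _)) /eqP; rewrite -(rmorph1 (real_complex R)).
  rewrite (inj_eq (fmorph_inj _)) => /eqP l1.
  have : 1 < l%:R :> R by rewrite ltr1n.
  by rewrite -l1 ltxx.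
pose L : 'rV[R]_#|A| := \row_i log_choices theta (enum_val i).
pose g := L *m invmx (M - 1%:M).
have gE : g *m M = g + L.
  by have := mulmxKV Mu L; rewrite -/g mulmxBr mulmx1 => /eqP; rewrite subr_eq addrC => /eqP.
exists (fun b => g 0 (enum_rank b)); split=> [a s sa|k a s t sa ta].
  by rewrite (letter_sum_mx _ sa) gE !mxE enum_rankK.
by rewrite (letter_sum_iter_realisations _ sa) (letter_sum_iter_realisations _ ta).
Qed.

End compatible.
End potentials.

(** * The theorem *)

Lemma frequency_measureP (R : realType) (A : alphabetType)
    (theta : A -> {fset seq A}) (P : A -> seq A -> R) (l : nat)
    (mu : probability (borel_shift A) R) :
  random_substitution theta P -> constant_length theta l -> (2 <= l)%N ->
  invariant_probability (subshift theta) mu ->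
  (forall w, has_frequency theta P l (fun s => (occurrences w s)%:R)
    (pr mu [set x | subword x 0 (size w) = w])) ->
  frequency_measure theta P mu.
Proof.
move=> rs hl l2 muX Hmu; split=> // v a _.
have mX := subshift_measurable theta.
have mV : measurable ([set x | subword x 0 (size v) = v] : set (borel_shift A)).
  exact: (local_measurable (@subword_local A (size v) v)).
have -> : fine (mu (cylinder theta v)) = pr mu [set x | subword x 0 (size v) = v].
  apply: (pr_eq_on mX (proj1 muX)) => //; first exact: (measurableI _ _ mX mV).
  by rewrite setIA setIid.
have sizeE k : law_expectation (iter_law theta P k [:: a]) (fun w => (size w)%:R) =
    (l ^ k)%:R.
  rewrite -[LHS]/(expect theta P k [:: a] (fun w => (size w)%:R)).
  rewrite -[RHS](expect_cst rs k [:: a]); apply: eq_expect => w.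
  by move=> /(size_iter_realisations hl) ->; rewrite muln1.
apply/cvgrPdist_le => e e0; have [J HJ] := Hmu v e e0.
exists J => // k /= Jk; have := HJ k Jk a.
have L0 : 0 < (l ^ k)%:R :> R by rewrite ltr0n expn_gt0 (leq_trans _ l2).
rewrite distrC sizeE /expect.
set E := law_expectation _ _; set p := pr _ _.
have -> : p - E / (l ^ k)%:R = (p * (l ^ k)%:R - E) / (l ^ k)%:R.
  by rewrite mulrBl mulfK ?gt_eqF.
by rewrite normrM normfV (gtr0_norm L0) ler_pdivrMr.
Qed.

Theorem theorem4p8 (R : realType) (A : alphabetType)
    (theta : A -> {fset seq A}) (P : A -> seq A -> R) (l : nat)
    (htheta : random_substitution theta P)
    (hl : (2 <= l)%N)
    (hlength : constant_length theta l)
    (hprim : primitive theta P)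
    (hrec : recognisable theta)
    (hcase : (forall a b : A, #|` theta a| = #|` theta b|) \/
             (compatible theta /\ only_nonzero_eigenvalue theta P l%:R)) :
  exists mu : probability (borel_shift A) R,
    [/\ maximal_entropy (subshift theta) mu,
        forall nu : probability (borel_shift A) R,
          maximal_entropy (subshift theta) nu ->
          forall B : set (borel_shift A), measurable B -> nu B = mu B
      & frequency_measure theta (uniform_weights theta) mu].
Proof.
have rsU := uniform_random_substitution htheta.
have irr := primitive_irreducible htheta hprim.
have [G [G1 G2]] : exists G : A -> R, is_potential (theta := theta) G.
  case: hcase => [E|[comp only]]; first exact: (potential_equal_cardinality hlength hl E).
  exact: (potential_compatible htheta hl comp only).
have [mu [muX Hmu]] := frequency_measure_ex rsU hlength hl irr.
pose h := pressure_mean theta l G.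
have upper nu nuX := word_entropy_upper rsU hlength hl irr hrec G1 G2 (nu := nu) nuX.
have lower := word_entropy_lower rsU hlength hl irr hrec G1 G2 muX Hmu.
have h0 : 0 <= h.
  apply/ler_addgt0Pr => e e0; have [n0 Hn0] := upper mu muX e e0.
  have n1 : 0 < n0.+1%:R :> R by rewrite ltr0n.
  rewrite -(pmulr_lge0 _ n1); apply: le_trans (Hn0 _ (leqnSn n0)).
  exact: (obs_entropy_ge0 mu (@observable_word A n0.+1)).
have top : topological_entropy (subshift theta) = h%:E.
  apply: (topological_entropyE h0 _ muX lower).
  exact: (card_legal rsU hlength hl irr hrec G1 G2).
exists mu; split.
- split=> //; rewrite top; apply/eqP; rewrite eq_le; apply/andP; split.
    exact: (measure_entropy_le (proj2 muX) h0 (upper mu muX)).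
  exact: (measure_entropy_ge (upper mu muX) lower).
- move=> nu [nuX nuh]; apply: (invariant_probability_eq nuX muX) => w.
  apply: (word_measure_unique rsU hlength hl irr hrec G1 G2 nuX _ (Hmu w)).
  by apply: (le_measure_entropy (proj2 nuX)); rewrite nuh top.
- exact: frequency_measureP rsU hlength hl muX Hmu.
Qed.
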